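(* Let $\mathcal{N}_{A\rightarrow BE}$ be a quantum channel (an isometric extension of a channel $A\to B$, with $E$ the environment/eavesdropper). Fix $\epsilon\in(0,1)$, $\epsilon'\in(0,1)$, $\delta\in(0,\epsilon)$ and $\delta'\in(0,\epsilon')$. Suppose there exist a probability distribution $p_{X,Y}$ on finite alphabets $\mathcal{X}\times\mathcal{Y}$ and input states $\{\rho_A^{x,y}\}$, giving the state $\rho_{XYBE}=\sum_{x,y}p_{X,Y}(x,y)|x\rangle\langle x|_X\otimes|y\rangle\langle y|_Y\otimes\mathcal{N}_{A\to BE}(\rho_A^{x,y})$, such that the pair $(r,R)$ satisfies $$r\leq I_{H}^{\epsilon-\delta}(X;B)_\rho-\log_{2}\Big(\frac{4\epsilon}{\delta^{2}}\Big),$$ $$R\leq I_{H}^{\epsilon-\delta}(Y;B|X)_\rho-\tilde{I}_{max}^{\sqrt{\epsilon'}-\delta'}(Y;E|X)_\rho-\log_{2}\Big(\frac{4\epsilon}{\delta^{2}}\Big)-2\log_{2}\Big(\frac{1}{\delta'}\Big).$$ Then there exists a one-shot $(r,R,\,3\epsilon+2\sqrt{\epsilon}+\sqrt{\epsilon'},\,2(\epsilon+\sqrt{\epsilon})+\sqrt{\epsilon'})$ simultaneous public-private code for $\mathcal{N}_{A\rightarrow BE}$.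
   Context: All systems are finite-dimensional and $\log=\log_2$. For states $\rho,\sigma$: fidelity $F(\rho,\sigma)=\|\sqrt{\rho}\sqrt{\sigma}\|_1$; purified distance $P(\rho,\sigma)=\sqrt{1-F(\rho,\sigma)^2}$; $\mathcal{B}^\eta(\rho)=\{\rho' \text{ state}: P(\rho',\rho)\le\eta\}$. Hypothesis testing relative entropy: $D_H^\eta(\rho\|\sigma)=-\log_2\inf\{\mathrm{Tr}(T\sigma): 0\le T\le \mathbb{1},\ \mathrm{Tr}((\mathbb{1}-T)\rho)\le\eta\}$, and $I_H^\eta(A;B)_\rho=D_H^\eta(\rho_{AB}\|\rho_A\otimes\rho_B)$. Max-relative entropy: $D_{max}(\rho\|\sigma)=\inf\{\lambda\in\mathbb{R}:\rho\le 2^\lambda\sigma\}$. For a classical-quantum state $\rho_{XYE}=\sum_x p_X(x)|x\rangle\langle x|\otimes\rho^x_{YE}$ (similarly $\rho_{XYB}$): $I_H^\eta(Y;B|X)_\rho=\max_{\rho'_X}\min_{x\in\mathrm{supp}(\rho'_X)} I_H^\eta(Y;B)_{\rho^x_{YB}}$, the maximum over classical states $\rho'_X=\sum_x p'(x)|x\rangle\langle x|$ with $P(\rho'_X,\rho_X)\le\eta$; and $\tilde{I}_{max}^\eta(Y;E|X)_\rho=\min_{\rho'_X}\max_{x\in\mathrm{supp}(\rho'_X)}\inf_{\tilde\rho_{YE}\in\mathcal{B}^\eta(\rho^x_{YE})}D_{max}(\tilde\rho_{YE}\|\rho^x_Y\otimes\tilde\rho_E)$, the minimum over classical $\rho'_X$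 with $P(\rho'_X,\rho_X)\le\eta$. A one-shot $(r,R,\epsilon_1,\epsilon_2)$ simultaneous public-private code for $\mathcal{N}_{A\to BE}$, with message sets $\mathcal{M},\mathcal{L}$ of sizes $|\mathcal{M}|=2^r$, $|\mathcal{L}|=2^R$ and public message $M$ and private message $L$ independent and uniformly distributed, consists of an encoding $\mathcal{E}:\mathcal{M}\times\mathcal{L}\to\mathcal{D}(\mathcal{H}_A)$ and a decoding measurement $\mathcal{D}$ on $B$ outputting $(\hat M,\hat L)$ such that $\Pr((\hat M,\hat L)\ne(M,L))\le\epsilon_1$ and, for every $m\in\mathcal{M}$, $\frac12\|\rho^m_{LE}-\rho_L\otimes\tilde\rho^m_E\|_1\le\epsilon_2$ for some state $\tilde\rho^m_E$, where $\rho^m_{LBE}=\frac{1}{|\mathcal{L}|}\sum_{\ell}|\ell\rangle\langle\ell|_L\otimes\mathcal{N}_{A\to BE}(\mathcal{E}(m,\ell))$. *)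

(* Defs.v *)
From HB Require Import structures.
From mathcomp Require Import all_boot all_order all_algebra.
From mathcomp Require Import boolp classical_sets reals ereal sequences exp.
From mathcomp Require Import complex mxtens.

Set Implicit Arguments.
Unset Strict Implicit.
Unset Printing Implicit Defensive.

Import Order.TTheory GRing.Theory Num.Theory.
Local Open Scope ring_scope.

Section QuantumDefs.
Variable R : realType.
Local Notation C := (R[i]).
Definition reC (z : C) : R := complex.Re z.
Definition toC (x : R) : C := (x%:C)%C.

Definition adjmx m n (A : 'M[C]_(m, n)) : 'M[C]_(n, m) := (map_mx (@conjc R) A)^T.

Definition psdmx n (A : 'M[C]_n) : Prop :=
  forall v : 'cV[C]_n, 0 <= (adjmx v *m A *m v) 0 0.

Definition is_state n (rho : 'M[C]_n) : Prop := psdmx rho /\ \tr rho = 1.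

Definition mx_sqrt n (A : 'M[C]_n) : 'M[C]_n :=
  xget 0 [set B | psdmx B /\ B *m B = A].

Definition trnorm m n (A : 'M[C]_(m, n)) : R :=
  reC (\tr (mx_sqrt (adjmx A *m A))).

Definition fidelity n (rho sigma : 'M[C]_n) : R :=
  trnorm (mx_sqrt rho *m mx_sqrt sigma).

Definition pdist n (rho sigma : 'M[C]_n) : R :=
  Num.sqrt (1 - fidelity rho sigma ^+ 2).

Definition log2 (x : R) : R := ln x / ln 2.
Definition pow2 (l : R) : R := expR (l * ln 2).

(* Tensor products: 'M_(m * n) is H_1 (x) H_2 with index (i,j) |-> i * n + j
   (tensmx from mathcomp-real-closed). *)
Definition blk m n (M : 'M[C]_(m * n)) (i j : 'I_m) : 'M[C]_n :=
  \matrix_(a, b) M (mxtens_index (i, a)) (mxtens_index (j, b)).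

Definition ptrace2 m n (M : 'M[C]_(m * n)) : 'M[C]_m :=
  \matrix_(i, j) \tr (blk M i j).

Definition ptrace1 m n (M : 'M[C]_(m * n)) : 'M[C]_n :=
  \sum_(i < m) blk M i i.

Definition idtens m n k (f : 'M[C]_n -> 'M[C]_k) (M : 'M[C]_(m * n)) :
  'M[C]_(m * k) :=
  \sum_(i < m) \sum_(j < m) tensmx (delta_mx i j) (f (blk M i j)).

Definition DH n (eta : R) (rho sigma : 'M[C]_n) : \bar R :=
  let mn := inf [set reC (\tr (T *m sigma)) | T in
                 [set T : 'M[C]_n | psdmx T /\ psdmx (1%:M - T) /\
                                    reC (\tr ((1%:M - T) *m rho)) <= eta]] in
  if mn == 0 then +oo%E else (- log2 mn)%:E.

Definition IH m n (eta : R) (rhoAB : 'M[C]_(m * n)) : \bar R :=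
  DH eta rhoAB (tensmx (ptrace2 rhoAB) (ptrace1 rhoAB)).

Definition Dmax n (rho sigma : 'M[C]_n) : \bar R :=
  ereal_inf [set l%:E | l in [set l : R | psdmx (toC (pow2 l) *: sigma - rho)]].

Definition is_distr n (p : 'I_n -> R) : Prop :=
  (forall i, 0 <= p i) /\ \sum_(i < n) p i = 1.
Definition cstate n (p : 'I_n -> R) : 'M[C]_n := diag_mx (\row_i toC (p i)).

(* For a cq state rho_XYB = sum_x p_X(x)|x><x| (x) rho^x_YB :
   p_X(x) = <x|rho_X|x> and rho^x_YB = blk rho_XYB x x / p_X(x). *)
Definition cq_prob m n (rhoXQ : 'M[C]_(m * n)) (x : 'I_m) : R :=
  reC (ptrace2 rhoXQ x x).
Definition cq_cond m n (rhoXQ : 'M[C]_(m * n)) (x : 'I_m) : 'M[C]_n :=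
  toC ((cq_prob rhoXQ x)^-1) *: blk rhoXQ x x.

(* I_H^eta(Y;B|X)_rho for rho_XYB, rho_XYB : 'M_(nX * (nY * dB)).
   The min ranges over x in supp rho'_X where the conditional state rho^x is
   defined, i.e. p_X(x) > 0. *)
Definition IHcond nX nY dB (eta : R) (rhoXYB : 'M[C]_(nX * (nY * dB))) : \bar R :=
  ereal_sup [set ereal_inf [set IH eta (cq_cond rhoXYB x) | x in
                    [set x | 0 < p' x /\ 0 < cq_prob rhoXYB x]]
            | p' in [set p' : 'I_nX -> R | is_distr p' /\
                       pdist (cstate p') (ptrace2 rhoXYB) <= eta]].

Definition Imaxcond nX nY dE (eta : R) (rhoXYE : 'M[C]_(nX * (nY * dE))) : \bar R :=
  ereal_inf [set ereal_sup [set
        ereal_inf [set Dmax rt (tensmx (ptrace2 (cq_cond rhoXYE x)) (ptrace1 rt))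
                  | rt in [set rt : 'M[C]_(nY * dE) | is_state rt /\
                              pdist rt (cq_cond rhoXYE x) <= eta]]
        | x in [set x | 0 < p' x /\ 0 < cq_prob rhoXYE x]]
            | p' in [set p' : 'I_nX -> R | is_distr p' /\
                       pdist (cstate p') (ptrace2 rhoXYE) <= eta]].

(* The channel N_{A->BE} is given by an isometry V : H_A -> H_B (x) H_E. *)
Definition is_isometry dA dBE (V : 'M[C]_(dBE, dA)) : Prop := adjmx V *m V = 1%:M.
Definition chan dA dBE (V : 'M[C]_(dBE, dA)) (rho : 'M[C]_dA) : 'M[C]_dBE :=
  V *m rho *m adjmx V.

Definition rhoXYBE dA dB dE nX nY (V : 'M[C]_(dB * dE, dA))
  (pXY : 'I_nX -> 'I_nY -> R) (rhoA : 'I_nX -> 'I_nY -> 'M[C]_dA) :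
  'M[C]_(nX * (nY * (dB * dE))) :=
  \sum_(x < nX) \sum_(y < nY)
     toC (pXY x y) *: tensmx (delta_mx x x) (tensmx (delta_mx y y) (chan V (rhoA x y))).

(* One-shot (r,R,e1,e2) simultaneous public-private code with |M| = nM = 2^r,
   |L| = nL = 2^R. enc m l is the encoded input state; dec m l the POVM element
   for outcome (m,l). *)
Definition is_pp_code dA dB dE (V : 'M[C]_(dB * dE, dA)) (nM nL : nat)
  (enc : 'I_nM -> 'I_nL -> 'M[C]_dA) (dec : 'I_nM -> 'I_nL -> 'M[C]_dB)
  (e1 e2 : R) : Prop :=
  (forall m l, is_state (enc m l)) /\
  (forall m l, psdmx (dec m l)) /\
  \sum_(m < nM) \sum_(l < nL) dec m l = 1%:M /\
  \sum_(m < nM) \sum_(l < nL) (nM%:R * nL%:R)^-1 *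
     \sum_(m' < nM) \sum_(l' < nL | (m', l') != (m, l))
        reC (\tr (dec m' l' *m ptrace2 (chan V (enc m l)))) <= e1 /\
  (forall m : 'I_nM,
     let rhoLE : 'M[C]_(nL * dE) :=
       \sum_(l < nL) toC (nL%:R^-1) *: tensmx (delta_mx l l) (ptrace1 (chan V (enc m l))) in
     exists sigmaE : 'M[C]_dE, is_state sigmaE /\
       2^-1 * trnorm (rhoLE - tensmx (ptrace2 rhoLE) sigmaE) <= e2).

End QuantumDefs.

(* Main.v *)
Require Import Defs.
From HB Require Import structures.
From mathcomp Require Import all_boot all_order all_algebra.
From mathcomp Require Import boolp classical_sets reals ereal sequences exp.
From mathcomp Require Import complex mxtens spectral ring lra.

Set Implicit Arguments.
Unset Strict Implicit.
Unset Printing Implicit Defensive.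

Import Order.TTheory GRing.Theory Num.Theory.
Local Open Scope ring_scope.

(* Random coding at two levels. Every public message [m] gets a codebook: a
   symbol [x_m] and, given [x_m], independent symbols [y_(l,k)], where [l] is the
   private message and [k] a dummy index chosen by the encoder. The receiver
   first decodes [m], then [(l,k)]; both measurements are square-root
   measurements analysed with the Hayashi-Nagaoka inequality, and their
   composition loses only a constant factor. Averaging over [k] hides [l] from
   the eavesdropper, by a second-moment bound on the empirical mean of the
   smoothed states.

   Secrecy has to hold for every [m]. Codebooks are therefore drawn from the
   distribution conditioned on [x_m] being admissible for both conditional
   entropies and on the secrecy bound [S = 2 (eps + sqrt eps) + sqrt eps'].
   Let [u = sqrt eps'], [w = 1 - u], [h] the probability of an admissible symbol
   and [g = 1 - u / S] the Markov bound for secrecy. The conditioning costs a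
   factor [1 / (h g)] in the probability that the public test of a message
   rejects its own state, [1 / (h^2 g)] in the pairwise false acceptances, and
   [1 / g] in the private error. This is affordable because [S < 1] forces
   [2 sqrt eps < w] and because only a fraction [w] of the public messages has
   to be decodable, which gains a factor [w] in the pairwise terms. If [S >= 1]
   a constant encoder works. *)

(** * Positive semidefinite matrices *)

(** Secrecy is required of each single [m] while the number of messages is prescribed, so bad
    messages cannot simply be deleted. Conditioning each codeword separately keeps different
    messages independent, and pairwise false acceptances still reduce to a test on a product of
    marginals. The conditioned law is normalised symbol by symbol: secrecy then leaves the law of
    the admissible [x_m] untouched, and as a public test depends only on its symbol, a pair of
    messages pays [1 / g] only once. The losses fix the constants. With [a = sqrt eps] one has
    [S - u = 2 a (1 + a)], so [g] is of order [a / S] and an error [eps / g] is of order [sqrt eps].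
    The two smoothings only guarantee [h >= 1 - eps^2 - u^2], which for [u] near 1 is comparable to
    [w]; giving up the share [u] of the public messages costs the term [sqrt eps'] and supplies the
    factors [w] that cancel [1 / h]. The penalty [4 eps / delta^2] is such that a suitable
    Hayashi-Nagaoka parameter turns [eps - delta] into exactly [eps]. *)

Section Positivity.
Variable R : realType.
Local Notation C := (R[i]).
Local Notation toC := (@toC R).
Local Notation adj := (@adjmx R _ _).

Lemma reCD (x y : C) : reC (x + y) = reC x + reC y.
Proof. by case: x y => [a b] [c d]. Qed.

Lemma reCN (x : C) : reC (- x) = - reC x.
Proof. by case: x. Qed.

Lemma reC0 : reC (0 : C) = 0. Proof. by []. Qed.

Lemma reC_sum I (r : seq I) (P : pred I) (F : I -> C) :
  reC (\sum_(i <- r | P i) F i) = \sum_(i <- r | P i) reC (F i).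
Proof. exact: (big_morph _ reCD reC0). Qed.

Lemma reCZ (a : R) (x : C) : reC (toC a * x) = a * reC x.
Proof. by case: x => b c; rewrite /reC /Defs.toC /=; simpc. Qed.

Lemma reC_conj (x : C) : reC (conjc x) = reC x. Proof. by case: x. Qed.

Lemma reC_ge0 (x : C) : 0 <= x -> 0 <= reC x.
Proof. by rewrite lecE => /andP[]. Qed.

Lemma toC_reC (x : C) : 0 <= x -> x = toC (reC x).
Proof. by case: x => a b /ger0_Im /= ->. Qed.

Lemma toCD (a b : R) : toC (a + b) = toC a + toC b.
Proof. exact: rmorphD. Qed.

Lemma toCM (a b : R) : toC (a * b) = toC a * toC b.
Proof. exact: rmorphM. Qed.

Lemma toC1 : toC 1 = 1. Proof. by []. Qed.
Lemma toC0 : toC 0 = 0. Proof. by []. Qed.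

Lemma toC_sum I (r : seq I) (P : pred I) (F : I -> R) :
  toC (\sum_(i <- r | P i) F i) = \sum_(i <- r | P i) toC (F i).
Proof. exact: (big_morph _ toCD toC0). Qed.

Lemma conj_toC (a : R) : conjc (toC a) = toC a.
Proof. exact: conjc_real. Qed.

Lemma toC_ge0 (a : R) : (0 <= toC a) = (0 <= a).
Proof. exact: ler0c. Qed.

Lemma adjmxK m n (A : 'M[C]_(m, n)) : adj (adj A) = A.
Proof. by apply/matrixP=> i j; rewrite !mxE conjcK. Qed.

Lemma adjmx_mul m n p (A : 'M[C]_(m, n)) (B : 'M[C]_(n, p)) :
  adj (A *m B) = adj B *m adj A.
Proof. by rewrite /adjmx map_mxM trmx_mul. Qed.

Lemma adjmxD m n (A B : 'M[C]_(m, n)) : adj (A + B) = adj A + adj B.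
Proof. by rewrite /adjmx map_mxD linearD. Qed.

Lemma adjmxN m n (A : 'M[C]_(m, n)) : adj (- A) = - adj A.
Proof. by rewrite /adjmx map_mxN linearN. Qed.

Lemma adjmxB m n (A B : 'M[C]_(m, n)) : adj (A - B) = adj A - adj B.
Proof. by rewrite adjmxD adjmxN. Qed.

Lemma adjmxZ m n (a : R) (A : 'M[C]_(m, n)) : adj (toC a *: A) = toC a *: adj A.
Proof.
apply/matrixP=> i j; rewrite !mxE rmorphM; congr (_ * _); exact: conj_toC.
Qed.

Lemma adjmx0 m n : adj (0 : 'M[C]_(m, n)) = 0.
Proof. by apply/matrixP=> i j; rewrite !mxE conjc0. Qed.

Lemma adjmx1 n : adj (1%:M : 'M[C]_n) = 1%:M.
Proof. by apply/matrixP=> i j; rewrite !mxE eq_sym; case: eqP => _ /=; rewrite ?oppr0. Qed.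

Lemma adjmx_sum m n I (r : seq I) (P : pred I) (F : I -> 'M[C]_(m, n)) :
  adj (\sum_(i <- r | P i) F i) = \sum_(i <- r | P i) adj (F i).
Proof. exact: (big_morph _ (@adjmxD m n) (@adjmx0 m n)). Qed.

Definition rtr n (A : 'M[C]_n) : R := reC (\tr A).

Lemma rtrD n (A B : 'M[C]_n) : rtr (A + B) = rtr A + rtr B.
Proof. by rewrite /rtr raddfD reCD. Qed.
Lemma rtrN n (A : 'M[C]_n) : rtr (- A) = - rtr A.
Proof. by rewrite /rtr raddfN reCN. Qed.
Lemma rtrB n (A B : 'M[C]_n) : rtr (A - B) = rtr A - rtr B.
Proof. by rewrite rtrD rtrN. Qed.
Lemma rtr0 n : rtr (0 : 'M[C]_n) = 0.
Proof. by rewrite /rtr raddf0. Qed.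
Lemma rtrZ n (a : R) (A : 'M[C]_n) : rtr (toC a *: A) = a * rtr A.
Proof. by rewrite /rtr mxtraceZ reCZ. Qed.
Lemma rtr_sum n I (r : seq I) (P : pred I) (F : I -> 'M[C]_n) :
  rtr (\sum_(i <- r | P i) F i) = \sum_(i <- r | P i) rtr (F i).
Proof. exact: (big_morph _ (@rtrD n) (@rtr0 n)). Qed.
Lemma rtrC m n (A : 'M[C]_(m, n)) (B : 'M[C]_(n, m)) : rtr (A *m B) = rtr (B *m A).
Proof. by rewrite /rtr mxtrace_mulC. Qed.
Lemma rtr_adj n (A : 'M[C]_n) : rtr (adj A) = rtr A.
Proof.
rewrite /rtr /mxtrace !reC_sum; apply: eq_bigr => i _.
by rewrite !mxE reC_conj.
Qed.

Lemma psdmx0 n : psdmx (0 : 'M[C]_n).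
Proof. by move=> v; rewrite mulmx0 mul0mx mxE. Qed.

Lemma psdmxD n (A B : 'M[C]_n) : psdmx A -> psdmx B -> psdmx (A + B).
Proof. by move=> hA hB v; rewrite mulmxDr mulmxDl mxE addr_ge0. Qed.

Lemma psdmx_sum n I (r : seq I) (P : pred I) (F : I -> 'M[C]_n) :
  (forall i, P i -> psdmx (F i)) -> psdmx (\sum_(i <- r | P i) F i).
Proof. by move=> h; apply: big_ind => //; [exact: psdmx0 | exact: psdmxD]. Qed.

Lemma psdmxZ n (a : R) (A : 'M[C]_n) : 0 <= a -> psdmx A -> psdmx (toC a *: A).
Proof.
by move=> a0 hA v; rewrite -scalemxAr -scalemxAl mxE mulr_ge0 // toC_ge0.
Qed.

Lemma psdmx_conj m n (A : 'M[C]_m) (X : 'M[C]_(m, n)) :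
  psdmx A -> psdmx (adj X *m A *m X).
Proof.
by move=> hA v; have := hA (X *m v); rewrite adjmx_mul !mulmxA.
Qed.

Lemma psdmx1 n : psdmx (1%:M : 'M[C]_n).
Proof.
move=> v; rewrite mulmx1 mxE; apply: sumr_ge0 => i _.
by rewrite !mxE mulrC mulcJ_ge0.
Qed.

Lemma psdmx_gram m n (X : 'M[C]_(m, n)) : psdmx (adj X *m X).
Proof. by have := psdmx_conj X (@psdmx1 m); rewrite mulmx1. Qed.

Lemma psdmx_trans n (A B D : 'M[C]_n) : psdmx (B - A) -> psdmx (D - B) -> psdmx (D - A).
Proof. by move=> h1 h2; have := psdmxD h2 h1; rewrite addrA subrK. Qed.

Lemma psdmx_diag_ge0 n (A : 'M[C]_n) i : psdmx A -> 0 <= A i i.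
Proof.
move=> /(_ (delta_mx i 0)).
suff -> : adj (delta_mx i 0 : 'cV[C]_n) = delta_mx 0 i.
  by rewrite -rowE -colE !mxE.
by apply/matrixP=> k l; rewrite !mxE andbC; case: (_ && _) => /=; rewrite ?oppr0.
Qed.

Lemma mxtrace_psd_ge0 n (A : 'M[C]_n) : psdmx A -> 0 <= \tr A.
Proof. by move=> hA; apply: sumr_ge0 => i _; apply: psdmx_diag_ge0. Qed.

Lemma rtr_ge0 n (A : 'M[C]_n) : psdmx A -> 0 <= rtr A.
Proof. by move=> /mxtrace_psd_ge0 /reC_ge0. Qed.

(** Polarization: the vectors [e_i + e_j] and [e_i + i e_j] give [D i j + D j i = 0] and
    [D i j = D j i]. *)
Lemma quad0_eq0 n (D : 'M[C]_n) :
  (forall v : 'cV[C]_n, (adj v *m D *m v) 0 0 = 0) -> D = 0.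
Proof.
move=> h.
have adjd i : adj (delta_mx i 0 : 'cV[C]_n) = delta_mx 0 i.
  by apply/matrixP=> k l; rewrite !mxE andbC; case: (_ && _) => /=; rewrite ?oppr0.
have E i j : (delta_mx (0 : 'I_1) i *m D *m delta_mx j (0 : 'I_1)) 0 0 = D i j.
  by rewrite -rowE -colE !mxE.
have dg i : D i i = 0 by rewrite -(h (delta_mx i 0)) adjd E.
apply/matrixP => i j; rewrite mxE.
have h1 := h (delta_mx i 0 + delta_mx j 0).
have h2 := h (delta_mx i 0 + 'i%C *: delta_mx j 0).
have adjZ (c : C) (v : 'cV[C]_n) : adj (c *: v) = conjc c *: adj v.
  by apply/matrixP=> k l; rewrite !mxE rmorphM.
move: h1 h2; rewrite !adjmxD adjZ !adjd !mulmxDl !mulmxDr.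
rewrite -?scalemxAl -?scalemxAr -?scalemxAl -?scalemxAr.
have addE (A B : 'M[C]_1) : (A + B) 0 0 = A 0 0 + B 0 0 by rewrite mxE.
have scE (c : C) (A : 'M[C]_1) : (c *: A) 0 0 = c * A 0 0 by rewrite mxE.
rewrite !addE.
rewrite !scE.
rewrite !E.
rewrite !dg.
rewrite mulr0 mulr0.
rewrite !addr0 !add0r => /eqP.
rewrite addr_eq0 => /eqP ->.
rewrite (_ : conjc _ = (0 -i* 1)%C) //.
case: (D j i) => a b; simpc => /eqP; rewrite eq_complex /= => /andP[/eqP p /eqP q].
apply/eqP; rewrite eq_complex /=; lra.
Qed.

End Positivity.

(** * Spectral calculus: square roots, pseudo-inverses and operator monotonicity *)

Section Spectral.
Variable R : realType.
Local Notation C := (R[i]).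
Local Notation toC := (@toC R).
Local Notation adj := (@adjmx R _ _).

(** [0 <=] on complex numbers includes being real, so [A] and its adjoint have the same quadratic
    form. *)
Lemma psdmx_herm n (A : 'M[C]_n) : psdmx A -> adj A = A.
Proof.
move=> hA; apply/eqP; rewrite -subr_eq0; apply/eqP/quad0_eq0 => v.
have cE (M : 'M[C]_1) : adj M 0 0 = conjc (M 0 0) by rewrite !mxE.
have : adj (adj v *m A *m v) 0 0 = (adj v *m A *m v) 0 0.
  by rewrite cE (toC_reC (hA v)) conj_toC.
rewrite !adjmx_mul adjmxK mulmxA mulmxBr mulmxBl => e.
by rewrite [LHS]mxE e [X in _ + X]mxE subrr.
Qed.

Lemma herm_diag n (A : 'M[C]_n) : adj A = A -> exists (U : 'M[C]_n) (d : 'I_n -> R),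
  [/\ adj U *m U = 1%:M, U *m adj U = 1%:M &
      A = adj U *m diag_mx (\row_i toC (d i)) *m U].
Proof.
move=> hA.
have tE m p (M : 'M[C]_(m, p)) : (map_mx Num.conj M^T)%R = adj M.
  by apply/matrixP=> i j; rewrite !mxE.
have nA : A \is normalmx by apply/normalmxP; rewrite tE hA.
have hU := spectral_unitarymx A.
have e1 : spectralmx A *m adj (spectralmx A) = 1%:M.
  by move/unitarymxP: hU; rewrite tE.
have e2 : adj (spectralmx A) *m spectralmx A = 1%:M by exact: mulmx1C.
have hS := orthomx_spectralP nA.
rewrite (invmx_unitary hU) tE in hS.
set U := spectralmx A in e1 e2 hS *; set D := spectral_diag A in hS *.
have hD : diag_mx D = U *m A *m adj U.
  by rewrite hS !mulmxA e1 mul1mx -mulmxA e1 mulmx1.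
have hDr i : D 0 i = toC (reC (D 0 i)).
  have : adj (diag_mx D) = diag_mx D by rewrite hD !adjmx_mul adjmxK hA mulmxA.
  move/matrixP/(_ i i); rewrite !mxE eqxx mulr1n.
  by case: (D 0 i) => a b [] /eqP; rewrite eq_sym -addr_eq0 -mulr2n mulrn_eq0 /= => /eqP ->.
exists U, (fun i => reC (D 0 i)); split; [exact: e2 | exact: e1 |].
by rewrite {1}hS; congr (_ *m diag_mx _ *m _); apply/rowP => i; rewrite !mxE -hDr.
Qed.

Lemma psdmx_diag n (d : 'I_n -> R) : (forall i, 0 <= d i) ->
  psdmx (diag_mx (\row_i toC (d i))).
Proof.
move=> hd v; rewrite mxE; apply: sumr_ge0 => i _.
rewrite mul_mx_diag !mxE mulrAC mulr_ge0 ?toC_ge0 //.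
by rewrite mulrC mulcJ_ge0.
Qed.

Lemma psd_diag n (A : 'M[C]_n) : psdmx A -> exists (U : 'M[C]_n) (d : 'I_n -> R),
  [/\ adj U *m U = 1%:M, U *m adj U = 1%:M, forall i, 0 <= d i &
      A = adj U *m diag_mx (\row_i toC (d i)) *m U].
Proof.
move=> hA; have [U [d [e1 e2 e3]]] := herm_diag (psdmx_herm hA).
exists U, d; split=> // i.
have : psdmx (diag_mx (\row_i toC (d i))).
  have -> : diag_mx (\row_i toC (d i)) = adj (adj U) *m A *m adj U.
    by rewrite adjmxK e3 !mulmxA e2 mul1mx -mulmxA e2 mulmx1.
  exact: psdmx_conj.
by move/(psdmx_diag_ge0 i); rewrite !mxE eqxx mulr1n toC_ge0.
Qed.

(* [Q] is the square root of the Moore-Penrose inverse: [0^-1 = 0] handles the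
   kernel of [A]. *)
Lemma psd_root_pinv n (A : 'M[C]_n) : psdmx A -> exists q Q P : 'M[C]_n,
  [/\ psdmx q, psdmx Q, psdmx P & psdmx (1%:M - P)] /\
  [/\ q *m q = A, q *m Q = P, Q *m q = P, P *m q = q & q *m P = q] /\
  [/\ P *m P = P, Q *m P = Q & P *m Q = Q].
Proof.
move=> hA; have [U [d [e1 e2 d0 e3]]] := psd_diag hA.
pose f (g : 'I_n -> R) := adj U *m diag_mx (\row_i toC (g i)) *m U.
have fM g1 g2 : f g1 *m f g2 = f (fun i => g1 i * g2 i).
  rewrite /f !mulmxA -[X in X *m _ *m U]mulmxA e2 mulmx1 -[X in X *m U]mulmxA.
  congr (_ *m _ *m _); rewrite mulmx_diag; congr diag_mx.
  by apply/rowP => i; rewrite !mxE toCM.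
have fpsd g : (forall i, 0 <= g i) -> psdmx (f g).
  by move=> h; apply/psdmx_conj/psdmx_diag.
have f1 : 1%:M = f (fun=> 1).
  by rewrite /f -[LHS]e1 -[adj U in LHS]mulmx1; congr (_ *m _ *m _);
     apply/matrixP=> i j; rewrite !mxE toC1.
have fB g1 g2 : f g1 - f g2 = f (fun i => g1 i - g2 i).
  rewrite /f -mulmxBl -mulmxBr; congr (_ *m _ *m _).
  rewrite -linearB /=; congr diag_mx; apply/rowP => i; rewrite !mxE.
  by rewrite /Defs.toC rmorphB.
have fe g1 g2 : g1 =1 g2 -> f g1 = f g2 by move=> e; rewrite (funext e).
pose s i := Num.sqrt (d i).
have s0 i : 0 <= s i by rewrite sqrtr_ge0.
have sE i : (s i == 0) || (s i != 0) by rewrite orbN.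
exists (f s), (f (fun i => (s i)^-1)), (f (fun i => s i / s i)).
split; [split|split; [split|split]]; rewrite ?fM ?f1 ?fB.
- exact: fpsd.
- by apply: fpsd => i; rewrite invr_ge0.
- by apply: fpsd => i; rewrite divr_ge0.
- apply: fpsd => i; have [->|h] := eqVneq (s i) 0; first by rewrite mul0r subr0.
  by rewrite divff // subrr.
- by rewrite e3; apply: fe => i; rewrite -expr2 sqr_sqrtr.
- exact: fe.
- by apply: fe => i; rewrite mulrC.
- by apply: fe => i; have [->|h] := eqVneq (s i) 0; rewrite ?mulr0 // divff // mul1r.
- by apply: fe => i; have [->|h] := eqVneq (s i) 0; rewrite ?mul0r // divff // mulr1.
- by apply: fe => i; have [->|h] := eqVneq (s i) 0; rewrite ?mul0r // divff // mulr1.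
- by apply: fe => i; have [->|h] := eqVneq (s i) 0; rewrite ?invr0 ?mul0r // divff // mulr1.
- by apply: fe => i; have [->|h] := eqVneq (s i) 0; rewrite ?invr0 ?mulr0 // divff // mul1r.
Qed.

Lemma psd_root n (A : 'M[C]_n) : psdmx A -> exists2 q, psdmx q & q *m q = A.
Proof. by move=> /psd_root_pinv[q [_ [_ [[? _ _ _] [[? _ _ _ _] _]]]]]; exists q. Qed.

Lemma rtr_mul_ge0 n (A B : 'M[C]_n) : psdmx A -> psdmx B -> 0 <= rtr (A *m B).
Proof.
move=> /psd_root[q hq <-] hB; rewrite -mulmxA rtrC.
have := psdmx_conj q hB; rewrite (psdmx_herm hq); exact: rtr_ge0.
Qed.

Lemma rtr_mul_le n (A B D : 'M[C]_n) : psdmx (B - A) -> psdmx D ->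
  rtr (A *m D) <= rtr (B *m D).
Proof. by move=> h hD; rewrite -subr_ge0 -rtrB -mulmxBl rtr_mul_ge0. Qed.

Lemma rtr_gram_eq0 m n (X : 'M[C]_(m, n)) : rtr (adj X *m X) = 0 -> X = 0.
Proof.
rewrite /rtr /mxtrace reC_sum => h.
pose N (x : C) := complex.Re x ^+ 2 + complex.Im x ^+ 2.
have N0 x : 0 <= N x by rewrite addr_ge0 ?sqr_ge0.
have e i j : reC (adj X i j * X j i) = N (X j i).
  by rewrite !mxE /N; case: (X j i) => a b /=; rewrite /reC; simpc; rewrite !expr2.
have h2 : \sum_i \sum_j N (X j i) = 0.
  rewrite -[RHS]h; apply: eq_bigr => i _; rewrite mxE reC_sum.
  by apply: eq_bigr => j _; rewrite e.
apply/matrixP => j i; rewrite [RHS]mxE.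
have := psumr_eq0P (fun i _ => sumr_ge0 _ (fun j _ => N0 (X j i))) h2.
move=> /(_ i isT)/(psumr_eq0P (fun j _ => N0 _))/(_ j isT)/eqP.
rewrite /N; case: (X j i) => a b /=; rewrite paddr_eq0 ?sqr_ge0 // !sqrf_eq0.
by case/andP=> /eqP -> /eqP ->.
Qed.

Lemma rtr_mul_eq0 n (A B : 'M[C]_n) : psdmx A -> psdmx B -> rtr (A *m B) = 0 -> A *m B = 0.
Proof.
move=> /psd_root[a ha <-] /psd_root[b hb <-] h.
have : b *m a = 0.
  apply: rtr_gram_eq0; rewrite adjmx_mul !psdmx_herm // -h.
  by rewrite -!mulmxA [in RHS]rtrC -!mulmxA.
move/(congr1 adj); rewrite adjmx_mul adjmx0 !psdmx_herm // => e.
by rewrite -mulmxA [a *m (b *m b)]mulmxA e mul0mx mulmx0.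
Qed.

(** With [D = A - B] one has [A D + D B = 0], hence [tr (A D^2) + tr (B D^2) = 0]. Both terms are
    nonnegative, so [A D^2 = B D^2 = 0], then [D^3 = 0] and [D = 0]. This lets the choice-based
    [mx_sqrt] be computed by exhibiting a root. *)
Lemma psd_root_uniq n (A B : 'M[C]_n) : psdmx A -> psdmx B -> A *m A = B *m B -> A = B.
Proof.
move=> hA hB e; pose D := A - B.
have hD : adj D = D by rewrite /D adjmxB !psdmx_herm.
have z : rtr (A *m (D *m D)) + rtr (B *m (D *m D)) = 0.
  have AD : A *m D + D *m B = 0.
    by rewrite /D mulmxBr mulmxBl e addrA subrK subrr.
  rewrite [B *m _]mulmxA [rtr (B *m _ *m _)]rtrC !mulmxA -rtrD.
  by rewrite -[D *m B *m D]mulmxA [D *m (B *m D)]mulmxA -mulmxDl AD mul0mx rtr0.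
have hDD : psdmx (D *m D) by rewrite -{1}hD; apply: psdmx_gram.
have a0 := rtr_mul_ge0 hA hDD; have b0 := rtr_mul_ge0 hB hDD.
have /(rtr_mul_eq0 hA hDD) zA : rtr (A *m (D *m D)) = 0 by lra.
have /(rtr_mul_eq0 hB hDD) zB : rtr (B *m (D *m D)) = 0 by lra.
have DDD : D *m (D *m D) = 0 by rewrite {1}/D mulmxBl zA zB subrr.
have DD : D *m D = 0.
  by apply: rtr_gram_eq0; rewrite adjmx_mul hD -mulmxA DDD mulmx0 rtr0.
by apply/eqP; rewrite -subr_eq0; apply/eqP/rtr_gram_eq0; rewrite -/D hD DD rtr0.
Qed.

Lemma mx_sqrtP n (A : 'M[C]_n) : psdmx A ->
  psdmx (mx_sqrt A) /\ mx_sqrt A *m mx_sqrt A = A.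
Proof.
move=> /psd_root[q hq e]; rewrite /mx_sqrt.
by case: xgetP => [B _ //|/(_ q)[]].
Qed.

Lemma mx_sqrt_uniq n (A B : 'M[C]_n) : psdmx B -> B *m B = A -> mx_sqrt A = B.
Proof.
move=> hB e; have hA : psdmx A.
  by rewrite -e -{1}(psdmx_herm hB); apply: psdmx_gram.
have [h1 h2] := mx_sqrtP hA; apply: psd_root_uniq => //.
by rewrite e.
Qed.

(** Operator monotonicity of the square root. At a unit eigenvector of [A - B] with eigenvalue
    [d < 0], the form of [A^2 - B^2] is [d (q A + q B)]; its nonnegativity forces [q A = q B = 0],
    whereas [q A - q B = d]. *)
Lemma psd_root_mono n (A B : 'M[C]_n) : psdmx A -> psdmx B ->
  psdmx (A *m A - B *m B) -> psdmx (A - B).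
Proof.
move=> hA hB hAB.
have hD : adj (A - B) = A - B by rewrite adjmxB !psdmx_herm.
have [U [d [e1 e2 e3]]] := herm_diag hD.
have [h|] := pselect (forall i, 0 <= d i).
  by rewrite e3; apply/psdmx_conj/psdmx_diag.
move/existsNP => [i /negP]; rewrite -ltNge => di; exfalso.
pose v : 'cV[C]_n := adj U *m delta_mx i 0.
have Dv : (A - B) *m v = toC (d i) *: v.
  rewrite e3 /v -!mulmxA [U *m (adj U *m _)]mulmxA e2 mul1mx scalemxAr.
  congr (_ *m _); apply/matrixP=> k l.
  by rewrite mul_diag_mx !mxE; case: eqP => [->|]; rewrite ?mulr0.
have vv : adj v *m v = 1%:M.
  rewrite /v adjmx_mul adjmxK mulmxA -[_ *m U *m _]mulmxA e2 mulmx1.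
  apply/matrixP=> k l; rewrite !ord1 !mxE (bigD1 i) //= !mxE !eqxx /= oppr0.
  rewrite big1 ?addr0; last by move=> j /negbTE ji; rewrite !mxE ji /= mulr0.
  exact: mulr1.
have vD : adj v *m (A - B) = toC (d i) *: adj v.
  by rewrite -[A - B]hD -adjmx_mul Dv adjmxZ.
pose q (M : 'M[C]_n) := reC ((adj v *m M *m v) 0 0).
have q0 M : psdmx M -> 0 <= q M by move=> /(_ v)/reC_ge0.
have qD M N : q (M + N) = q M + q N.
  by rewrite /q mulmxDr mulmxDl [X in reC X]mxE reCD.
have qZ a M : q (toC a *: M) = a * q M.
  by rewrite /q -scalemxAr -scalemxAl [X in reC X]mxE reCZ.
have qN M : q (- M) = - q M by rewrite /q mulmxN mulNmx [X in reC X]mxE reCN.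
have ql M : q ((A - B) *m M) = d i * q M.
  by rewrite /q mulmxA vD -!scalemxAl [X in reC X]mxE reCZ.
have qr M : q (M *m (A - B)) = d i * q M.
  by rewrite /q -!mulmxA Dv -!scalemxAr [X in reC X]mxE reCZ.
have E : q (A *m A - B *m B) = d i * (q A + q B).
  have <- : toC 2^-1 *: ((A - B) *m (A + B) + (A + B) *m (A - B)) =
      A *m A - B *m B.
    rewrite !(mulmxBl, mulmxBr, mulmxDl, mulmxDr).
    apply: (scalerI (a := toC 2)); first by apply/eqP=> -[]/eqP; rewrite pnatr_eq0.
    rewrite scalerA -toCM divff ?pnatr_eq0 // scale1r.
    rewrite /Defs.toC rmorph_nat scaler_nat mulr2n.
    move: (A *m A) (A *m B) (B *m A) (B *m B) => a b c e.
    by apply/matrixP => k l; rewrite !mxE; ring.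
  by rewrite qZ qD ql qr qD; field.
have := q0 _ hAB; rewrite E => h.
have a0 := q0 _ hA; have b0 := q0 _ hB.
have s0 : q A + q B <= 0.
  by rewrite leNgt; apply/negP=> h'; move: h; rewrite leNgt nmulr_rlt0 ?h'.
have : q (A - B) = d i.
  by rewrite /q vD -scalemxAl vv [X in reC X]mxE reCZ mxE /= /reC /= mulr1.
by rewrite qD qN => e; move: di; rewrite -e; lra.
Qed.

End Spectral.

(** * Decoding inequalities and the trace norm *)

Section Norms.
Variable R : realType.
Local Notation C := (R[i]).
Local Notation toC := (@toC R).
Local Notation adj := (@adjmx R _ _).

Definition nrm2 m n (X : 'M[C]_(m, n)) : R := rtr (adj X *m X).

Lemma nrm2_ge0 m n (X : 'M[C]_(m, n)) : 0 <= nrm2 X.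
Proof. exact: rtr_ge0 (psdmx_gram X). Qed.

Lemma nrm2Z m n a (X : 'M[C]_(m, n)) : nrm2 (toC a *: X) = a ^+ 2 * nrm2 X.
Proof. by rewrite /nrm2 adjmxZ -scalemxAl -scalemxAr !rtrZ mulrA expr2. Qed.

Lemma nrm2D m n (X Y : 'M[C]_(m, n)) :
  nrm2 (X + Y) = nrm2 X + nrm2 Y + 2 * rtr (adj X *m Y).
Proof.
have e : rtr (adj Y *m X) = rtr (adj X *m Y).
  by rewrite -rtr_adj adjmx_mul adjmxK.
by rewrite /nrm2 adjmxD mulmxDl !mulmxDr !rtrD e; ring.
Qed.

(** Cauchy-Schwarz in arithmetic-geometric form; the free weight [t] replaces square roots of
    norms. *)
Lemma rtr_amgm m n (X Y : 'M[C]_(m, n)) (t : R) : 0 < t ->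
  rtr (adj X *m Y) <= (t * nrm2 X + t^-1 * nrm2 Y) / 2.
Proof.
move=> t0; pose s := Num.sqrt t.
have s0 : 0 < s by rewrite sqrtr_gt0.
have := nrm2_ge0 (toC s *: X + toC (- s^-1) *: Y).
rewrite nrm2D !nrm2Z adjmxZ -scalemxAl -scalemxAr !rtrZ sqrrN exprVn (sqr_sqrtr (ltW t0)).
rewrite [s * (_ * _)]mulrA mulrN divff ?gt_eqF //; lra.
Qed.

Lemma nrm2D_le m n (X Y : 'M[C]_(m, n)) (c : R) : 0 < c ->
  nrm2 (X + Y) <= (1 + c) * nrm2 X + (1 + c^-1) * nrm2 Y.
Proof. move=> c0; rewrite nrm2D; have := rtr_amgm X Y c0; lra. Qed.

Lemma rtr_nrm2 m n (A X : 'M[C]_n) (B : 'M[C]_(m, n)) : psdmx X -> A = adj B *m B ->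
  rtr (A *m (X *m X)) = nrm2 (B *m X).
Proof.
move=> hX ->; rewrite /nrm2 adjmx_mul (psdmx_herm hX).
by rewrite mulmxA rtrC !mulmxA.
Qed.

Lemma psdmx_conjh n (A X : 'M[C]_n) : psdmx A -> psdmx X -> psdmx (X *m A *m X).
Proof. by move=> hA hX; have := psdmx_conj X hA; rewrite psdmx_herm. Qed.

(* Writing [Q = 1 + (Q - 1)] splits [Q T Q] into [T] and [(Q - 1) T (Q - 1)],
   which is at most [(Q - 1) G (Q - 1) = P + G - 2 q] for [G = S + T]; finally
   [q >= S] since [q^2 = G >= S >= S^2]. *)
Lemma hayashi_nagaoka n (S T q Q P rho : 'M[C]_n) c : 0 < c ->
  psdmx S -> psdmx (1%:M - S) -> psdmx T -> psdmx rho ->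
  psdmx q -> psdmx Q -> psdmx (1%:M - P) ->
  q *m q = S + T -> q *m Q = P -> Q *m q = P -> P *m q = q -> q *m P = q ->
  rtr ((1%:M - Q *m S *m Q) *m rho) <=
    (1 + c) * rtr ((1%:M - S) *m rho) + (2 + c + c^-1) * rtr (T *m rho).
Proof.
move=> c0 hS hS1 hT hrho hq hQ hP qq qQ Qq Pq qP.
have [X hX eX] := psd_root hrho; have [t ht et] := psd_root hT.
have [s hs es] := psd_root hS.
have qS : psdmx (q - S).
  apply: (psd_root_mono hq hS); rewrite qq addrAC.
  apply: (psdmxD _ hT).
  have -> : S - S *m S = adj s *m (1%:M - S) *m s.
    by rewrite psdmx_herm // mulmxBr mulmx1 mulmxBl -es !mulmxA.
  exact: psdmx_conj.
have PP : P *m P = P by rewrite -[X in P *m X]qQ mulmxA Pq qQ.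
have e1 : 1%:M - Q *m S *m Q = (1%:M - P) + Q *m T *m Q.
  have <- : Q *m (S + T) *m Q = P by rewrite -qq !mulmxA Qq Pq qQ.
  by rewrite mulmxDr mulmxDl opprD addrA subrK.
have hQT : rtr (Q *m T *m Q *m rho) <=
    (1 + c^-1) * rtr (T *m rho) + (1 + c) * rtr ((P + (S + T) - q - q) *m rho).
  rewrite -{1 2}eX (rtr_nrm2 (B := t *m Q)) //; last first.
    by rewrite adjmx_mul !psdmx_herm // -et !mulmxA.
  have -> : t *m Q *m X = t *m (Q - 1%:M) *m X + t *m X.
    by rewrite mulmxBr mulmx1 mulmxBl subrK.
  apply: le_trans (nrm2D_le _ _ c0) _.
  rewrite addrC; apply: lerD.
    by rewrite (rtr_nrm2 (B := t)) // psdmx_herm.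
  rewrite ler_pM2l; last by rewrite addr_gt0.
  rewrite -(rtr_nrm2 (A := (Q - 1%:M) *m T *m (Q - 1%:M))) //; last first.
    by rewrite adjmx_mul adjmxB adjmx1 !psdmx_herm // -et !mulmxA.
  rewrite eX; apply: rtr_mul_le; last exact: hrho.
  have -> : P + (S + T) - q - q = (Q - 1%:M) *m (S + T) *m (Q - 1%:M).
    have -> : (Q - 1%:M) *m (S + T) *m (Q - 1%:M) = (P - q) *m (P - q).
      rewrite -qq mulmxA -[LHS]mulmxA mulmxBl Qq mul1mx.
      by rewrite [q *m (Q - _)]mulmxBr qQ mulmx1.
    rewrite mulmxBl !mulmxBr PP Pq qP qq.
    by apply/matrixP => i j; rewrite !mxE; ring.
  rewrite [_ *m (S + T)]mulmxDr [(_ + _ *m T) *m _]mulmxDl addrK.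
  have e : adj (Q - 1%:M) = Q - 1%:M by rewrite adjmxB adjmx1 psdmx_herm.
  by have := psdmx_conj (Q - 1%:M) hS; rewrite e.
have -> : rtr ((1%:M - Q *m S *m Q) *m rho) =
    rtr ((1%:M - P) *m rho) + rtr (Q *m T *m Q *m rho) by rewrite e1 -rtrD -mulmxDl.
have h1 : rtr ((P + (S + T) - q - q) *m rho) <= rtr (T *m rho) + rtr ((1%:M - S) *m rho)
    - rtr ((1%:M - P) *m rho).
  rewrite -rtrD -rtrB -mulmxDl -mulmxBl; apply: rtr_mul_le; last exact: hrho.
  have := psdmxD qS qS; congr psdmx.
  by apply/matrixP => i j; rewrite !mxE; ring.
have h2 := rtr_mul_ge0 hP hrho.
have h3 := rtr_mul_ge0 hT hrho.
have h4 := rtr_mul_ge0 hS1 hrho.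
move: hQT h1 h2 h3 h4; move: (rtr _) (rtr _) (rtr _) (rtr _) (rtr _).
move=> x y z w v k1 k2 k3 k4 k5.
have h5 := ler_wpM2l (ltW (addr_gt0 ltr01 c0)) k2.
have h6 : 0 <= c * x by rewrite mulr_ge0 // ltW.
move: k1 h5 h6; lra.
Qed.

(** The square-root measurement [G^(-1/2) A_i G^(-1/2)], with [G] the sum of all [A_j]. Its elements
    add up to the support projection of [G], so it is only a sub-measurement. *)
Lemma pretty_good_povm n (I : finType) (A : I -> 'M[C]_n) :
  (forall i, psdmx (A i)) -> (forall i, psdmx (1%:M - A i)) ->
  exists L : I -> 'M[C]_n,
  [/\ forall i, psdmx (L i), psdmx (1%:M - \sum_i L i) &
   forall c rho i, 0 < c -> psdmx rho -> rtr ((1%:M - L i) *m rho) <=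
     (1 + c) * rtr ((1%:M - A i) *m rho) +
     (2 + c + c^-1) * \sum_(j | j != i) rtr (A j *m rho)].
Proof.
move=> hA hA1.
have hG : psdmx (\sum_i A i) by apply: psdmx_sum.
have [q [Q [P [[hq hQ hP hP1] [[qq qQ Qq Pq qP] [PP QP PQ]]]]]] := psd_root_pinv hG.
exists (fun i => Q *m A i *m Q); split.
- by move=> i; exact: psdmx_conjh (hA i) hQ.
- suff -> : \sum_i Q *m A i *m Q = P by [].
  by rewrite -mulmx_suml -mulmx_sumr -qq !mulmxA Qq Pq qQ.
move=> c rho i c0 hrho.
have hT : psdmx (\sum_(j | j != i) A j) by apply: psdmx_sum => j _; exact: hA.
rewrite (bigD1 i) //= in qq.
have := hayashi_nagaoka c0 (hA i) (hA1 i) hT hrho hq hQ hP1 qq qQ Qq Pq qP.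
by rewrite mulmx_suml rtr_sum.
Qed.

(** [sqrt L - L = r (1 - sqrt L) r] for the fourth root [r] of [L]. *)
Lemma mx_sqrt_le1 n (L : 'M[C]_n) : psdmx L -> psdmx (1%:M - L) ->
  psdmx (1%:M - mx_sqrt L) /\ psdmx (mx_sqrt L - L).
Proof.
move=> hL hL1; have [hl e] := mx_sqrtP hL.
have h1 : psdmx (1%:M - mx_sqrt L).
  by apply: (psd_root_mono (@psdmx1 _ n) hl); rewrite mulmx1 e.
split; first exact: h1.
have [r hr er] := psd_root hl.
have -> : mx_sqrt L - L = r *m (1%:M - mx_sqrt L) *m r.
  rewrite mulmxBr mulmx1 mulmxBl er; congr (_ - _).
  have -> : r *m mx_sqrt L *m r = r *m r *m (r *m r) by rewrite -er !mulmxA.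
  by rewrite er e.
exact: psdmx_conjh.
Qed.

(** With [l = sqrt L], the loss beyond [1 - L] is [l (1 - G) l]. Writing [l = 1 - (1 - l)] and
    splitting the squared norm evenly leaves [2 (1 - G)] and [2 (1 - l)^2] in expectation, and
    [(1 - l)^2 <= 1 - L]; hence [3 = 1 + 2]. Both errors enter linearly, whereas a
    gentle-measurement bound would bring in a square root. *)
Lemma sequential_error n (L G rho : 'M[C]_n) :
  psdmx L -> psdmx (1%:M - L) -> psdmx G -> psdmx (1%:M - G) -> psdmx rho ->
  rtr ((1%:M - mx_sqrt L *m G *m mx_sqrt L) *m rho) <=
    3 * rtr ((1%:M - L) *m rho) + 2 * rtr ((1%:M - G) *m rho).
Proof.
move=> hL hL1 hG hG1 hrho; have [hl el] := mx_sqrtP hL.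
have [hl1 hlL] := mx_sqrt_le1 hL hL1.
set l := mx_sqrt L in hl el hl1 hlL *.
have [X hX eX] := psd_root hrho; have [e he ee] := psd_root hG1.
have -> : 1%:M - l *m G *m l = (1%:M - L) + l *m (1%:M - G) *m l.
  by rewrite mulmxBr mulmx1 mulmxBl el addrA subrK.
rewrite [(_ + l *m _ *m _) *m rho]mulmxDl rtrD.
suff h1 : rtr (l *m (1%:M - G) *m l *m rho) <=
    2 * rtr ((1%:M - G) *m rho) + 2 * rtr ((1%:M - L) *m rho).
  by move: h1; move: (rtr _) (rtr _) (rtr _) => x y z; lra.
  rewrite -{1 2}eX (rtr_nrm2 (B := e *m l)) //; last first.
    by rewrite adjmx_mul !psdmx_herm // -ee !mulmxA.
  have -> : e *m l *m X = e *m X + - (e *m (1%:M - l) *m X).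
    by rewrite mulmxBr mulmx1 mulmxBl opprB addrC subrK.
  apply: le_trans (nrm2D_le _ _ (c := 1) ltr01) _.
  rewrite invr1 -[1 + 1]/(2 : R) (rtr_nrm2 (B := e)) ?psdmx_herm //.
  apply: lerD => //; rewrite ler_pM2l //.
  have -> : nrm2 (- (e *m (1%:M - l) *m X)) = nrm2 (e *m (1%:M - l) *m X).
    by rewrite /nrm2 adjmxN mulmxN mulNmx opprK.
  rewrite -(rtr_nrm2 (A := (1%:M - l) *m (1%:M - G) *m (1%:M - l))) //; last first.
    by rewrite adjmx_mul !psdmx_herm // -ee !mulmxA.
  rewrite eX; apply: le_trans (rtr_mul_le (B := (1%:M - l) *m (1%:M - l)) _ hrho) _.
    have -> : (1%:M - l) *m (1%:M - l) - (1%:M - l) *m (1%:M - G) *m (1%:M - l) =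
        (1%:M - l) *m G *m (1%:M - l).
      by rewrite [(1%:M - l) *m (1%:M - G)]mulmxBr mulmx1 [(_ - _ *m G) *m _]mulmxBl
           opprB addrC subrK.
    exact: psdmx_conjh hG hl1.
  apply: rtr_mul_le; last exact: hrho.
  have := psdmxD hlL hlL; congr psdmx.
  rewrite mulmxBl mul1mx mulmxBr mulmx1 el.
  by apply/matrixP => i j; rewrite !mxE; ring.
Qed.

(** The dual unit ball of the trace norm. *)
Definition contraction n (W : 'M[C]_n) := psdmx (1%:M - W *m adj W).

Lemma contraction_nrm2 m n (W : 'M[C]_m) (D : 'M[C]_(m, n)) : contraction W ->
  nrm2 (adj W *m D) <= nrm2 D.
Proof.
move=> hW; have := rtr_ge0 (psdmx_conj D hW).
by rewrite mulmxBr mulmx1 mulmxBl rtrB subr_ge0 /nrm2 adjmx_mul adjmxK !mulmxA.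
Qed.

Lemma trnorm_psd n (A : 'M[C]_n) : psdmx A -> trnorm A = rtr A.
Proof.
by move=> hA; rewrite /trnorm (mx_sqrt_uniq (B := A)) // psdmx_herm.
Qed.

Lemma trnormN n (A : 'M[C]_n) : trnorm (- A) = trnorm A.
Proof. by rewrite /trnorm adjmxN mulmxN mulNmx opprK. Qed.

(** The dual problem is solved by [W = |M|^(-1) M^*], the inverse being taken on the support. *)
Lemma trnorm_polar n (M : 'M[C]_n) :
  exists2 W, contraction W & trnorm M = rtr (W *m M).
Proof.
have [q [Q [P [[hq hQ hP hP1] [[qq qQ Qq Pq qP] [PP QP PQ]]]]]] :=
  psd_root_pinv (psdmx_gram M).
exists (Q *m adj M).
  rewrite /contraction adjmx_mul adjmxK (psdmx_herm hQ) !mulmxA.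
  by rewrite -[Q *m adj M *m M]mulmxA -qq !mulmxA Qq Pq qQ.
by rewrite /trnorm (mx_sqrt_uniq hq qq) -mulmxA -qq mulmxA Qq Pq.
Qed.

(** With [r = |M|^(1/2)], [tr (W M)] is the inner product of [W^* r] and [M |M|^(-1) r], each of
    squared norm at most [tr |M|]. *)
Lemma trnorm_ge n (W M : 'M[C]_n) : contraction W -> rtr (W *m M) <= trnorm M.
Proof.
move=> hW.
have [q [Q [P [[hq hQ hP hP1] [[qq qQ Qq Pq qP] [PP QP PQ]]]]]] :=
  psd_root_pinv (psdmx_gram M).
have MP : M *m P = M.
  apply/eqP; rewrite -subr_eq0; apply/eqP/rtr_gram_eq0.
  have -> : M *m P - M = M *m (P - 1%:M) by rewrite mulmxBr mulmx1.
  rewrite adjmx_mul -mulmxA [adj M *m _]mulmxA -qq -[q *m q *m _]mulmxA.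
  by rewrite mulmxBr qP mulmx1 subrr !mulmx0 rtr0.
have [r hr er] := psd_root hq.
rewrite /trnorm (mx_sqrt_uniq hq qq) -/(rtr q).
have -> : rtr (W *m M) = rtr (adj (adj W *m r) *m (M *m Q *m r)).
  rewrite adjmx_mul adjmxK (psdmx_herm hr) -[r *m W *m _]mulmxA [RHS]rtrC.
  by rewrite -!mulmxA er Qq MP.
have /le_trans -> // := rtr_amgm (adj W *m r) (M *m Q *m r) ltr01.
rewrite invr1 !mul1r ler_pdivrMr // mulr_natr mulr2n lerD //.
  by rewrite (le_trans (contraction_nrm2 _ hW)) // /nrm2 psdmx_herm // er.
have -> : nrm2 (M *m Q *m r) = rtr (r *m P *m r).
  rewrite /nrm2 !adjmx_mul (psdmx_herm hr) (psdmx_herm hQ) -!mulmxA [adj M *m _]mulmxA -qq.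
  by rewrite -!mulmxA [q *m (Q *m _)]mulmxA qQ [q *m (P *m _)]mulmxA qP
     [Q *m (q *m _)]mulmxA Qq.
have := rtr_ge0 (psdmx_conjh hP1 hr).
by rewrite mulmxBr mulmx1 mulmxBl rtrB subr_ge0 er.
Qed.

Lemma trnormD n (A B : 'M[C]_n) : trnorm (A + B) <= trnorm A + trnorm B.
Proof.
have [W hW ->] := trnorm_polar (A + B).
by rewrite mulmxDr rtrD lerD // trnorm_ge.
Qed.

Lemma trnorm0 n : trnorm (0 : 'M[C]_n) = 0.
Proof. by rewrite trnorm_psd ?rtr0 //; apply: psdmx0. Qed.

Lemma trnorm_sum n I (r : seq I) (P : pred I) (F : I -> 'M[C]_n) :
  trnorm (\sum_(i <- r | P i) F i) <= \sum_(i <- r | P i) trnorm (F i).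
Proof.
apply: (big_ind2 (fun (A : 'M[C]_n) x => trnorm A <= x)) => //.
  by rewrite trnorm0.
by move=> A x B y hA hB; apply: le_trans (trnormD _ _) (lerD hA hB).
Qed.

Lemma trnormZ n a (A : 'M[C]_n) : 0 <= a -> trnorm (toC a *: A) <= a * trnorm A.
Proof.
move=> a0; have [W hW ->] := trnorm_polar (toC a *: A).
by rewrite -scalemxAr rtrZ ler_wpM2l // trnorm_ge.
Qed.

Lemma trnorm_ge0 n (A : 'M[C]_n) : 0 <= trnorm A.
Proof.
have := @trnorm_ge _ 0 A; rewrite mul0mx rtr0; apply.
by rewrite /contraction mul0mx subr0; apply: psdmx1.
Qed.

Lemma trnorm_amgm m n (X Y : 'M[C]_(m, n)) (t : R) : 0 < t ->
  trnorm (X *m adj Y) <= (t * nrm2 X + t^-1 * nrm2 Y) / 2.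
Proof.
move=> t0; have [W hW ->] := trnorm_polar (X *m adj Y).
rewrite mulmxA rtrC mulmxA -{1}[W]adjmxK -adjmx_mul.
have ti0 : 0 < t^-1 by rewrite invr_gt0.
apply: le_trans (rtr_amgm (adj W *m Y) X ti0) _.
rewrite invrK ler_pM2r // addrC lerD2l ler_pM2l ?invr_gt0 //.
exact: contraction_nrm2.
Qed.

(** The end of [trnorm_pdist] in numbers: [z] is the trace of the defect, [s] is [1 / t], and
    [2 z <= (t + s) z] because [t + 1 / t >= 2]. *)
Lemma trnorm_pdist_arith (x y v z t s F eta : R) :
  x <= (t * (2 - z - 2 * F) + s * (2 - z + 2 * F)) / 2 ->
  y <= (s * (2 - z + 2 * F) + t * (2 - z - 2 * F)) / 2 ->
  v <= 2^-1 * (x + y) -> 2 * z <= (t + s) * z ->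
  t * (1 - F) <= eta -> s * (1 + F) = eta -> v + z <= 2 * eta.
Proof. lra. Qed.

(* Fuchs-van de Graaf: for [A = sqrt rho], [B = sqrt sigma] and a contraction
   [W] with [F = rtr (W A B)], up to the defect [B (1 - W (adjmx W)) B] the matrix
   [rho - sigma] is the symmetrised product of [A - B W] and [A + B W], whose
   squared Hilbert-Schmidt norms are at most [2 - 2 F] and [2 + 2 F]. *)
Lemma trnorm_pdist n (rho sigma : 'M[C]_n) eta : is_state rho -> is_state sigma ->
  0 < eta -> pdist rho sigma <= eta -> trnorm (rho - sigma) <= 2 * eta.
Proof.
move=> [hr tr] [hs ts] e0; rewrite /pdist /fidelity.
have [hA eA] := mx_sqrtP hr; have [hB eB] := mx_sqrtP hs.
set A := mx_sqrt rho in hA eA *; set B := mx_sqrt sigma in hB eB *.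
have F0 := trnorm_ge0 (A *m B).
have [W hW eF] := trnorm_polar (A *m B).
set F := trnorm _ in F0 eF * => hF.
(* [Num.sqrt] is 0 on negative numbers, so [1 - F^2 < 0] is a separate case. *)
have hFe : 1 - F ^+ 2 <= eta ^+ 2.
  have [h|h] := leP 0 (1 - F ^+ 2); last by rewrite (le_trans (ltW h)) // sqr_ge0.
  by rewrite -(sqr_sqrtr h) lerXn2r ?nnegrE ?sqrtr_ge0 // ltW.
pose b := B *m W; pose Z := B *m (1%:M - W *m adj W) *m B.
have hZ : psdmx Z by apply: psdmx_conjh.
have eZ : b *m adj b = sigma - Z.
  by rewrite /b /Z adjmx_mul (psdmx_herm hB) mulmxBr mulmx1 mulmxBl eB opprB addrC subrK !mulmxA.
have nA : nrm2 A = 1 by rewrite /nrm2 (psdmx_herm hA) eA /rtr tr.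
have nb : nrm2 b = 1 - rtr Z.
  by rewrite /nrm2 rtrC eZ rtrB /rtr ts.
have Ab : rtr (adj A *m b) = F.
  by rewrite (psdmx_herm hA) /b mulmxA rtrC -eF.
have n1 : nrm2 (A - b) = 2 - rtr Z - 2 * F.
  by rewrite nrm2D mulmxN rtrN Ab nA /nrm2 adjmxN mulmxN mulNmx opprK -/(nrm2 b) nb; ring.
have n2 : nrm2 (A + b) = 2 - rtr Z + 2 * F.
  by rewrite nrm2D Ab nA nb; ring.
have -> : rho - sigma = toC 2^-1 *: ((A - b) *m adj (A + b) + (A + b) *m adj (A - b)) + - Z.
  have -> : rho - sigma = (A *m adj A - b *m adj b) - Z.
    by rewrite eZ (psdmx_herm hA) eA opprB [Z - _]addrC addrA addrK.
  congr (_ + _).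
  apply: (scalerI (a := toC 2)); first by apply/eqP=> -[]/eqP; rewrite pnatr_eq0.
  rewrite scalerA -toCM divff ?pnatr_eq0 // scale1r /Defs.toC rmorph_nat scaler_nat mulr2n.
  rewrite adjmxD adjmxB !mulmxDl !mulmxDr !mulNmx !mulmxN.
  move: (A *m adj A) (A *m adj b) (b *m adj A) (b *m adj b) => x y z w.
  by apply/matrixP => i j; rewrite !mxE; ring.
apply: le_trans (trnormD _ _) _; rewrite trnormN (trnorm_psd hZ).
have zle : 0 <= rtr Z := rtr_ge0 hZ.
(* This weight gives [(1 + F) / t = eta] and [t (1 - F) = (1 - F^2) / eta <= eta], so both halves of
   the bound cost [eta]. *)
pose t := (1 + F) / eta.
have t0 : 0 < t by rewrite divr_gt0 // ltr_wpDr.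
have b1 := trnorm_amgm (A - b) (A + b) t0.
have ti0 : 0 < t^-1 by rewrite invr_gt0.
have b2 := trnorm_amgm (A + b) (A - b) ti0.
rewrite invrK n1 n2 in b1 b2.
have b3 : trnorm (toC 2^-1 *: ((A - b) *m adj (A + b) + (A + b) *m adj (A - b))) <=
   2^-1 * (trnorm ((A - b) *m adj (A + b)) + trnorm ((A + b) *m adj (A - b))).
  by apply: le_trans (trnormZ _ _) _; rewrite ?invr_ge0 // ler_pM2l ?invr_gt0 // trnormD.
have tt : 2 <= t + t^-1.
  rewrite -subr_ge0 (_ : _ - _ = (t - 1) ^+ 2 / t); last by field; rewrite gt_eqF.
  by rewrite divr_ge0 ?sqr_ge0 // ltW.
have ttz : 2 * rtr Z <= (t + t^-1) * rtr Z by rewrite ler_wpM2r.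
have c1 : t * (1 - F) <= eta.
  rewrite /t mulrAC ler_pdivrMr // -expr2; move: hFe; rewrite -{1}[1](expr1n _ 2) subr_sqr mulrC.
  by [].
have c2 : t^-1 * (1 + F) = eta.
  by rewrite /t invf_div divfK // gt_eqF // ltr_wpDr.
exact: (trnorm_pdist_arith b1 b2 b3 ttz c1 c2).
Qed.

End Norms.

(** * Block matrices and classical-quantum states *)

Section Tensors.
Variable R : realType.
Local Notation C := (R[i]).
Local Notation toC := (@toC R).
Local Notation adj := (@adjmx R _ _).

(** Compression by the 0/1 matrix that selects the indices [f]; diagonal blocks and partial traces
    are made of such compressions. *)
Lemma psdmx_mxsub n k (f : 'I_k -> 'I_n) (A : 'M[C]_n) : psdmx A ->
  psdmx (\matrix_(i, j) A (f i) (f j)).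
Proof.
move=> hA; pose E : 'M[C]_(n, k) := \matrix_(i, j) ((i == f j)%:R : C).
have -> : \matrix_(i, j) A (f i) (f j) = adj E *m A *m E.
  apply/matrixP => i j; rewrite !mxE (bigD1 (f j)) //= big1 ?addr0; last first.
    by move=> l /negbTE lj; rewrite [E _ _]mxE lj mulr0.
  rewrite [E _ _]mxE eqxx mulr1 mxE (bigD1 (f i)) //= big1 ?addr0; last first.
    by move=> l /negbTE lj; rewrite !mxE lj conjc0 mul0r.
  by rewrite !mxE eqxx conjc1 mul1r.
exact: psdmx_conj.
Qed.

Lemma sum_mxtens_index (Z : nmodType) m n (F : 'I_(m * n) -> Z) :
  \sum_k F k = \sum_(i < m) \sum_(j < n) F (mxtens_index (i, j)).
Proof.
rewrite pair_big /= (reindex (@mxtens_index m n)) /=; last first.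
  by exists (@mxtens_unindex m n) => x _; [exact: mxtens_indexK | exact: mxtens_unindexK].
by apply: eq_bigr => -[].
Qed.

Lemma mxtens_inj m n (A B : 'M[C]_(m * n)) :
  (forall i j, blk A i j = blk B i j) -> A = B.
Proof.
move=> h; apply/matrixP => k l.
case: (mxtens_indexP k) => i a; case: (mxtens_indexP l) => j b.
by have /matrixP/(_ a b) := h i j; rewrite !mxE.
Qed.

Lemma blkD m n (A B : 'M[C]_(m * n)) i j : blk (A + B) i j = blk A i j + blk B i j.
Proof. by apply/matrixP => a b; rewrite !mxE. Qed.

Lemma blkB m n (A B : 'M[C]_(m * n)) i j : blk (A - B) i j = blk A i j - blk B i j.
Proof. by apply/matrixP => a b; rewrite !mxE. Qed.

Lemma blk0 m n i j : blk (0 : 'M[C]_(m * n)) i j = 0.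
Proof. by apply/matrixP => a b; rewrite !mxE. Qed.

Lemma blkZ m n (c : C) (A : 'M[C]_(m * n)) i j : blk (c *: A) i j = c *: blk A i j.
Proof. by apply/matrixP => a b; rewrite !mxE. Qed.

Lemma blk_sum m n I (r : seq I) (P : pred I) (F : I -> 'M[C]_(m * n)) i j :
  blk (\sum_(k <- r | P k) F k) i j = \sum_(k <- r | P k) blk (F k) i j.
Proof.
by apply: (big_morph (fun A => blk A i j)) => [A B|]; rewrite ?blkD ?blk0.
Qed.

Lemma blk_tens m n (A : 'M[C]_m) (B : 'M[C]_n) i j : blk (tensmx A B) i j = A i j *: B.
Proof. by apply/matrixP => a b; rewrite !mxE !mxtens_indexK. Qed.

Lemma blk1 m n i j : blk (1%:M : 'M[C]_(m * n)) i j = (i == j)%:R *: 1%:M.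
Proof.
apply/matrixP => a b; rewrite !mxE (inj_eq (can_inj (@mxtens_indexK m n))).
by rewrite xpair_eqE -natrM mulnb.
Qed.

Lemma blk_mul m n (A B : 'M[C]_(m * n)) i j :
  blk (A *m B) i j = \sum_k blk A i k *m blk B k j.
Proof.
apply/matrixP => a b; rewrite summxE !mxE sum_mxtens_index.
by apply: eq_bigr => k _; rewrite !mxE; apply: eq_bigr => l _; rewrite !mxE.
Qed.

Lemma blk_adj m n (A : 'M[C]_(m * n)) i j : blk (adj A) i j = adj (blk A j i).
Proof. by apply/matrixP => a b; rewrite !mxE. Qed.

Lemma psdmx_blk m n (A : 'M[C]_(m * n)) i : psdmx A -> psdmx (blk A i i).
Proof. exact: (psdmx_mxsub (fun a => mxtens_index (i, a))). Qed.

Lemma psdmx_ptrace2 m n (A : 'M[C]_(m * n)) : psdmx A -> psdmx (ptrace2 A).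
Proof.
move=> hA; have -> : ptrace2 A = \sum_a \matrix_(i, j)
    A (mxtens_index (i, a)) (mxtens_index (j, a)).
  apply/matrixP => i j; rewrite summxE mxE.
  by apply: eq_bigr => a _; rewrite !mxE.
by apply: psdmx_sum => a _; apply: (psdmx_mxsub (fun i => mxtens_index (i, a))).
Qed.

Lemma psdmx_ptrace1 m n (A : 'M[C]_(m * n)) : psdmx A -> psdmx (ptrace1 A).
Proof. by move=> hA; apply: psdmx_sum => i _; apply: psdmx_blk. Qed.

Lemma mxtrace_blk m n (A : 'M[C]_(m * n)) : \tr A = \sum_i \tr (blk A i i).
Proof.
rewrite /mxtrace sum_mxtens_index; apply: eq_bigr => i _.
by apply: eq_bigr => a _; rewrite mxE.
Qed.

Lemma mxtrace_ptrace2 m n (A : 'M[C]_(m * n)) : \tr (ptrace2 A) = \tr A.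
Proof. by rewrite mxtrace_blk; apply: eq_bigr => i _; rewrite mxE. Qed.

Lemma mxtrace_ptrace1 m n (A : 'M[C]_(m * n)) : \tr (ptrace1 A) = \tr A.
Proof. by rewrite mxtrace_blk raddf_sum. Qed.

Lemma state_ptrace2 m n (A : 'M[C]_(m * n)) : is_state A -> is_state (ptrace2 A).
Proof. by case=> h t; split; rewrite ?mxtrace_ptrace2 //; apply: psdmx_ptrace2. Qed.

Lemma state_ptrace1 m n (A : 'M[C]_(m * n)) : is_state A -> is_state (ptrace1 A).
Proof. by case=> h t; split; rewrite ?mxtrace_ptrace1 //; apply: psdmx_ptrace1. Qed.

Lemma rtr_state n (A : 'M[C]_n) : is_state A -> rtr A = 1.
Proof. by case=> _; rewrite /rtr => ->. Qed.

Lemma ptrace2D m n (A B : 'M[C]_(m * n)) : ptrace2 (A + B) = ptrace2 A + ptrace2 B.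
Proof. by apply/matrixP => i j; rewrite !mxE blkD raddfD. Qed.

Lemma ptrace2Z m n (c : C) (A : 'M[C]_(m * n)) : ptrace2 (c *: A) = c *: ptrace2 A.
Proof. by apply/matrixP => i j; rewrite !mxE blkZ mxtraceZ. Qed.

Lemma ptrace20 m n : ptrace2 (0 : 'M[C]_(m * n)) = 0.
Proof. by apply/matrixP => i j; rewrite !mxE blk0 mxtrace0. Qed.

Lemma ptrace1D m n (A B : 'M[C]_(m * n)) : ptrace1 (A + B) = ptrace1 A + ptrace1 B.
Proof. by rewrite /ptrace1 -big_split; apply: eq_bigr => i _; rewrite blkD. Qed.

Lemma ptrace1Z m n (c : C) (A : 'M[C]_(m * n)) : ptrace1 (c *: A) = c *: ptrace1 A.
Proof. by rewrite /ptrace1 scaler_sumr; apply: eq_bigr => i _; rewrite blkZ. Qed.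

Lemma ptrace10 m n : ptrace1 (0 : 'M[C]_(m * n)) = 0.
Proof. by rewrite /ptrace1 big1 // => i _; rewrite blk0. Qed.

Lemma state_chan dA dBE (V : 'M[C]_(dBE, dA)) rho :
  is_isometry V -> is_state rho -> is_state (chan V rho).
Proof.
move=> hV [hr tr]; split.
  by have := psdmx_conj (adj V) hr; rewrite adjmxK.
by rewrite /chan mxtrace_mulC mulmxA hV mul1mx.
Qed.

(** The blocks are unnormalised and carry the probabilities; nesting [cq] gives two classical
    registers. *)
Definition cq m n (F : 'I_m -> 'M[C]_n) : 'M[C]_(m * n) :=
  \sum_i tensmx (delta_mx i i) (F i).

Lemma blk_cq m n (F : 'I_m -> 'M[C]_n) i j : blk (cq F) i j = (i == j)%:R *: F i.
Proof.
rewrite /cq blk_sum (bigD1 i) //= blk_tens mxE eqxx andTb eq_sym big1 ?addr0 //.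
by move=> k /negbTE ki; rewrite blk_tens mxE eq_sym ki scale0r.
Qed.

Lemma blk_cqd m n (F : 'I_m -> 'M[C]_n) i : blk (cq F) i i = F i.
Proof. by rewrite blk_cq eqxx scale1r. Qed.

Lemma ptrace1_cq m n (F : 'I_m -> 'M[C]_n) : ptrace1 (cq F) = \sum_i F i.
Proof. by apply: eq_bigr => i _; rewrite blk_cqd. Qed.

Lemma ptrace2_cq m n (F : 'I_m -> 'M[C]_n) (p : 'I_m -> R) :
  (forall i, \tr (F i) = toC (p i)) -> ptrace2 (cq F) = cstate p.
Proof.
move=> h; apply/matrixP => i j; rewrite !mxE blk_cq mxtraceZ h.
by case: eqP => _; rewrite ?mul1r ?mul0r ?mulr1n ?mulr0n.
Qed.

Lemma rtr_mul_cq m n (T : 'M[C]_(m * n)) (F : 'I_m -> 'M[C]_n) :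
  rtr (T *m cq F) = \sum_i rtr (blk T i i *m F i).
Proof.
rewrite /rtr mxtrace_blk reC_sum; apply: eq_bigr => i _.
rewrite blk_mul (bigD1 i) //= blk_cqd big1 ?addr0 // => k /negbTE ki.
by rewrite blk_cq ki scale0r mulmx0.
Qed.

Lemma idtens_cq m n k (f : 'M[C]_n -> 'M[C]_k) (F : 'I_m -> 'M[C]_n) :
  f 0 = 0 -> idtens f (cq F) = cq (f \o F).
Proof.
move=> f0; apply: eq_bigr => i _; rewrite (bigD1 i) //= blk_cqd big1 ?addr0 //.
by move=> j /negbTE ji; rewrite blk_cq eq_sym ji scale0r f0 tensmx0.
Qed.

Lemma eq_cq m n (F G : 'I_m -> 'M[C]_n) : F =1 G -> cq F = cq G.
Proof. by move=> h; apply: eq_bigr => i _; rewrite h. Qed.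

Lemma cqZ m n (c : C) (F : 'I_m -> 'M[C]_n) : c *: cq F = cq (fun i => c *: F i).
Proof.
apply: mxtens_inj => i j; rewrite blkZ !blk_cq !scalerA; congr (_ *: _).
by rewrite mulrC.
Qed.

Lemma tens_cstate_cq m n (p : 'I_m -> R) (B : 'M[C]_n) :
  tensmx (cstate p) B = cq (fun i => toC (p i) *: B).
Proof.
apply: mxtens_inj => i j; rewrite blk_tens blk_cq scalerA !mxE; congr (_ *: _).
by case: eqP => _; rewrite ?mul1r ?mul0r ?mulr1n ?mulr0n.
Qed.

Lemma psdmx_cq m n (F : 'I_m -> 'M[C]_n) : (forall i, psdmx (F i)) -> psdmx (cq F).
Proof.
move=> h v.
have -> : adj v *m cq F *m v = \sum_i
   adj (\col_a v (mxtens_index (i, a)) 0) *m F i *m (\col_a v (mxtens_index (i, a)) 0).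
  apply/matrixP => k l; rewrite summxE !mxE sum_mxtens_index; apply: eq_bigr => i _.
  rewrite mxE; apply: eq_bigr => b _; rewrite !mxE !ord1; congr (_ * _).
  rewrite sum_mxtens_index (bigD1 i) //= [X in _ + X]big1 ?addr0; last first.
    move=> j /negbTE ji; apply: big1 => a _.
    have /matrixP/(_ a b) := blk_cq F j i.
    by rewrite ji scale0r !mxE => ->; rewrite mulr0.
  apply: eq_bigr => a _; have /matrixP/(_ a b) := blk_cqd F i.
  by rewrite !mxE => ->.
by rewrite summxE; apply: sumr_ge0 => i _; apply: h.
Qed.

(** Pinching: the optimal contractions of the diagonal blocks are glued into one block-diagonal
    contraction. *)
Lemma trnorm_cq_ge m n (A : 'M[C]_(m * n)) : \sum_i trnorm (blk A i i) <= trnorm A.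
Proof.
pose W i := sval (cid2 (trnorm_polar (blk A i i))).
have hW i : contraction (W i) by rewrite /W; case: cid2.
have eW i : trnorm (blk A i i) = rtr (W i *m blk A i i) by rewrite /W; case: cid2.
rewrite (eq_bigr (fun i => rtr (blk A i i *m W i))); last by move=> i _; rewrite eW rtrC.
rewrite -rtr_mul_cq rtrC; apply: trnorm_ge.
rewrite /contraction.
have -> : 1%:M - cq W *m adj (cq W) = cq (fun i => 1%:M - W i *m adj (W i)).
  apply: mxtens_inj => i j; rewrite blkB blk1 blk_mul blk_cq (bigD1 i) //= big1 ?addr0.
    rewrite blk_adj !blk_cq eqxx scale1r; case: (eqVneq i j) => [->|ij].
      by rewrite !scale1r.
    rewrite !scale0r.
    by rewrite adjmx0 mulmx0 subr0.
  by move=> k /negbTE ki; rewrite blk_cq eq_sym ki scale0r mul0mx.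
by apply: psdmx_cq.
Qed.

(** Diagonal blocks of a contraction are contractions: the [(i, i)] block of [W W^*] is
    [W_ii W_ii^*] plus Gram matrices. *)
Lemma trnorm_cq_le m n (F : 'I_m -> 'M[C]_n) : trnorm (cq F) <= \sum_i trnorm (F i).
Proof.
have [W hW ->] := trnorm_polar (cq F).
rewrite rtr_mul_cq; apply: ler_sum => i _; apply: trnorm_ge.
rewrite /contraction.
have -> : 1%:M - blk W i i *m adj (blk W i i) = blk (1%:M - W *m adj W) i i +
    \sum_(k | k != i) blk W i k *m adj (blk W i k).
  rewrite blkB blk1 eqxx scale1r blk_mul (bigD1 i) //= blk_adj opprD addrA.
  rewrite [X in _ = _ - X + _](eq_bigr (fun k => blk W i k *m adj (blk W i k))).
    by rewrite subrK.
  by move=> k _; rewrite blk_adj.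
apply: psdmxD; first exact: psdmx_blk.
apply: psdmx_sum => k _; rewrite -{1}(adjmxK (blk W i k)); exact: psdmx_gram.
Qed.

End Tensors.

(** * Hypothesis tests *)

Section Testing.
Variable R : realType.
Local Notation C := (R[i]).
Local Notation toC := (@toC R).
Local Notation adj := (@adjmx R _ _).

Local Open Scope classical_set_scope.

Lemma psdmx_cstate n (p : 'I_n -> R) : (forall i, 0 <= p i) -> psdmx (cstate p).
Proof. exact: psdmx_diag. Qed.

Lemma cstateM n (p q : 'I_n -> R) :
  cstate p *m cstate q = cstate (fun i => p i * q i).
Proof.
rewrite /cstate mulmx_diag; congr diag_mx; apply/rowP => i.
by rewrite !mxE toCM.
Qed.

Lemma rtr_cstate n (p : 'I_n -> R) : rtr (cstate p) = \sum_i p i.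
Proof. by rewrite /rtr mxtrace_diag reC_sum; apply: eq_bigr => i _; rewrite mxE. Qed.

Lemma mx_sqrt_cstate n (p : 'I_n -> R) : (forall i, 0 <= p i) ->
  mx_sqrt (cstate p) = cstate (fun i => Num.sqrt (p i)).
Proof.
move=> p0; apply: mx_sqrt_uniq; first by apply: psdmx_cstate => i; apply: sqrtr_ge0.
rewrite cstateM; congr cstate; apply/funext => i.
by rewrite -expr2 sqr_sqrtr.
Qed.

Lemma fidelity_cstate n (p q : 'I_n -> R) : (forall i, 0 <= p i) -> (forall i, 0 <= q i) ->
  fidelity (cstate p) (cstate q) = \sum_i Num.sqrt (p i) * Num.sqrt (q i).
Proof.
move=> p0 q0; rewrite /fidelity !mx_sqrt_cstate // cstateM trnorm_psd ?rtr_cstate //.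
by apply: psdmx_cstate => i; rewrite mulr_ge0 ?sqrtr_ge0.
Qed.

(* By Cauchy-Schwarz the squared fidelity is at most the [q]-mass of the support
   of [p]. *)
Lemma pdist_cstate_support n (p q : 'I_n -> R) eta : is_distr p -> is_distr q ->
  pdist (cstate p) (cstate q) <= eta -> \sum_(i | ~~ (0 < p i)) q i <= eta ^+ 2.
Proof.
move=> [p0 p1] [q0 q1]; rewrite /pdist fidelity_cstate //.
set F := \sum_i _ => hF.
have F0 : 0 <= F by apply: sumr_ge0 => i _; rewrite mulr_ge0 ?sqrtr_ge0.
set P := \sum_(i | 0 < p i) q i.
have eP : \sum_(i | ~~ (0 < p i)) q i = 1 - P.
  by have := q1; rewrite (bigID (fun i => 0 < p i)) /= -/P => <-; rewrite [P + _]addrC addrK.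
have P0 : 0 <= P by apply: sumr_ge0.
have FP : F ^+ 2 <= P.
  have [->|F1] := eqVneq F 0; first by rewrite expr0n.
  have {F1}F1 : 0 < F by rewrite lt_neqAle eq_sym F1.
  (* Termwise [sqrt p sqrt q <= (q / F + p F) / 2]; taking [F] itself as weight yields
     [F^2 <= P]. *)
  have : F <= (P / F + F) / 2.
    rewrite {1}/F (bigID (fun i => 0 < p i)) /= [X in _ + X]big1 ?addr0; last first.
      move=> i; rewrite lt_neqAle p0 andbT negbK => /eqP <-.
      by rewrite sqrtr0 mul0r.
    have -> : (P / F + F) / 2 = \sum_(i | 0 < p i) (q i / F / 2) + F / 2.
      by rewrite -!mulr_suml -/P; field; rewrite gt_eqF.
    have {2}-> : F = \sum_i (p i * F) by rewrite -mulr_suml p1 mul1r.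
    rewrite [X in _ + X / 2](bigID (fun i => 0 < p i)) /= [X in _ + (_ + X) / 2]big1 ?addr0.
      rewrite mulr_suml -big_split /=; apply: ler_sum => i pi.
      have := sqr_ge0 (Num.sqrt (p i) * F - Num.sqrt (q i)).
      rewrite sqrrB exprMn !sqr_sqrtr // => h.
      rewrite -(ler_pM2r (x := F * 2)) ?mulr_gt0 //.
      have -> : (q i / F / 2 + p i * F / 2) * (F * 2) = q i + p i * F ^+ 2.
        by field; rewrite gt_eqF.
      by move: h; rewrite -mulr_natr; lra.
    by move=> i; rewrite lt_neqAle p0 andbT negbK => /eqP <-; rewrite mul0r.
  move=> h; have : F * (F * 2) <= (P / F + F) / 2 * (F * 2) by rewrite ler_pM2r ?mulr_gt0.
  have -> : (P / F + F) / 2 * (F * 2) = P + F ^+ 2 by field; rewrite gt_eqF.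
  rewrite expr2; lra.
rewrite eP.
have : 1 - F ^+ 2 <= eta ^+ 2.
  have e0 : 0 <= eta by apply: le_trans hF; apply: sqrtr_ge0.
  have [h|h] := leP 0 (1 - F ^+ 2); last by rewrite (le_trans (ltW h)) // sqr_ge0.
  by rewrite -(sqr_sqrtr h) lerXn2r ?nnegrE ?sqrtr_ge0.
lra.
Qed.

Lemma ln2_gt0 : 0 < ln 2 :> R.
Proof. by apply: ln_gt0; rewrite ltr1n. Qed.

Lemma log2M (x y : R) : 0 < x -> 0 < y -> log2 (x * y) = log2 x + log2 y.
Proof. by move=> x0 y0; rewrite /log2 lnM ?posrE // mulrDl. Qed.

Lemma ltr_log2 (x y : R) : 0 < x -> 0 < y -> (log2 x < log2 y) = (x < y).
Proof.
by move=> x0 y0; rewrite /log2 ltr_pM2r ?invr_gt0 ?ln2_gt0 // ltr_ln ?posrE.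
Qed.

Lemma ler_log2 (x y : R) : 0 < x -> 0 < y -> (log2 x <= log2 y) = (x <= y).
Proof.
by move=> x0 y0; rewrite /log2 ler_pM2r ?invr_gt0 ?ln2_gt0 // ler_ln ?posrE.
Qed.

Lemma log2V (x : R) : 0 < x -> log2 x^-1 = - log2 x.
Proof. by move=> x0; rewrite /log2 lnV ?posrE // mulNr. Qed.

Lemma pow2_gt0 (l : R) : 0 < pow2 l. Proof. exact: expR_gt0. Qed.

Lemma log2_pow2 (l : R) : log2 (pow2 l) = l.
Proof. by rewrite /log2 /pow2 expRK mulfK // gt_eqF // ln2_gt0. Qed.

Lemma pow2D (l k : R) : pow2 (l + k) = pow2 l * pow2 k.
Proof. by rewrite /pow2 mulrDl expRD. Qed.

Lemma ler_pow2 (l k : R) : (pow2 l <= pow2 k) = (l <= k).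
Proof. by rewrite /pow2 ler_expR ler_pM2r // ln2_gt0. Qed.

Lemma pow2_0 : pow2 (0 : R) = 1. Proof. by rewrite /pow2 mul0r expR0. Qed.

Lemma pow2_1 : pow2 (1 : R) = 2. Proof. by rewrite /pow2 mul1r lnK // posrE. Qed.

(** Strictness yields a test from the infimum, attained or not. The form [a * x <= 1] also covers
    the value [+oo], where the infimum is 0. *)
Lemma DH_test n (eta a : R) (rho sigma : 'M[C]_n) : 0 <= eta -> psdmx sigma -> 0 < a ->
  ((log2 a)%:E < DH eta rho sigma)%E ->
  exists T, [/\ psdmx T, psdmx (1%:M - T), rtr ((1%:M - T) *m rho) <= eta &
    a * rtr (T *m sigma) <= 1].
Proof.
move=> eta0 hs a0; rewrite /DH.
set E := [set _ | _ in _].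
have E1 : E (rtr (1%:M *m sigma)).
  exists 1%:M => //; split; first exact: psdmx1.
  by rewrite subrr mul0mx; split; [exact: psdmx0 | rewrite mxtrace0].
have Elb : lbound E 0.
  by move=> _ [T [hT _] <-]; apply: (rtr_mul_ge0 hT hs).
have hE : has_inf E by split; [exists (rtr (1%:M *m sigma)) | exists 0].
have m0 : 0 <= inf E by apply: lb_le_inf => //; exists (rtr (1%:M *m sigma)).
move=> h; have : inf E < a^-1.
  move: h; case: eqP => [-> _|/eqP m1]; first by rewrite invr_gt0.
  have {}m0 : 0 < inf E by rewrite lt_neqAle eq_sym m1.
  by rewrite lte_fin ltrNr -log2V // ltr_log2 ?invr_gt0.
move=> /(inf_lt hE.1)[_ [T [hT [hT1 hTe]] <-] hlt].
exists T; split=> //.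
by rewrite mulrC -ler_pdivlMr // div1r ltW.
Qed.

End Testing.

(** * Conditional entropies of states with two classical registers *)

Section ConditionalEntropies.
Variable R : realType.
Local Notation C := (R[i]).
Local Notation toC := (@toC R).
Local Notation adj := (@adjmx R _ _).

Local Open Scope classical_set_scope.

(** The product of the marginals of a cq state is again block diagonal, so only the diagonal blocks
    of a test matter: one test per symbol. *)
Lemma IH_test m n (F : 'I_m -> 'M[C]_n) (p : 'I_m -> R) (eta a : R) :
  (forall i, psdmx (F i)) -> (forall i, \tr (F i) = toC (p i)) ->
  0 <= eta -> 0 < a -> ((log2 a)%:E < IH eta (cq F))%E ->
  exists T : 'I_m -> 'M[C]_n, [/\ forall i, psdmx (T i), forall i, psdmx (1%:M - T i),
    \sum_i rtr ((1%:M - T i) *m F i) <= eta &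
    a * \sum_i p i * rtr (T i *m \sum_j F j) <= 1].
Proof.
move=> hF tF eta0 a0; rewrite /IH (ptrace2_cq tF) ptrace1_cq tens_cstate_cq.
have hS : psdmx (\sum_j F j) by apply: psdmx_sum => j _; exact: hF.
have p0 i : 0 <= p i by rewrite -toC_ge0 -tF; exact: mxtrace_psd_ge0 (hF i).
move=> /(DH_test eta0 _ a0)[|T [hT hT1 h1 h2]].
  by apply: psdmx_cq => i; exact: psdmxZ (p0 i) hS.
exists (fun i => blk T i i); split.
- by move=> i; exact: psdmx_blk.
- by move=> i; have := psdmx_blk i hT1; rewrite blkB blk1 eqxx scale1r.
- move: h1; rewrite rtr_mul_cq (eq_bigr (fun i => rtr ((1%:M - blk T i i) *m F i))) //.
  by move=> i _; rewrite blkB blk1 eqxx scale1r.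
- move: h2; rewrite rtr_mul_cq (eq_bigr (fun i => p i * rtr (blk T i i *m \sum_j F j))) //.
  by move=> i _; rewrite -scalemxAr rtrZ.
Qed.

Section ClassicalClassicalQuantum.
Variables (nX nY d : nat) (p : 'I_nX -> 'I_nY -> R) (G : 'I_nX -> 'I_nY -> 'M[C]_d).
Hypothesis p0 : forall x y, 0 <= p x y.
Hypothesis p1 : \sum_x \sum_y p x y = 1.
Hypothesis hG : forall x y, is_state (G x y).

Definition ccq : 'M[C]_(nX * (nY * d)) := cq (fun x => cq (fun y => toC (p x y) *: G x y)).
Definition marg (x : 'I_nX) : R := \sum_y p x y.
(** Zero where [marg x = 0], by the convention on inverses. *)
Definition cond (x : 'I_nX) (y : 'I_nY) : R := p x y / marg x.

Lemma marg_ge0 x : 0 <= marg x. Proof. exact: sumr_ge0. Qed.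

Lemma marg_distr : is_distr marg. Proof. by split; [exact: marg_ge0 |]. Qed.

Lemma cond_ge0 x y : 0 <= cond x y.
Proof. by rewrite divr_ge0 // marg_ge0. Qed.

Lemma cond_sum x : 0 < marg x -> \sum_y cond x y = 1.
Proof. by move=> h; rewrite -mulr_suml -/(marg x) divff // gt_eqF. Qed.

Lemma mxtrace_cq_row (q : 'I_nY -> R) x : \tr (cq (fun y => toC (q y) *: G x y)) = toC (\sum_y q y).
Proof.
rewrite mxtrace_blk toC_sum; apply: eq_bigr => y _.
by rewrite blk_cqd mxtraceZ (hG x y).2 mulr1.
Qed.

Lemma ptrace2_ccq : ptrace2 ccq = cstate marg.
Proof. by apply: ptrace2_cq => x; rewrite mxtrace_cq_row. Qed.

Lemma cq_prob_ccq x : cq_prob ccq x = marg x.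
Proof. by rewrite /cq_prob ptrace2_ccq !mxE eqxx mulr1n. Qed.

Definition cond_state x : 'M[C]_(nY * d) := cq (fun y => toC (cond x y) *: G x y).

Lemma cq_cond_ccq x : cq_cond ccq x = cond_state x.
Proof.
rewrite /cq_cond cq_prob_ccq blk_cqd cqZ; apply: eq_cq => y.
by rewrite scalerA -toCM mulrC.
Qed.

Lemma psdmx_row q x y : 0 <= q -> psdmx (toC q *: G x y).
Proof. by move=> q0; exact: psdmxZ q0 (hG x y).1. Qed.

Lemma trace_row q x y : \tr (toC q *: G x y) = toC q.
Proof. by rewrite mxtraceZ (hG x y).2 mulr1. Qed.

Lemma is_state_cond_state x : 0 < marg x -> is_state (cond_state x).
Proof.
move=> mx; split; last by rewrite mxtrace_cq_row cond_sum.
by apply: psdmx_cq => y; apply: psdmx_row; apply: cond_ge0.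
Qed.

Lemma ptrace2_cond_state x : ptrace2 (cond_state x) = cstate (cond x).
Proof. by apply: ptrace2_cq => y; rewrite trace_row. Qed.

Lemma rtr_mul_row (q : R) (T : 'M[C]_d) x y : rtr (T *m (toC q *: G x y)) = q * rtr (T *m G x y).
Proof. by rewrite -scalemxAr rtrZ. Qed.

(** One near-optimal [p'] of the outer supremum serves all symbols; its support tells which symbols
    have a test. *)
Lemma IHcond_test (eta a : R) : 0 <= eta -> 0 < a ->
  ((log2 a)%:E < IHcond eta ccq)%E ->
  exists p' : 'I_nX -> R, [/\ is_distr p', pdist (cstate p') (cstate marg) <= eta &
    forall x, 0 < p' x -> 0 < marg x -> exists S : 'I_nY -> 'M[C]_d,
    [/\ forall y, psdmx (S y), forall y, psdmx (1%:M - S y),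
    \sum_y cond x y * rtr ((1%:M - S y) *m G x y) <= eta &
    a * \sum_y cond x y * rtr (S y *m \sum_z (toC (cond x z) *: G x z)) <= 1]].
Proof.
move=> eta0 a0 /ereal_sup_gt[_ [p' [dp' hp'] <-] hlt].
exists p'; split; [by [] | by rewrite -ptrace2_ccq |].
move=> x px mx.
have : ((log2 a)%:E < IH eta (cond_state x))%E.
  apply: (lt_le_trans hlt); apply: ereal_inf_lbound; exists x.
    by rewrite /= cq_prob_ccq.
  by rewrite cq_cond_ccq.
move=> /(IH_test (p := cond x) _ _ eta0 a0)[||S [h1 h2 h3 h4]].
- by move=> y; apply: psdmx_row; apply: cond_ge0.
- by move=> y; rewrite trace_row.
exists S; split=> //; move: h3; congr (_ <= _).
by apply: eq_bigr => y _; rewrite rtr_mul_row.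
Qed.

Lemma Imaxcond_lt (eta l : R) : (Imaxcond eta ccq < l%:E)%E ->
  exists p' : 'I_nX -> R, [/\ is_distr p', pdist (cstate p') (cstate marg) <= eta &
    forall x, 0 < p' x -> 0 < marg x -> exists rt : 'M[C]_(nY * d),
    [/\ is_state rt, pdist rt (cond_state x) <= eta &
        psdmx (toC (pow2 l) *: tensmx (cstate (cond x)) (ptrace1 rt) - rt)]].
Proof.
move=> /ereal_inf_lt[_ [p' [dp' hp'] <-] hlt].
exists p'; split; [by [] | by rewrite -ptrace2_ccq |].
move=> x px mx.
have : (ereal_inf [set Dmax rt (tensmx (ptrace2 (cq_cond ccq x)) (ptrace1 rt))
   | rt in [set rt : 'M[C]_(nY * d) | is_state rt /\ (pdist rt (cq_cond ccq x) <= eta)%R]] < l%:E)%E.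
  apply: le_lt_trans hlt; apply: ereal_sup_ubound; exists x => //.
  by rewrite /= cq_prob_ccq.
rewrite cq_cond_ccq ptrace2_cond_state => /ereal_inf_lt[_ [rt [srt hrt] <-]].
move=> /ereal_inf_lt[_ [k hk <-]]; rewrite lte_fin => kl.
exists rt; split; [exact: srt | exact: hrt |].
have hT : psdmx (tensmx (cstate (cond x)) (ptrace1 rt)).
  rewrite tens_cstate_cq; apply: psdmx_cq => y; apply: psdmxZ; first exact: cond_ge0.
  exact: psdmx_ptrace1 srt.1.
have h : 0 <= pow2 l - pow2 k by rewrite subr_ge0 ler_pow2 ltW.
have := psdmxD (psdmxZ h hT) hk; congr psdmx.
by rewrite addrA -scalerDl -toCD subrK.
Qed.

Lemma support_marg_neq0 (p' : 'I_nX -> R) eta : is_distr p' -> 0 <= eta < 1 ->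
  pdist (cstate p') (cstate marg) <= eta -> exists x, 0 < p' x /\ 0 < marg x.
Proof.
move=> dp' /andP[eta0 eta1] h; apply/not_existsP => hx.
have := pdist_cstate_support dp' marg_distr h.
have e : \sum_(x | 0 < p' x) marg x = 0.
  apply: big1 => x px; apply/eqP; rewrite eq_le marg_ge0 andbT leNgt.
  by apply/negP => mx; apply: (hx x).
have := marg_distr.2; rewrite (bigID (fun x => 0 < p' x)) /= e add0r => ->.
by rewrite leNgt exprn_ilt1.
Qed.

(** Taking traces in the operator inequality behind [Dmax] gives [1 <= 2^l]. A radius below 1
    ensures a symbol in both supports, hence a supremum over a nonempty set. The bound excludes
    [-oo] from the rate condition and later makes the number of randomization indices positive. *)
Lemma Imaxcond_ge0 (eta : R) : 0 <= eta < 1 -> (0 <= Imaxcond eta ccq)%E.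
Proof.
move=> he; rewrite leNgt; apply/negP => h.
have [l l0 hl] : exists2 l : R, l < 0 & (Imaxcond eta ccq < l%:E)%E.
  move: h; case: (Imaxcond eta ccq) => [r||] //.
    rewrite lte_fin => r0; exists (r / 2); first by rewrite pmulr_llt0.
    by rewrite lte_fin; lra.
  by exists (- 1); rewrite ?ltrN10 // ltNyr.
have [p' [dp' hp' H]] := Imaxcond_lt hl.
have [x [px mx]] := support_marg_neq0 dp' he hp'.
have [rt [srt _ hrt]] := H x px mx.
have := rtr_ge0 hrt; rewrite rtrB rtrZ (rtr_state srt) tens_cstate_cq.
have -> : rtr (cq (fun i => toC (cond x i) *: ptrace1 rt)) = 1.
  rewrite /rtr mxtrace_blk reC_sum -[RHS](cond_sum mx); apply: eq_bigr => y _.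
  by rewrite blk_cqd mxtraceZ mxtrace_ptrace1 srt.2 mulr1.
rewrite mulr1 subr_ge0 -[X in X <= _]pow2_0 ler_pow2; lra.
Qed.

(* Pinching the smoothed state to its [Y]-diagonal blocks keeps both the
   trace-norm bound and the operator bound. *)
Lemma smoothed_blocks (eta v : R) x rt : 0 < eta -> 0 < marg x -> is_state rt ->
  pdist rt (cond_state x) <= eta ->
  psdmx (toC v *: tensmx (cstate (cond x)) (ptrace1 rt) - rt) ->
  exists (omega : 'M[C]_d) (theta : 'I_nY -> 'M[C]_d),
  [/\ is_state omega, forall y, psdmx (theta y), \sum_y theta y = omega,
      forall y, psdmx (toC (v * cond x y) *: omega - theta y) &
      \sum_y trnorm (toC (cond x y) *: G x y - theta y) <= 2 * eta].
Proof.
move=> eta0 mx srt hp hv; exists (ptrace1 rt), (fun y => blk rt y y); split.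
- exact: state_ptrace1.
- by move=> y; apply: psdmx_blk srt.1.
- by [].
- move=> y; have := psdmx_blk y hv.
  by rewrite blkB blkZ tens_cstate_cq blk_cqd scalerA -toCM.
have h := trnorm_pdist srt (is_state_cond_state mx) eta0 hp.
apply: le_trans h; apply: le_trans (trnorm_cq_ge _).
by apply: ler_sum => y _; rewrite blkB blk_cqd -trnormN opprB.
Qed.

End ClassicalClassicalQuantum.

End ConditionalEntropies.

(** * Random coding *)

Section Covering.
Variable R : realType.
Local Notation C := (R[i]).
Local Notation toC := (@toC R).
Local Notation adj := (@adjmx R _ _).

(** The element found has positive weight: this is how the conditioning event is recovered for the
    chosen codebook. *)
Lemma exists_le_average (T : finType) (w f : T -> R) (b : R) :
  (forall t, 0 <= w t) -> \sum_t w t = 1 -> \sum_t w t * f t <= b ->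
  exists2 t, 0 < w t & f t <= b.
Proof.
move=> w0 w1 h; apply: contrapT => hn.
have hb t : 0 < w t -> b < f t.
  by move=> wt; rewrite ltNge; apply/negP => ft; apply: hn; exists t.
have : \sum_t w t * f t > \sum_t w t * b.
  rewrite lt_neqAle; apply/andP; split; last first.
    apply: ler_sum => t _; have [->|wt] := eqVneq (w t) 0; first by rewrite !mul0r.
    by rewrite ler_wpM2l // ltW // hb // lt_neqAle eq_sym wt w0.
  apply/negP => /eqP e.
  have z t : w t * (f t - b) = 0.
    have pos i : true -> 0 <= w i * (f i - b).
      move=> _; have [->|wt] := eqVneq (w i) 0; first by rewrite mul0r.
      by rewrite mulr_ge0 // subr_ge0 ltW // hb // lt_neqAle eq_sym wt w0.
    have s0 : \sum_i w i * (f i - b) = 0.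
      rewrite (eq_bigr (fun i => w i * f i - w i * b)); last by move=> i _; rewrite mulrBr.
      by rewrite big_split sumrN /= e subrr.
    exact: (psumr_eq0P pos s0 (i := t)).
  have w00 t : w t = 0.
    apply/eqP; rewrite eq_le w0 andbT leNgt; apply/negP => wt.
    have := z t => /eqP; rewrite mulf_eq0 subr_eq0 !gt_eqF //; exact: hb.
  by move: w1; rewrite big1 // => /esym/eqP; rewrite oner_eq0.
by rewrite -mulr_suml w1 mul1r ltNge h.
Qed.

Section ProductDistribution.
Variables (I T : finType) (q : T -> R).
Hypothesis q0 : forall t, 0 <= q t.
Hypothesis q1 : \sum_t q t = 1.

Definition prodw (c : {ffun I -> T}) : R := \prod_i q (c i).

Lemma prodw_ge0 c : 0 <= prodw c. Proof. exact: prodr_ge0. Qed.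

Lemma prodw_sum : \sum_c prodw c = 1.
Proof. by rewrite /prodw -(bigA_distr_bigA (fun (_ : I) => q)) big1. Qed.

Lemma prodw_gt0 c i : 0 < prodw c -> 0 < q (c i).
Proof.
move=> h; rewrite lt_neqAle q0 andbT eq_sym; apply: contraTneq h => e.
by rewrite /prodw (bigD1 i) //= e mul0r ltxx.
Qed.

Lemma prodw1 i (f : T -> R) : \sum_c prodw c * f (c i) = \sum_t q t * f t.
Proof.
pose F k t := if k == i then q t * f t else q t.
rewrite (eq_bigr (fun c : {ffun I -> T} => \prod_k F k (c k))); last first.
  move=> c _; rewrite /prodw (bigD1 i) //= [RHS](bigD1 i) //= /F eqxx mulrAC.
  by congr (_ * _); apply: eq_bigr => k /negbTE ->.
rewrite -(bigA_distr_bigA F) (bigD1 i) //= [X in _ * X]big1 ?mulr1.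
  by apply: eq_bigr => t _; rewrite /F eqxx.
by move=> k /negbTE ki; rewrite /F ki.
Qed.

Lemma prodw2 i j (g : T -> T -> R) : i != j ->
  \sum_c prodw c * g (c i) (c j) = \sum_s \sum_t q s * q t * g s t.
Proof.
move=> ij.
(* Freezing the value at [i] with an indicator turns the summand into a product over coordinates. *)
transitivity (\sum_s \sum_(c : {ffun I -> T}) prodw c * ((c i == s)%:R * g s (c j))).
  rewrite exchange_big; apply: eq_bigr => c _; rewrite (bigD1 (c i)) //= eqxx mul1r.
  rewrite big1 ?addr0 // => s; rewrite eq_sym => /negbTE ->.
  by rewrite mul0r mulr0.
apply: eq_bigr => s _.
pose F k t := if k == i then q t * (t == s)%:R else if k == j then q t * g s t else q t.
rewrite (eq_bigr (fun c : {ffun I -> T} => \prod_k F k (c k))); last first.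
  move=> c _; rewrite /prodw (bigD1 i) //= (bigD1 j) //=; last by rewrite eq_sym.
  rewrite [RHS](bigD1 i) //= [X in _ = _ * X](bigD1 j) //=; last by rewrite eq_sym.
  rewrite /F !eqxx (eq_sym j) (negbTE ij) !mulrA.
  rewrite -!mulrA; congr (_ * _).
  set X := \prod_(k | _) _; set Y := \prod_(k | _) _.
  have -> : X = Y.
    by apply: eq_bigr => k /andP[/negbTE -> /negbTE ->].
  by ring.
rewrite -(bigA_distr_bigA F) (bigD1 i) //= (bigD1 j) //=; last by rewrite eq_sym.
rewrite [X in _ * (_ * X)]big1 ?mulr1; last first.
  by move=> k /andP[/negbTE ki /negbTE kj]; rewrite /F ki kj.
rewrite (bigD1 s) //= /F !eqxx mulr1 [X in q s + X]big1 ?addr0.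
  rewrite mulr_sumr (eq_sym j) (negbTE ij).
  by apply: eq_bigr => t _; rewrite mulrA.
by move=> t /negbTE ->; rewrite mulr0.
Qed.

End ProductDistribution.

Lemma psdmx_antisym n (A : 'M[C]_n) : psdmx A -> psdmx (- A) -> A = 0.
Proof.
move=> h1 h2; apply: quad0_eq0 => v; apply/eqP.
by rewrite eq_le h1 andbT -oppr_ge0; have := h2 v; rewrite mulmxN mulNmx mxE.
Qed.

(** The compression of [tau] to the complement of [P] has trace at most 0, so
    [sqrt tau (1 - P) = 0]. *)
Lemma psdmx_le_support n (A P tau : 'M[C]_n) (c : R) :
  psdmx P -> A *m P = A -> psdmx tau -> psdmx (toC c *: A - tau) ->
  tau *m P = tau /\ P *m tau = tau.
Proof.
move=> hP AP ht hc; have [s hs es] := psd_root ht.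
have hQ : adj (1%:M - P) = 1%:M - P by rewrite adjmxB adjmx1 psdmx_herm.
have A0 : A *m (1%:M - P) = 0 by rewrite mulmxBr mulmx1 AP subrr.
have s0 : s *m (1%:M - P) = 0.
  apply: rtr_gram_eq0; apply/eqP; rewrite eq_le rtr_ge0 ?andbT; last exact: psdmx_gram.
  rewrite adjmx_mul hQ (psdmx_herm hs) -mulmxA [s *m (s *m _)]mulmxA es mulmxA.
  have := rtr_ge0 (psdmx_conj (1%:M - P) hc).
  rewrite hQ -mulmxA [(_ - tau) *m _]mulmxBl -scalemxAl A0 scaler0 sub0r mulmxN mulmxA.
  by rewrite rtrN oppr_ge0.
have t0 : tau *m (1%:M - P) = 0 by rewrite -es -mulmxA s0 mulmx0.
have e : tau *m P = tau.
  by apply/esym/eqP; rewrite -subr_eq0 -[X in X - _]mulmx1 -mulmxBr t0.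
by split=> //; rewrite -[in LHS](psdmx_herm ht) -{1}(psdmx_herm hP) -adjmx_mul e psdmx_herm.
Qed.

(* Second-moment method: with [Z y = omega^(-1/2) tau_y omega^(-1/2)], which is
   at most [v] and has mean the support projection of [omega], the variance of
   the empirical mean of [K] independent copies is at most [v / K]. *)
Lemma covering (n nY K : nat) (I : finType) (w : 'I_K -> I) (q : 'I_nY -> R)
    (tau : 'I_nY -> 'M[C]_n) (omega : 'M[C]_n) (v t : R) :
  injective w -> (0 < K)%N -> (forall y, 0 <= q y) -> \sum_y q y = 1 -> is_state omega ->
  (forall y, psdmx (tau y)) -> (forall y, psdmx (toC v *: omega - tau y)) ->
  \sum_y toC (q y) *: tau y = omega ->
  0 <= v -> 0 < t -> v / K%:R <= t ^+ 2 ->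
  \sum_(c : {ffun I -> 'I_nY}) prodw q c *
    trnorm (toC K%:R^-1 *: (\sum_k tau (c (w k))) - omega) <= t.
Proof.
move=> winj K0 q0 q1 [ho to] ht htv sq v0 t0 hv.
have KR : (0 : R) < K%:R by rewrite ltr0n.
have [r [Q [P [[hr hQ hP hP1] [[rr rQ Qr Pr rP] [PP QP PQ]]]]]] := psd_root_pinv ho.
have oP : omega *m P = omega by rewrite -rr -mulmxA rP.
pose Z y := Q *m tau y *m Q; pose D y := Z y - P.
have hZ y : psdmx (Z y) by exact: psdmx_conjh (ht y) hQ.
have rZr y : r *m Z y *m r = tau y.
  have [e1 e2] := psdmx_le_support hP oP (ht y) (htv y).
  by rewrite /Z !mulmxA rQ -mulmxA Qr e2 e1.
have rPr : r *m P *m r = omega by rewrite rP.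
have hD y : adj (D y) = D y by rewrite /D adjmxB (psdmx_herm (hZ y)) (psdmx_herm hP).
have sD : \sum_y toC (q y) *: D y = 0.
  rewrite (eq_bigr (fun y => Q *m (toC (q y) *: tau y) *m Q - toC (q y) *: P)).
    rewrite sumrB -mulmx_suml -mulmx_sumr sq -scaler_suml -toC_sum q1 scale1r.
    by rewrite -rr !mulmxA Qr Pr rQ subrr.
  by move=> y _; rewrite /D /Z scalerBr -scalemxAr -scalemxAl.
(* The covariance of the centred operators, weighted by [omega]; by independence and [sD] only
   diagonal terms survive in the variance. *)
pose g a b := rtr (D a *m omega *m D b).
have gZ : \sum_y q y * g y y <= v.
  have gE y : g y y = rtr (Z y *m omega *m Z y) - 2 * rtr (P *m omega *m Z y) + rtr omega.
    have e : rtr (Z y *m omega *m P) = rtr (P *m omega *m Z y).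
      rewrite -[LHS]rtr_adj 2!adjmx_mul (psdmx_herm hP) (psdmx_herm ho) (psdmx_herm (hZ y)).
      by rewrite mulmxA.
    have e2 : P *m omega *m P = omega.
      by rewrite -mulmxA oP -rr mulmxA Pr.
    by rewrite /g /D; move: (Z y) e => z e; rewrite !mulmxBl !mulmxBr !rtrB e e2; move: (rtr _) (rtr _) (rtr _) => x1 x2 x3; ring.
  have gle y : rtr (Z y *m omega *m Z y) <= v * rtr (tau y).
    have [z hz ez] := psd_root (hZ y).
    have h1 : psdmx (toC v *: P - Z y).
      have := psdmx_conjh (htv y) hQ; congr psdmx.
      rewrite mulmxBr mulmxBl -scalemxAr -scalemxAl; congr (_ *: _ - _).
      by rewrite -rr !mulmxA Qr Pr rQ.
    have h2 : psdmx (toC v *: 1%:M - Z y).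
      have := psdmxD h1 (psdmxZ v0 hP1); congr psdmx.
      by rewrite scalerBr addrC addrA subrK.
    (* Conjugating [Z <= v] by the square root of [Z] gives [Z^2 <= v Z], which is linear in [Z] and
       can be averaged. *)
    have h3 : psdmx (toC v *: Z y - Z y *m Z y).
      have := psdmx_conjh h2 hz; congr psdmx.
      rewrite mulmxBr mulmxBl -scalemxAr -scalemxAl mulmx1 ez; congr (_ - _).
      by rewrite -ez !mulmxA.
    rewrite -mulmxA rtrC -mulmxA rtrC.
    apply: le_trans (rtr_mul_le h3 ho) _.
    rewrite -scalemxAl rtrZ -rr mulmxA rtrC mulmxA rZr //.
  have sZ : \sum_y q y * rtr (P *m omega *m Z y) = rtr omega.
    have e : \sum_y toC (q y) *: Z y = P.
      have := sD; rewrite (eq_bigr (fun y => toC (q y) *: Z y - toC (q y) *: P)).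
        rewrite sumrB -[X in _ - X]scaler_suml -toC_sum q1 scale1r => /eqP.
        by rewrite subr_eq0 => /eqP.
      by move=> y _; rewrite scalerBr.
    rewrite (eq_bigr (fun y => rtr (P *m omega *m (toC (q y) *: Z y)))).
      by rewrite -rtr_sum -mulmx_sumr e -mulmxA oP -rr mulmxA Pr.
    by move=> y _; rewrite -scalemxAr rtrZ.
  have to1 : rtr omega = 1 by rewrite /rtr to.
  have st : \sum_y q y * rtr (tau y) = 1.
    rewrite -to1 -sq rtr_sum; apply: eq_bigr => y _; by rewrite rtrZ.
  rewrite (eq_bigr (fun y => q y * rtr (Z y *m omega *m Z y) -
      2 * (q y * rtr (P *m omega *m Z y)) + q y * rtr omega)); last first.
    by move=> y _; rewrite gE; move: (rtr _) (rtr _) (rtr _) => x1 x2 x3; ring.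
  rewrite big_split sumrB -mulr_sumr sZ -mulr_suml q1 to1 /=.
  have : \sum_y q y * rtr (Z y *m omega *m Z y) <= \sum_y v * (q y * rtr (tau y)).
    by apply: ler_sum => y _; rewrite mulrCA ler_wpM2l.
  rewrite -mulr_sumr st; move: (\sum_y _) => x; lra.
have gX k k' : k != k' ->
    \sum_(c : {ffun I -> 'I_nY}) prodw q c * g (c (w k)) (c (w k')) = 0.
  move=> kk; rewrite prodw2 //; last by rewrite (inj_eq winj).
  transitivity (rtr ((\sum_a toC (q a) *: D a) *m omega *m (\sum_b toC (q b) *: D b))).
    rewrite mulmx_suml mulmx_suml rtr_sum; apply: eq_bigr => a _.
    rewrite mulmx_sumr rtr_sum; apply: eq_bigr => b _.
    by rewrite -scalemxAr -!scalemxAl !rtrZ /g; ring.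
  by rewrite sD mulmx0 rtr0.
pose M (c : {ffun I -> 'I_nY}) := toC K%:R^-1 *: \sum_k D (c (w k)).
have hM c : adj (M c) = M c.
  by rewrite /M adjmxZ adjmx_sum; congr (_ *: _); apply: eq_bigr => k _; rewrite hD.
(* The deviation factors through [r], and [nrm2 r = 1], so its trace norm is controlled by the
   second moment of [r M]. *)
have XE (c : {ffun I -> 'I_nY}) : toC K%:R^-1 *: (\sum_k tau (c (w k))) - omega = r *m adj (r *m M c).
  rewrite adjmx_mul hM (psdmx_herm hr) /M -scalemxAl -scalemxAr.
  rewrite mulmx_suml mulmx_sumr.
  rewrite [in RHS](eq_bigr (fun k => tau (c (w k)) - omega)).
    rewrite sumrB scalerBr; congr (_ - _).
    rewrite sumr_const card_ord -scaler_nat scalerA.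
    have -> : (K%:R : C) = toC K%:R by rewrite /Defs.toC rmorph_nat.
    by rewrite -toCM mulVf ?gt_eqF // scale1r.
  by move=> k _; rewrite mulmxA /D mulmxBr mulmxBl rZr rPr.
have EM : \sum_(c : {ffun I -> 'I_nY}) prodw q c * nrm2 (r *m M c) <= v / K%:R.
  have nE c : nrm2 (r *m M c) = K%:R^-1 ^+ 2 * \sum_k \sum_k' g (c (w k)) (c (w k')).
    rewrite /nrm2 adjmx_mul hM (psdmx_herm hr) mulmxA -[M c *m r *m r]mulmxA rr /M.
    rewrite -scalemxAr -!scalemxAl rtrZ rtrZ mulrA -expr2; congr (_ * _).
    rewrite !mulmx_suml rtr_sum; apply: eq_bigr => k _.
    by rewrite mulmx_sumr rtr_sum.
  rewrite (eq_bigr (fun c => K%:R^-1 ^+ 2 *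
     (\sum_k \sum_k' prodw q c * g (c (w k)) (c (w k'))))); last first.
    move=> c _; rewrite nE mulrCA mulr_sumr; congr (_ * _).
    by apply: eq_bigr => k _; rewrite mulr_sumr.
  rewrite -mulr_sumr exchange_big /=.
  have -> : v / K%:R = K%:R^-1 ^+ 2 * (K%:R * v) by field; rewrite gt_eqF.
  rewrite ler_pM2l ?exprn_gt0 ?invr_gt0 //.
  have -> : K%:R * v = \sum_(k < K) v by rewrite sumr_const card_ord mulr_natl.
  apply: ler_sum => k _; rewrite exchange_big (bigD1 k) //= [X in _ + X]big1 ?addr0.
    by rewrite (prodw1 q1 (w k) (fun y => g y y)).
  by move=> k' kk; apply: gX; rewrite eq_sym.
have ti0 : 0 < t^-1 by rewrite invr_gt0.
apply: (@le_trans _ _ (\sum_c (t / 2 * prodw q c + t^-1 / 2 * (prodw q c * nrm2 (r *m M c))))).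
  apply: ler_sum => c _; rewrite XE.
  have h := trnorm_amgm r (r *m M c) t0.
  have nr : nrm2 r = 1 by rewrite /nrm2 (psdmx_herm hr) rr /rtr to.
  have w0 := prodw_ge0 q0 c.
  rewrite nr mulr1 in h.
  have := ler_wpM2l w0 h; congr (_ <= _); by field; rewrite gt_eqF.
rewrite big_split -!mulr_sumr prodw_sum //=.
have : t^-1 / 2 * (\sum_(c : {ffun I -> 'I_nY}) prodw q c * nrm2 (r *m M c)) <= t^-1 / 2 * t ^+ 2.
  by rewrite ler_wpM2l ?divr_ge0 ?(ltW ti0) // (le_trans EM).
have -> : t^-1 / 2 * t ^+ 2 = t / 2 by field; rewrite gt_eqF.
lra.
Qed.

End Covering.

(** * Codebook averages, the two-stage decoder and the balance of constants *)

Section Averages.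
Variable R : realType.
Local Notation C := (R[i]).
Local Notation toC := (@toC R).
Local Notation adj := (@adjmx R _ _).

Definition secrecy (d nY L K : nat) (rho : 'I_nY -> 'M[C]_d) (omega : 'M[C]_d)
    (c : {ffun 'I_L * 'I_K -> 'I_nY}) : R :=
  L%:R^-1 * \sum_l 2^-1 * trnorm (toC K%:R^-1 *: (\sum_k rho (c (l, k))) - omega).

(** Passing from the true states to the smoothed ones costs [2 eta] in trace norm, and covering
    costs [2 t]; the half in [secrecy] explains [(2 * t) ^+ 2]. *)
Lemma secrecy_average (d nY L K : nat) (q : 'I_nY -> R) (rho theta : 'I_nY -> 'M[C]_d)
    (omega : 'M[C]_d) (v eta t : R) :
  (0 < L)%N -> (0 < K)%N -> (forall y, 0 <= q y) -> \sum_y q y = 1 -> is_state omega ->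
  (forall y, psdmx (theta y)) -> \sum_y theta y = omega ->
  (forall y, psdmx (toC (v * q y) *: omega - theta y)) ->
  \sum_y trnorm (toC (q y) *: rho y - theta y) <= 2 * eta ->
  0 <= v -> 0 < t -> v / K%:R <= (2 * t) ^+ 2 ->
  \sum_(c : {ffun 'I_L * 'I_K -> 'I_nY}) prodw q c * secrecy rho omega c <= eta + t.
Proof.
move=> L0 K0 q0 q1 so ht st htv hB v0 t0 hv.
have KR : (0 : R) < K%:R by rewrite ltr0n.
have LR : (0 : R) < L%:R by rewrite ltr0n.
(* Zero where [q y = 0]; there the operator bound forces [theta y = 0], so nothing is lost. *)
pose tau y := toC (q y)^-1 *: theta y.
have th0 y : q y = 0 -> theta y = 0.
  move=> e; apply: psdmx_antisym; first exact: ht.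
  by have := htv y; rewrite e mulr0 toC0 scale0r sub0r.
have qtau y : toC (q y) *: tau y = theta y.
  rewrite /tau scalerA -toCM; have [e|e] := eqVneq (q y) 0.
    by rewrite th0 // scaler0.
  by rewrite divff // scale1r.
have htau y : psdmx (tau y) by apply: psdmxZ; [rewrite invr_ge0 | exact: ht].
have htauv y : psdmx (toC v *: omega - tau y).
  have [e|e] := eqVneq (q y) 0.
    by rewrite /tau th0 // scaler0 subr0; exact: psdmxZ v0 so.1.
  have qi : 0 <= (q y)^-1 by rewrite invr_ge0.
  have := psdmxZ qi (htv y); congr psdmx.
  by rewrite scalerBr scalerA -toCM mulrCA (mulVf e) mulr1.
have stau : \sum_y toC (q y) *: tau y = omega.
  by rewrite -st; apply: eq_bigr => y _.
have h1 : \sum_y q y * trnorm (rho y - tau y) <= 2 * eta.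
  apply: le_trans hB; apply: ler_sum => y _.
  have [e|e] := eqVneq (q y) 0; first by rewrite e mul0r trnorm_ge0.
  have qi : 0 <= (q y)^-1 by rewrite invr_ge0.
  have qp : 0 < q y by rewrite lt_neqAle eq_sym e q0.
  rewrite -ler_pdivlMl //.
  have := trnormZ (toC (q y) *: rho y - theta y) qi.
  by rewrite scalerBr scalerA -toCM (mulVf e) scale1r.
pose tn l (c : {ffun 'I_L * 'I_K -> 'I_nY}) :=
  trnorm (toC K%:R^-1 *: (\sum_k rho (c (l, k))) - omega).
suff hl l : \sum_c prodw q c * tn l c <= 2 * eta + 2 * t.
  rewrite (eq_bigr (fun c => L%:R^-1 * (2^-1 * \sum_l prodw q c * tn l c))); last first.
    move=> c _; rewrite /secrecy mulrCA -mulr_sumr [prodw q c * _]mulrCA.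
    by congr (_ * (_ * _)); rewrite -mulr_sumr.
  rewrite -mulr_sumr -mulr_sumr exchange_big /=.
  have : \sum_l \sum_c prodw q c * tn l c <= \sum_(l < L) (2 * eta + 2 * t).
    by apply: ler_sum => l _.
  rewrite sumr_const card_ord -mulr_natl => h.
  rewrite ler_pdivrMl // ler_pdivrMl //.
  by apply: (le_trans h); rewrite le_eqVlt; apply/orP; left; apply/eqP; ring.
have t20 : 0 < 2 * t by rewrite mulr_gt0.
have winj : injective (fun k : 'I_K => (l, k)) by move=> k k' [].
have h2 := covering winj K0 q0 q1 so htau htauv stau v0 t20 hv.
apply: le_trans (lerD h1 h2).
have e1 : \sum_y q y * trnorm (rho y - tau y) =
   \sum_(c : {ffun 'I_L * 'I_K -> 'I_nY}) prodw q c *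
     (K%:R^-1 * \sum_k trnorm (rho (c (l, k)) - tau (c (l, k)))).
  rewrite (eq_bigr (fun c => K%:R^-1 * \sum_k prodw q c *
      trnorm (rho (c (l, k)) - tau (c (l, k))))); last first.
    by move=> c _; rewrite mulrCA mulr_sumr.
  rewrite -mulr_sumr exchange_big /=.
  rewrite [X in _ = _ * X](eq_bigr (fun=> \sum_y q y * trnorm (rho y - tau y))).
    by rewrite sumr_const card_ord -[X in _ * X]mulr_natl mulKf // gt_eqF.
  by move=> k _; exact: (prodw1 q1 (l, k) (fun y => trnorm (rho y - tau y))).
rewrite e1 -big_split; apply: ler_sum => c _ /=.
rewrite -mulrDr ler_wpM2l ?prodw_ge0 //.
rewrite /tn; set X := toC _ *: _; set Y := toC _ *: \sum_k tau _.
have -> : X - omega = (X - Y) + (Y - omega) by rewrite addrA subrK.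
apply: le_trans (trnormD _ _) _; rewrite lerD2r.
rewrite /X /Y -scalerBr -sumrB.
have Ki : 0 <= K%:R^-1 :> R by rewrite invr_ge0 ltW.
apply: le_trans (trnormZ _ Ki) _; rewrite ler_wpM2l //.
exact: trnorm_sum.
Qed.

(** The Hayashi-Nagaoka bound for a uniform index of the codebook; [al] and [ga] are the two
    coefficients in [pretty_good_povm]. *)
Definition hncost (I T : finType) d (al ga : R) (A rho : T -> 'M[C]_d) (c : {ffun I -> T}) : R :=
  #|I|%:R^-1 * \sum_i (al * rtr ((1%:M - A (c i)) *m rho (c i)) +
     ga * \sum_(j | j != i) rtr (A (c j) *m rho (c i))).

(** Distinct codewords are independent, so each of the [#|I| - 1] false acceptances averages to the
    test on the product of the marginals, the second argument of the mutual information. *)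
Lemma hncost_average (I T : finType) d (al ga e b : R) (q : T -> R) (A rho : T -> 'M[C]_d) :
  (0 < #|I|)%N -> (forall t, 0 <= q t) -> \sum_t q t = 1 -> 0 <= al -> 0 <= ga ->
  \sum_t q t * rtr ((1%:M - A t) *m rho t) <= e ->
  (#|I|%:R - 1) * (\sum_t q t * rtr (A t *m \sum_s (toC (q s) *: rho s))) <= b ->
  \sum_(c : {ffun I -> T}) prodw q c * hncost al ga A rho c <= al * e + ga * b.
Proof.
move=> I0 q0 q1 al0 ga0 he hb; have IR : (0 : R) < #|I|%:R by rewrite ltr0n.
have cross i : \sum_(c : {ffun I -> T}) prodw q c * (\sum_(j | j != i) rtr (A (c j) *m rho (c i))) =
    (#|I|%:R - 1) * (\sum_t q t * rtr (A t *m \sum_s (toC (q s) *: rho s))).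
  rewrite (eq_bigr (fun c : {ffun I -> T} => \sum_(j | j != i) prodw q c * rtr (A (c j) *m rho (c i)))); last first.
    by move=> c _; rewrite mulr_sumr.
  rewrite exchange_big /=.
  rewrite (eq_bigr (fun=> \sum_t q t * rtr (A t *m \sum_s (toC (q s) *: rho s)))).
    rewrite sumr_const -[X in X = _]mulr_natl; congr (_ * _).
    have -> : #|[pred j | j != i]| = #|I|.-1.
      by rewrite -(cardC1 i); apply: eq_card.
    by rewrite -subn1 natrB.
  move=> j ji; rewrite (prodw2 q1 (fun s t => rtr (A s *m rho t))) //.
  apply: eq_bigr => t _; rewrite mulmx_sumr rtr_sum mulr_sumr.
  by apply: eq_bigr => s _; rewrite -scalemxAr rtrZ mulrA.
rewrite (eq_bigr (fun c : {ffun I -> T} => #|I|%:R^-1 * \sum_i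
   (al * (prodw q c * rtr ((1%:M - A (c i)) *m rho (c i))) +
    ga * (prodw q c * (\sum_(j | j != i) rtr (A (c j) *m rho (c i))))))); last first.
  move=> c _; rewrite /hncost mulrCA; congr (_ * _); rewrite mulr_sumr.
  by apply: eq_bigr => i _; rewrite mulrDr mulrCA [prodw q c * (ga * _)]mulrCA.
rewrite -mulr_sumr exchange_big /= ler_pdivrMl //.
have -> : #|I|%:R * (al * e + ga * b) = \sum_(i : I) (al * e + ga * b).
  by rewrite sumr_const -[RHS]mulr_natl.
apply: ler_sum => i _; rewrite big_split -!mulr_sumr cross.
rewrite (prodw1 q1 i (fun t => rtr ((1%:M - A t) *m rho t))).
by rewrite lerD // ler_wpM2l.
Qed.

(** The element for [(m, l)] is [sqrt (L_m) G_m(l, k) sqrt (L_m)] summed over [k]: the dummy index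
    is decoded and forgotten. The coefficients 3 and 2 come from [sequential_error]. *)
Lemma decoder (n M L K : nat) (A : 'I_M -> 'M[C]_n) (S : 'I_M -> 'I_L * 'I_K -> 'M[C]_n) (c : R) :
  0 < c ->
  (forall m, psdmx (A m)) -> (forall m, psdmx (1%:M - A m)) ->
  (forall m i, psdmx (S m i)) -> (forall m i, psdmx (1%:M - S m i)) ->
  exists D : 'I_M -> 'I_L -> 'M[C]_n,
  [/\ forall m l, psdmx (D m l), psdmx (1%:M - \sum_m \sum_l D m l) &
   forall m (rho : 'I_L * 'I_K -> 'M[C]_n), (forall i, psdmx (rho i)) ->
     \sum_l rtr ((1%:M - D m l) *m \sum_k rho (l, k)) <=
     \sum_i (3 * ((1 + c) * rtr ((1%:M - A m) *m rho i) +
        (2 + c + c^-1) * \sum_(j | j != m) rtr (A j *m rho i)) +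
      2 * ((1 + c) * rtr ((1%:M - S m i) *m rho i) +
        (2 + c + c^-1) * \sum_(j | j != i) rtr (S m j *m rho i)))].
Proof.
move=> c0 hA hA1 hS hS1.
have [Lm [hL hL1 errL]] := pretty_good_povm hA hA1.
have /choice [Gm HG] : forall m, exists G : 'I_L * 'I_K -> 'M[C]_n,
  [/\ forall i, psdmx (G i), psdmx (1%:M - \sum_i G i) &
   forall c rho i, 0 < c -> psdmx rho -> rtr ((1%:M - G i) *m rho) <=
     (1 + c) * rtr ((1%:M - S m i) *m rho) +
     (2 + c + c^-1) * \sum_(j | j != i) rtr (S m j *m rho)].
  by move=> m; exact: pretty_good_povm (hS m) (hS1 m).
have hG m i : psdmx (Gm m i) by case: (HG m).
have hGs m : psdmx (1%:M - \sum_i Gm m i) by case: (HG m).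
have errG m : forall rho i, psdmx rho -> rtr ((1%:M - Gm m i) *m rho) <=
     (1 + c) * rtr ((1%:M - S m i) *m rho) +
     (2 + c + c^-1) * \sum_(j | j != i) rtr (S m j *m rho).
  by move=> rho i hr; have [_ _ h] := HG m; exact: h.
have hl m : psdmx (mx_sqrt (Lm m)) := (mx_sqrtP (hL m)).1.
have el m : mx_sqrt (Lm m) *m mx_sqrt (Lm m) = Lm m := (mx_sqrtP (hL m)).2.
pose D m l := \sum_k mx_sqrt (Lm m) *m Gm m (l, k) *m mx_sqrt (Lm m).
have sub1 (I : finType) (F : I -> 'M[C]_n) i : (forall j, psdmx (F j)) ->
    psdmx (1%:M - \sum_j F j) -> psdmx (1%:M - F i).
  move=> hF h; apply: (fun h' => psdmx_trans h' h); rewrite (bigD1 i) //= addrAC subrr add0r.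
  by apply: psdmx_sum => j _; exact: hF.
exists D; split.
- by move=> m l; apply: psdmx_sum => k _; exact: psdmx_conjh (hG m _) (hl m).
- apply: (fun h => psdmx_trans h hL1).
  rewrite -sumrB; apply: psdmx_sum => m _.
  have -> : \sum_l D m l = mx_sqrt (Lm m) *m (\sum_i Gm m i) *m mx_sqrt (Lm m).
    rewrite mulmx_sumr mulmx_suml pair_big /=; apply: eq_bigr => -[l k] _ //.
  have := psdmx_conjh (hGs m) (hl m); congr psdmx.
  by rewrite mulmxBr mulmx1 mulmxBl el.
move=> m rho hrho.
have -> : \sum_i (3 * ((1 + c) * rtr ((1%:M - A m) *m rho i) +
        (2 + c + c^-1) * \sum_(j | j != m) rtr (A j *m rho i)) +
      2 * ((1 + c) * rtr ((1%:M - S m i) *m rho i) +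
        (2 + c + c^-1) * \sum_(j | j != i) rtr (S m j *m rho i))) =
  \sum_l \sum_k (3 * ((1 + c) * rtr ((1%:M - A m) *m rho (l, k)) +
        (2 + c + c^-1) * \sum_(j | j != m) rtr (A j *m rho (l, k))) +
      2 * ((1 + c) * rtr ((1%:M - S m (l, k)) *m rho (l, k)) +
        (2 + c + c^-1) * \sum_(j | j != (l, k)) rtr (S m j *m rho (l, k)))).
  by rewrite pair_big /=; apply: eq_bigr => -[l k].
apply: ler_sum => l _; rewrite mulmx_sumr rtr_sum; apply: ler_sum => k _.
set d := mx_sqrt (Lm m) *m Gm m (l, k) *m mx_sqrt (Lm m).
have h1 : rtr ((1%:M - D m l) *m rho (l, k)) <= rtr ((1%:M - d) *m rho (l, k)).
  apply: rtr_mul_le; last exact: hrho.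
  rewrite opprB addrC addrA subrK /D (bigD1 k) //= addrAC subrr add0r.
  by apply: psdmx_sum => j _; exact: psdmx_conjh (hG m _) (hl m).
apply: (le_trans h1).
have h2 := sequential_error (hL m) (sub1 _ _ m hL hL1) (hG m (l, k))
   (sub1 _ _ (l, k) (hG m) (hGs m)) (hrho (l, k)).
apply: (le_trans h2); apply: lerD; rewrite ler_pM2l //.
  exact: errL.
exact: errG.
Qed.

(** From [S < 1] follow [2 a < w] and [4 eps < w^2]; with [1 - u^2 = 2 w - w^2] this gives
    [w / h <= 8/7], whose square is below [4/3]. The left side is then at most [(4 + 2 w) eps / g].
    As [g = 2 a (1 + a) / S] and the target is [2 a (1 + a)], what remains is
    [(4 + 2 w) S <= 4 (1 + a)^2]. *)
Lemma rate_arith (eps u a S h g w al b0 ga e0 : R) :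
  0 < a -> a ^+ 2 = eps -> 0 < u < 1 -> S = u + 2 * a + 2 * eps -> S < 1 ->
  w = 1 - u -> 1 - eps ^+ 2 - u ^+ 2 <= h -> g = 1 - u / S ->
  0 <= al * e0 -> 0 <= ga * b0 -> al * e0 + ga * b0 = eps ->
  [/\ 0 < h, 0 < g, 0 < w &
  w * (3 * (al * e0 / (h * g) + ga * (w * b0) / (h ^+ 2 * g)) + 2 * (eps / g)) <=
    2 * a + 2 * eps].
Proof.
move=> a0 ae /andP[u0 u1] eS S1 ew hh eg p1 p2 ps.
have w0 : 0 < w by lra.
have eps0 : 0 < eps by rewrite -ae exprn_gt0.
have aw : 2 * a < w by lra.
have aw2 : 4 * eps < w ^+ 2.
  rewrite -ae; have -> : 4 * a ^+ 2 = (2 * a) ^+ 2 by ring.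
  by rewrite ltrXn2r ?nnegrE ?mulr_ge0 ?ltW.
have w1 : w < 1 by lra.
have ww : w ^+ 2 < w by rewrite expr2 -[X in _ < X]mulr1 ltr_pM2l.
have e4 : 16 * eps ^+ 2 < w ^+ 2.
  have -> : 16 * eps ^+ 2 = (4 * eps) ^+ 2 by ring.
  apply: (@lt_trans _ _ ((w ^+ 2) ^+ 2)).
    by rewrite ltrXn2r ?nnegrE ?mulr_ge0 ?sqr_ge0 ?ltW.
  by rewrite ltrXn2r ?nnegrE ?sqr_ge0 // ltW.
have hw : 7 * w <= 8 * h.
  have : 1 - u ^+ 2 = 2 * w - w ^+ 2 by rewrite ew; ring.
  lra.
have h0 : 0 < h by lra.
have S0 : 0 < S by lra.
have eg2 : g = (2 * a * (1 + a)) / S.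
  have -> : 2 * a * (1 + a) = S - u by rewrite eS -ae; ring.
  by rewrite eg; field; rewrite gt_eqF.
have g0 : 0 < g by rewrite eg2 divr_gt0 ?mulr_gt0 ?addr_gt0.
split=> //.
pose k := w / h.
have k0 : 0 <= k by rewrite divr_ge0 ?ltW.
have k1 : k <= 8 / 7 by rewrite /k ler_pdivrMr //; lra.
have k2 : k ^+ 2 <= 4 / 3.
  have : k * k <= 8 / 7 * k by apply: ler_wpM2r.
  by rewrite expr2; lra.
have -> : w * (3 * (al * e0 / (h * g) + ga * (w * b0) / (h ^+ 2 * g)) + 2 * (eps / g)) =
   (3 * (k * (al * e0) + k ^+ 2 * (ga * b0)) + 2 * w * eps) / g.
  by rewrite /k; field; rewrite ?gt_eqF.
have b1 : k * (al * e0) <= 4 / 3 * (al * e0) by rewrite ler_wpM2r //; lra.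
have b2 : k ^+ 2 * (ga * b0) <= 4 / 3 * (ga * b0) by rewrite ler_wpM2r.
rewrite ler_pdivrMr //.
apply: (@le_trans _ _ ((4 + 2 * w) * eps)).
  have b3 : 3 * (k * (al * e0) + k ^+ 2 * (ga * b0)) <= 4 * eps by rewrite -ps; lra.
  lra.
have -> : (2 * a + 2 * eps) * g = eps * (4 * (1 + a) ^+ 2 / S).
  by rewrite eg2 -ae; field; rewrite gt_eqF.
rewrite mulrC ler_pM2l // ler_pdivlMr //.
have z1 : u + (2 * a + 2 * eps) <= 1 by lra.
pose z := 2 * a + 2 * eps.
have q1 : (4 + 2 * w) * S <= 4 + 3 * z.
  have -> : S = u + z by rewrite eS /z; ring.
  rewrite ew; have q2 : (3 - 2 * u) * z <= (3 - 2 * u) * (1 - u).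
    by rewrite ler_pM2l; rewrite /z; lra.
  have -> : (4 + 2 * (1 - u)) * (u + z) = 6 * u + 3 * z - 2 * u ^+ 2 + (3 - 2 * u) * z by ring.
  have q3 : (3 - 2 * u) * (1 - u) = 3 - 5 * u + 2 * u ^+ 2 by ring.
  lra.
apply: (le_trans q1); rewrite /z.
have -> : 4 * (1 + a) ^+ 2 = 4 + 8 * a + 4 * eps by rewrite -ae; ring.
have : eps <= a by rewrite -ae expr2 -[X in _ <= X]mulr1 ler_pM2l //; lra.
lra.
Qed.

End Averages.

(** * Codebooks drawn from the conditioned distribution *)

Section Codebooks.
Variable R : realType.
Local Notation C := (R[i]).
Local Notation toC := (@toC R).
Local Notation adj := (@adjmx R _ _).

(** Each [x] is normalised by its own probability [G x] of a secure second component, at least [g]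
    by Markov. The first component therefore follows exactly [m] conditioned on [good]; only joint
    averages lose [1 / g]. *)
Lemma expurgated_distribution (X Y : finType) (good : pred X) (m : X -> R)
    (pr sec : X -> Y -> R) (u S : R) :
  (forall x, 0 <= m x) -> (forall x y, 0 <= pr x y) ->
  (forall x, good x -> \sum_y pr x y = 1) -> (forall x y, 0 <= sec x y) ->
  (forall x, good x -> \sum_y pr x y * sec x y <= u) -> 0 < u < S ->
  let h := \sum_(x | good x) m x in let g := 1 - u / S in 0 < h ->
  exists Q : X * Y -> R,
  [/\ forall t, 0 <= Q t, \sum_t Q t = 1,
   forall t, 0 < Q t -> good t.1 /\ sec t.1 t.2 <= S,
   forall f, (forall t, 0 <= f t) -> \sum_t Q t * f t <=
      (h * g)^-1 * \sum_(x | good x) m x * \sum_y pr x y * f (x, y) &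
   forall f, \sum_t Q t * f t.1 = h^-1 * \sum_(x | good x) m x * f x].
Proof.
move=> m0 pr0 pr1 sec0 secu /andP[u0 uS] h g h0.
have S0 : 0 < S by apply: lt_trans uS.
have g0 : 0 < g by rewrite subr_gt0 ltr_pdivrMr // mul1r.
pose G x := \sum_(y | sec x y <= S) pr x y.
have Gg x : good x -> g <= G x.
  move=> gx; have := pr1 x gx; rewrite (bigID (fun y => sec x y <= S)) /= -/(G x) => e.
  rewrite /g lerBlDr -e lerD2l ler_pdivlMr // mulr_suml.
  apply: le_trans (secu x gx); rewrite [X in _ <= X](bigID (fun y => sec x y <= S)) /=.
  rewrite -[X in X <= _]add0r lerD //.
    by apply: sumr_ge0 => y _; rewrite mulr_ge0.
  by apply: ler_sum => y; rewrite -ltNge => /ltW hy; rewrite ler_wpM2l.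
have G0 x : good x -> 0 < G x by move=> gx; apply: lt_le_trans (Gg x gx).
pose Q (t : X * Y) : R := if good t.1 && (sec t.1 t.2 <= S)
  then m t.1 / h * (pr t.1 t.2 / G t.1) else 0.
have Q0 t : 0 <= Q t.
  rewrite /Q; case: ifP => // /andP[gt _].
  by rewrite mulr_ge0 // divr_ge0 // ltW // G0.
have QX f : \sum_t Q t * f t.1 = h^-1 * \sum_(x | good x) m x * f x.
  rewrite -(pair_bigA _ (fun x y => Q (x, y) * f x)) /= [RHS]mulr_sumr big_mkcond [RHS]big_mkcond /=.
  apply: eq_bigr => x _; rewrite -mulr_suml; case: (boolP (good x)) => gx; last first.
    by rewrite big1 ?mul0r // => y _; rewrite /Q /= (negbTE gx).
  suff -> : \sum_y Q (x, y) = m x / h by ring.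
  rewrite (eq_bigr (fun y => if sec x y <= S then m x / h * (pr x y / G x) else 0)); last first.
    by move=> y _; rewrite /Q /= gx.
  rewrite -big_mkcond -mulr_sumr -mulr_suml -/(G x) divff ?mulr1 //.
  by rewrite gt_eqF // G0.
exists Q; split=> //.
- have := QX (fun=> 1); under eq_bigr do rewrite mulr1.
  by move=> ->; under eq_bigr do rewrite mulr1; rewrite mulVf // gt_eqF.
- by move=> t; rewrite /Q; case: ifP => [/andP[]|]; rewrite ?ltxx.
move=> f f0; rewrite (eq_bigr (fun t => Q (t.1, t.2) * f (t.1, t.2))); last by move=> [].
rewrite -(pair_bigA _ (fun x y => Q (x, y) * f (x, y))) /= mulr_sumr [X in _ <= X]big_mkcond /=.
apply: ler_sum => x _; case: (boolP (good x)) => gx; last first.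
  by rewrite big1 // => y _; rewrite /Q /= (negbTE gx) mul0r.
rewrite mulrA mulr_sumr; apply: ler_sum => y _; rewrite mulrA.
rewrite ler_wpM2r // /Q /= gx /=; case: ifP => _; last first.
  by rewrite mulr_ge0 // mulr_ge0 // invr_ge0 ltW // mulr_gt0.
have -> : (h * g)^-1 * m x * pr x y = m x / h * (pr x y / g).
  by field; rewrite ?gt_eqF.
rewrite ler_wpM2l ?divr_ge0 ?(ltW h0) // ler_wpM2l // lef_pV2 ?posrE ?G0 //.
exact: Gg.
Qed.

Lemma prodw_avg (I T : finType) (q : T -> R) (f : T -> R) : (0 < #|I|)%N -> \sum_t q t = 1 ->
  \sum_(c : {ffun I -> T}) prodw q c * (#|I|%:R^-1 * \sum_i f (c i)) = \sum_t q t * f t.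
Proof.
move=> I0 q1; rewrite (eq_bigr (fun c => #|I|%:R^-1 * \sum_i prodw q c * f (c i))); last first.
  by move=> c _; rewrite mulrCA mulr_sumr.
rewrite -mulr_sumr exchange_big /=.
rewrite [X in _ * X = _](eq_bigr (fun=> \sum_t q t * f t)).
  by rewrite sumr_const -[X in _ * X]mulr_natl mulKf // gt_eqF // ltr0n.
by move=> i _; exact: prodw1.
Qed.

(** Costs count only the first [N] messages, the decodable ones, while all [M] codewords have
    positive weight and inherit what holds on the support of [Q]. *)
Lemma codebook_exists (T : finType) (M N : nat) (Q : T -> R) (F : T -> R) (G : T -> T -> R) (A B : R) :
  (forall t, 0 <= Q t) -> \sum_t Q t = 1 -> (N <= M)%N ->
  \sum_t Q t * F t <= A -> \sum_s \sum_t Q s * Q t * G s t <= B ->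
  exists C : 'I_M -> T, (forall m, 0 < Q (C m)) /\
    \sum_(m < M | (m < N)%N) (F (C m) + \sum_(k < M | (k < N)%N && (k != m)) G (C k) (C m)) <=
      N%:R * (A + (N%:R - 1) * B).
Proof.
move=> Q0 Q1 NM hA hB.
have card1 : \sum_(m < M | (m < N)%N) (1 : R) = N%:R.
  by rewrite -(big_ord_widen M (fun=> (1 : R)) NM) sumr_const card_ord.
have card2 (m : 'I_M) : (m < N)%N -> \sum_(k < M | (k < N)%N && (k != m)) (1 : R) = N%:R - 1.
  by move=> mN; rewrite -card1 [in RHS](bigD1 m) //= addrAC subrr add0r.
have [|C C0 hC] := exists_le_average (prodw_ge0 Q0) (prodw_sum 'I_M Q1)
   (f := fun C : {ffun 'I_M -> T} => \sum_(m < M | (m < N)%N) (F (C m) +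
      \sum_(k < M | (k < N)%N && (k != m)) G (C k) (C m)))
   (b := N%:R * (A + (N%:R - 1) * B)); last first.
  by exists C; split=> // m; exact: prodw_gt0 C0.
rewrite (eq_bigr (fun C => \sum_(m < M | (m < N)%N) (prodw Q C * F (C m) +
   \sum_(k < M | (k < N)%N && (k != m)) prodw Q C * G (C k) (C m)))); last first.
  move=> C _; rewrite mulr_sumr; apply: eq_bigr => m _.
  by rewrite mulrDr mulr_sumr.
rewrite exchange_big /=.
have -> : N%:R * (A + (N%:R - 1) * B) = \sum_(m < M | (m < N)%N) (A + (N%:R - 1) * B).
  by rewrite -card1 mulr_suml; apply: eq_bigr => m _; rewrite mul1r card1.
apply: ler_sum => m mN; rewrite big_split; apply: lerD.
  by rewrite (prodw1 Q1 m F).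
rewrite exchange_big /= -(card2 m mN) mulr_suml; apply: ler_sum => k /andP[_ km].
by rewrite mul1r (prodw2 Q1 G km).
Qed.

End Codebooks.

(** * Error analysis of the conditioned random code *)

Section Coding.
Variable R : realType.
Local Notation C := (R[i]).
Local Notation toC := (@toC R).
Local Notation adj := (@adjmx R _ _).

(** Undecoded messages count as full errors: with a share at least [w] decoded at average error at
    most [Fail <= 1], the total is at most [u + w Fail], which [rate_arith] bounds by
    [u + 2 a + 2 eps]. *)
Lemma random_code (d dE nX nY M L K : nat) (p : 'I_nX -> 'I_nY -> R)
    (B : 'I_nX -> 'I_nY -> 'M[C]_d) (E : 'I_nX -> 'I_nY -> 'M[C]_dE)
    (good : pred 'I_nX) (omega : 'I_nX -> 'M[C]_dE) (S : 'I_nX -> 'I_nY -> 'M[C]_d)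
    (eps a u c e0 b0 : R) :
  (0 < M)%N -> (0 < L)%N -> (0 < K)%N ->
  (forall x y, 0 <= p x y) -> \sum_x \sum_y p x y = 1 ->
  (forall x y, is_state (B x y)) ->
  (forall x, good x -> 0 < marg p x) ->
  1 - eps ^+ 2 - u ^+ 2 <= \sum_(x | good x) marg p x ->
  (forall x y, psdmx (S x y)) -> (forall x y, psdmx (1%:M - S x y)) ->
  (forall x, good x -> \sum_y cond p x y * rtr ((1%:M - S x y) *m B x y) <= e0) ->
  (forall x, good x -> ((L * K)%:R - 1) *
     (\sum_y cond p x y * rtr (S x y *m \sum_z (toC (cond p x z) *: B x z))) <= b0) ->
  (forall x, good x -> \sum_(y : {ffun 'I_L * 'I_K -> 'I_nY})
     prodw (cond p x) y * secrecy (E x) (omega x) y <= u) ->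
  (forall r, 0 < r < M%:R -> exists T : 'I_nX -> 'M[C]_d,
    [/\ forall x, psdmx (T x), forall x, psdmx (1%:M - T x),
     \sum_x rtr ((1%:M - T x) *m \sum_y toC (p x y) *: B x y) <= e0 &
     r * (\sum_x marg p x * rtr (T x *m \sum_z \sum_y toC (p z y) *: B z y)) <= b0]) ->
  0 < c -> 0 < a -> a ^+ 2 = eps -> 0 < u < 1 -> u + 2 * a + 2 * eps < 1 ->
  0 <= e0 -> 0 <= b0 -> (1 + c) * e0 + (2 + c + c^-1) * b0 = eps ->
  exists (xm : 'I_M -> 'I_nX) (ym : 'I_M -> {ffun 'I_L * 'I_K -> 'I_nY})
    (dec : 'I_M -> 'I_L -> 'M[C]_d),
  [/\ forall m l, psdmx (dec m l), \sum_m \sum_l dec m l = 1%:M,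
    forall m, good (xm m) /\ secrecy (E (xm m)) (omega (xm m)) (ym m) <= u + 2 * a + 2 * eps &
    \sum_m \sum_l (M%:R * L%:R)^-1 *
      (1 - rtr (dec m l *m (toC K%:R^-1 *: \sum_k B (xm m) (ym m (l, k))))) <=
      u + 2 * a + 3 * eps].
Proof.
move=> M0 L0 K0 p0 p1 hB gpos hgood hS hS1 priv1 priv2 hsec hpub c0 a0 ae u01 S1 e00 b00 hcb.
have [u0 u1] := andP u01.
pose Sm := u + 2 * a + 2 * eps; pose w := 1 - u; pose g := 1 - u / Sm.
pose h := \sum_(x | good x) marg p x.
have MR : (0 : R) < M%:R by rewrite ltr0n.
have LR : (0 : R) < L%:R by rewrite ltr0n.
have KR : (0 : R) < K%:R by rewrite ltr0n.
have eps0 : 0 < eps by rewrite -ae exprn_gt0.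
pose al := 1 + c; pose ga := 2 + c + c^-1.
have al0 : 0 <= al by rewrite addr_ge0 ?ltW.
have ga0 : 0 <= ga by rewrite !addr_ge0 ?invr_ge0 ?ltW.
have [h0 g0 w0 hrate] := rate_arith a0 ae u01 (erefl Sm) S1 (erefl w) hgood (erefl g)
  (mulr_ge0 al0 e00) (mulr_ge0 ga0 b00) hcb.
have w1 : w < 1 by rewrite /w; lra.
(* The ceiling of [w M]; a decodable message has [N - 1] competitors. *)
have [N [NM Nw N1w N0]] : exists N : nat, [/\ (N <= M)%N, w * M%:R <= N%:R,
    N%:R - 1 < w * M%:R & (0 < N)%N].
  have ex : exists n : nat, w * M%:R <= n%:R.
    by exists M; rewrite ler_piMl // ltW.
  have N0 : (0 < ex_minn ex)%N.
    case: ex_minnP => -[|n] // hn _; move: hn; rewrite leNgt pmulr_rgt0 //.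
    by rewrite MR.
  exists (ex_minn ex); move: N0; case: ex_minnP => n hn hmin n0; split=> //.
    by apply: hmin; rewrite ler_piMl // ltW.
  rewrite ltNge; apply/negP => hle.
  have := hmin n.-1; rewrite -subn1 natrB // => /(_ hle).
  by rewrite subn1 leqNgt prednK // leqnn.
have NR : (0 : R) < N%:R by rewrite ltr0n.
(* Strictly between [(N - 1) / w] and [M]: tests exist only below [M], and exceeding the lower end
   gives [(N - 1) beta <= w b0]. *)
pose r := ((N%:R - 1) / w + M%:R) / 2.
have r1 : (N%:R - 1) / w < M%:R by rewrite ltr_pdivrMr // mulrC.
have N10 : 0 <= N%:R - 1 :> R by rewrite subr_ge0 ler1n.
have rM : 0 < r < M%:R.
  have : 0 <= (N%:R - 1) / w by rewrite divr_ge0 // ltW.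
  by move=> ?; rewrite /r; apply/andP; split; lra.
have [T [hT hT1 pub1 pub2]] := hpub r rM.
pose beta := \sum_x marg p x * rtr (T x *m \sum_z \sum_y toC (p z y) *: B z y).
rewrite -/beta in pub2.
have hBtot x : psdmx (\sum_y toC (p x y) *: B x y).
  by apply: psdmx_sum => y _; exact: psdmxZ (p0 x y) (hB x y).1.
have hBtot2 : psdmx (\sum_z \sum_y toC (p z y) *: B z y).
  by apply: psdmx_sum => z _; exact: hBtot.
have beta0 : 0 <= beta.
  by apply: sumr_ge0 => x _; rewrite mulr_ge0 ?marg_ge0 //; exact: rtr_mul_ge0.
have hbeta : (N%:R - 1) * beta <= w * b0.
  apply: (@le_trans _ _ (w * (r * beta))); last by rewrite ler_pM2l.
  rewrite mulrA ler_wpM2r // mulrC -ler_pdivrMr //.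
  by rewrite /r; lra.
pose I := ('I_L * 'I_K)%type.
have cardI : #|{: I}| = (L * K)%N by rewrite card_prod !card_ord.
have I0 : (0 < #|{: I}|)%N by rewrite cardI muln_gt0 L0.
have IR : (0 : R) < #|{: I}|%:R by rewrite ltr0n.
have sec0 x (y : {ffun I -> 'I_nY}) : 0 <= secrecy (E x) (omega x) y.
  rewrite mulr_ge0 ?invr_ge0 // sumr_ge0 // => l _.
  by rewrite mulr_ge0 ?invr_ge0 // trnorm_ge0.
have uS : 0 < u < Sm by rewrite u0 /Sm; lra.
have q0 x := cond_ge0 p0 x.
have q1 x : good x -> \sum_y cond p x y = 1 by move=> gx; apply: cond_sum (gpos x gx).
have [Q [Q0 Q1 Qpos QF QX]] := expurgated_distribution (good := good)
  (m := marg p) (pr := fun x => prodw (cond p x) (I := I))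
  (sec := fun x y => secrecy (E x) (omega x) y) (u := u) (S := Sm)
  (marg_ge0 p0) (fun x => prodw_ge0 (q0 x)) (fun x gx => prodw_sum I (q1 x gx))
  sec0 hsec uS h0.
rewrite -/h -/g in QF QX.
(* [F] is the cost of a codeword by itself, with weight 3 on the public rejection and 2 on the
   private decoding; [G] is the false acceptance of [t] by the public test of [s]. *)
pose F (t : 'I_nX * {ffun I -> 'I_nY}) : R :=
  3 * al * (#|{: I}|%:R^-1 * \sum_i rtr ((1%:M - T t.1) *m B t.1 (t.2 i))) +
  2 * hncost al ga (S t.1) (B t.1) t.2.
pose G (s t : 'I_nX * {ffun I -> 'I_nY}) : R :=
  3 * ga * (#|{: I}|%:R^-1 * \sum_i rtr (T s.1 *m B t.1 (t.2 i))).
have rT x y z : 0 <= rtr (T x *m B y z) := rtr_mul_ge0 (hT x) (hB y z).1.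
have rT1 x y z : 0 <= rtr ((1%:M - T x) *m B y z) := rtr_mul_ge0 (hT1 x) (hB y z).1.
have hn0 t : 0 <= hncost al ga (S t.1) (B t.1) t.2.
  rewrite /hncost mulr_ge0 ?invr_ge0 // sumr_ge0 // => i _.
  rewrite addr_ge0 ?mulr_ge0 //; first exact: rtr_mul_ge0 (hS1 _ _) (hB _ _).1.
  by apply: sumr_ge0 => j _; exact: rtr_mul_ge0 (hS _ _) (hB _ _).1.
have F0 t : 0 <= F t.
  apply: addr_ge0; last by apply: mulr_ge0.
  apply: mulr_ge0; first by apply: mulr_ge0.
  by apply: mulr_ge0; [rewrite invr_ge0 | apply: sumr_ge0].
have G0 s t : 0 <= G s t.
  apply: mulr_ge0; first by apply: mulr_ge0.
  by apply: mulr_ge0; [rewrite invr_ge0 | apply: sumr_ge0].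
have hg0 : 0 < h * g by rewrite mulr_gt0.
have pc x y : good x -> marg p x * cond p x y = p x y.
  by move=> gx; rewrite mulrC divfK // gt_eqF // gpos.
have EF : \sum_t Q t * F t <= 3 * (al * e0 / (h * g)) + 2 * (eps / g).
  apply: le_trans (QF F F0) _.
  have -> : 3 * (al * e0 / (h * g)) + 2 * (eps / g) = (h * g)^-1 * (3 * al * e0 + h * (2 * eps)).
    by field; rewrite ?gt_eqF.
  rewrite ler_pM2l ?invr_gt0 //.
  apply: (@le_trans _ _ (\sum_(x | good x) (3 * al * (rtr ((1%:M - T x) *m \sum_y toC (p x y) *: B x y)) +
       marg p x * (2 * eps)))).
    apply: ler_sum => x gx.
    have -> : \sum_y prodw (cond p x) y * F (x, y) =
       3 * al * (\sum_y cond p x y * rtr ((1%:M - T x) *m B x y)) +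
       2 * (\sum_(y : {ffun I -> 'I_nY}) prodw (cond p x) y * hncost al ga (S x) (B x) y).
      rewrite -(prodw_avg (fun y => rtr ((1%:M - T x) *m B x y)) I0 (q1 x gx)).
      rewrite !mulr_sumr -big_split; apply: eq_bigr => y _ /=.
      by rewrite /F /= mulrDr mulrCA [prodw _ _ * (2 * _)]mulrCA.
    rewrite mulrDr; apply: lerD.
      rewrite mulrCA le_eqVlt; apply/orP; left; apply/eqP; congr (_ * _).
      rewrite mulr_sumr mulmx_sumr rtr_sum; apply: eq_bigr => y _.
      by rewrite mulrA pc // -scalemxAr rtrZ.
    rewrite ler_wpM2l ?marg_ge0 // ler_pM2l // -hcb.
    apply: (hncost_average I0 (q0 x) (q1 x gx) al0 ga0 (priv1 x gx)).
    by rewrite cardI; exact: priv2.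
  rewrite big_split -mulr_suml -/h; apply: lerD => //.
  rewrite -mulr_sumr ler_wpM2l ?mulr_ge0 //.
  apply: le_trans pub1; rewrite [X in _ <= X](bigID good) /= lerDl.
  by apply: sumr_ge0 => x _; exact: rtr_mul_ge0 (hT1 x) (hBtot x).
have EG : \sum_s \sum_t Q s * Q t * G s t <= 3 * ga * beta / (h ^+ 2 * g).
  apply: (@le_trans _ _ (\sum_s Q s * ((h * g)^-1 * (3 * ga) *
      rtr (T s.1 *m \sum_z \sum_y toC (p z y) *: B z y)))).
    apply: ler_sum => s _; rewrite (eq_bigr (fun t => Q s * (Q t * G s t))); last first.
      by move=> t _; rewrite mulrA.
    rewrite -mulr_sumr ler_wpM2l //.
    apply: le_trans (QF (G s) (G0 s)) _; rewrite -mulrA ler_pM2l ?invr_gt0 //.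
    rewrite mulmx_sumr rtr_sum mulr_sumr [X in _ <= X](bigID good) /=.
    rewrite -[X in X <= _]addr0; apply: lerD.
      apply: ler_sum => x gx.
      have -> : \sum_y prodw (cond p x) y * G s (x, y) =
         3 * ga * (\sum_y cond p x y * rtr (T s.1 *m B x y)).
        rewrite -(prodw_avg (fun y => rtr (T s.1 *m B x y)) I0 (q1 x gx)).
        by rewrite mulr_sumr; apply: eq_bigr => y _; rewrite /G /= mulrCA.
      rewrite mulrCA le_eqVlt; apply/orP; left; apply/eqP; congr (_ * _).
      rewrite mulr_sumr mulmx_sumr rtr_sum; apply: eq_bigr => y _.
      by rewrite mulrA pc // -scalemxAr rtrZ.
    by apply: sumr_ge0 => x _; rewrite !mulr_ge0 //; exact: rtr_mul_ge0 (hT _) (hBtot x).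
  (* The test of [s] sees only its symbol, so the exact law of the symbol applies and [s]
     contributes only [1 / h]. *)
  rewrite (QX (fun x => (h * g)^-1 * (3 * ga) * rtr (T x *m \sum_z \sum_y toC (p z y) *: B z y))).
  have -> : 3 * ga * beta / (h ^+ 2 * g) = h^-1 * ((h * g)^-1 * (3 * ga) * beta).
    by field; rewrite ?gt_eqF.
  rewrite ler_pM2l ?invr_gt0 //.
  rewrite (eq_bigr (fun x => (h * g)^-1 * (3 * ga) *
     (marg p x * rtr (T x *m \sum_z \sum_y toC (p z y) *: B z y)))); last first.
    by move=> x _; rewrite mulrCA.
  rewrite -mulr_sumr ler_wpM2l ?mulr_ge0 ?invr_ge0 ?(ltW hg0) //.
  rewrite /beta [X in _ <= X](bigID good) /= lerDl.
  by apply: sumr_ge0 => x _; rewrite mulr_ge0 ?marg_ge0 //; exact: rtr_mul_ge0 (hT x) hBtot2.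
have [Cb [Cpos Ccost]] := codebook_exists Q0 Q1 NM EF EG.
pose x m := (Cb m).1; pose y m := (Cb m).2.
(* The zero test gives up the messages from [N] on, and in return they cause no false acceptance. *)
pose A (m : 'I_M) : 'M[C]_d := if (m < N)%N then T (x m) else 0.
have hA m : psdmx (A m) by rewrite /A; case: ifP => _; [exact: hT | exact: psdmx0].
have hA1 m : psdmx (1%:M - A m).
  by rewrite /A; case: ifP => _; [exact: hT1 | rewrite subr0; exact: psdmx1].
have [D [hD hD1 errD]] := decoder (S := fun m i => S (x m) (y m i)) c0 hA hA1
   (fun m i => hS _ _) (fun m i => hS1 _ _).
pose Z : 'M[C]_d := 1%:M - \sum_m \sum_l D m l.
pose m0 := Ordinal M0; pose l0 := Ordinal L0.
(* The defect of the sub-measurement goes to an arbitrary outcome, which can only raise success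
   probabilities. *)
pose dec (m : 'I_M) (l : 'I_L) : 'M[C]_d := D m l + (if (m == m0) && (l == l0) then Z else 0).
exists x, y, dec; split.
- move=> m l; apply: psdmxD; first exact: hD.
  by case: ifP => _; [exact: hD1 | exact: psdmx0].
- rewrite /dec (eq_bigr (fun m => \sum_l D m l + (if m == m0 then Z else 0))).
    by rewrite big_split /= -big_mkcond big_pred1_eq /Z addrC subrK.
  move=> m _; rewrite big_split /=; congr (_ + _).
  case: (m == m0) => /=; last by rewrite big1.
  by rewrite -big_mkcond big_pred1_eq.
- by move=> m; have := Qpos _ (Cpos m).
pose rho m (i : I) := B (x m) (y m i).
have srho m l : rtr (toC K%:R^-1 *: \sum_k rho m (l, k)) = 1.
  rewrite rtrZ rtr_sum (eq_bigr (fun=> 1)); last by move=> k _; exact: rtr_state (hB _ _).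
  by rewrite sumr_const card_ord mulVf // gt_eqF.
pose err m := \sum_l (1 - rtr (D m l *m (toC K%:R^-1 *: \sum_k rho m (l, k)))).
have dec_err : \sum_m \sum_l (M%:R * L%:R)^-1 *
      (1 - rtr (dec m l *m (toC K%:R^-1 *: \sum_k rho m (l, k)))) <=
    (M%:R * L%:R)^-1 * \sum_m err m.
  rewrite mulr_sumr; apply: ler_sum => m _; rewrite mulr_sumr; apply: ler_sum => l _.
  apply: ler_wpM2l; first by rewrite invr_ge0 mulr_ge0 // ltW.
  rewrite lerD2l lerN2.
  apply: rtr_mul_le.
    by rewrite /dec addrAC subrr add0r; case: ifP => _; [exact: hD1 | exact: psdmx0].
  apply: psdmxZ; first by rewrite invr_ge0 ltW.
  by apply: psdmx_sum => k _; exact: (hB _ _).1.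
apply: le_trans dec_err _.
have err1 m : err m <= L%:R.
  rewrite -[X in _ <= X]mulr1 mulr_natl -[X in _ *+ X](card_ord L) -sumr_const.
  apply: ler_sum => l _; rewrite lerBlDr lerDl; apply: rtr_mul_ge0; first exact: hD.
  apply: psdmxZ; first by rewrite invr_ge0 ltW.
  by apply: psdmx_sum => k _; exact: (hB _ _).1.
have errN (m : 'I_M) : (m < N)%N -> err m <= L%:R * (F (Cb m) +
    \sum_(k < M | (k < N)%N && (k != m)) G (Cb k) (Cb m)).
  move=> mN.
  have -> : err m = K%:R^-1 * \sum_l rtr ((1%:M - D m l) *m \sum_k rho m (l, k)).
    rewrite mulr_sumr; apply: eq_bigr => l _.
    by rewrite -rtrZ scalemxAr mulmxBl mul1mx rtrB srho.
  rewrite ler_pdivrMl //.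
  apply: le_trans (errD m (rho m) (fun i => (hB _ _).1)) _.
  have -> : K%:R * (L%:R * (F (Cb m) + \sum_(k < M | (k < N)%N && (k != m)) G (Cb k) (Cb m))) =
     #|{: I}|%:R * F (Cb m) + \sum_(k < M | (k < N)%N && (k != m)) #|{: I}|%:R * G (Cb k) (Cb m).
    by rewrite -[X in _ = _ + X]mulr_sumr cardI natrM; ring.
  have -> : #|{: I}|%:R * F (Cb m) = 3 * (al * \sum_i rtr ((1%:M - T (x m)) *m rho m i)) +
      2 * \sum_i (al * rtr ((1%:M - S (x m) (y m i)) *m rho m i) +
     ga * \sum_(j | j != i) rtr (S (x m) (y m j) *m rho m i)).
    rewrite /F /hncost /rho /x /y; field; by rewrite gt_eqF.
  have -> : \sum_(k < M | (k < N)%N && (k != m)) #|{: I}|%:R * G (Cb k) (Cb m) =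
      3 * (ga * \sum_i \sum_(j < M | j != m) rtr (A j *m rho m i)).
    rewrite exchange_big mulr_sumr mulr_sumr big_mkcond [RHS]big_mkcond /=.
    apply: eq_bigr => k _; rewrite /A; case: (k != m); rewrite ?andbF //=.
    rewrite andbT; case: ifP => _; last first.
      by rewrite big1 ?mulr0 // => i _; rewrite mul0mx rtr0.
    by rewrite /G /rho /x /y; field; rewrite gt_eqF.
  rewrite big_split /= -!mulr_sumr big_split /= -!mulr_sumr.
  have -> : A m = T (x m) by rewrite /A mN.
  rewrite -/al -/ga; lra.
set Fail := 3 * (al * e0 / (h * g)) + 2 * (eps / g) + (N%:R - 1) * (3 * ga * beta / (h ^+ 2 * g)).
have hFail : w * Fail <= 2 * a + 2 * eps.
  apply: le_trans hrate; rewrite ler_pM2l // /Fail.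
  have hhg : 0 < h ^+ 2 * g by rewrite mulr_gt0 // exprn_gt0.
  have : ga * ((N%:R - 1) * beta) / (h ^+ 2 * g) <= ga * (w * b0) / (h ^+ 2 * g).
    by rewrite ler_pM2r ?invr_gt0 // ler_wpM2l.
  have -> : (N%:R - 1) * (3 * ga * beta / (h ^+ 2 * g)) =
     3 * (ga * ((N%:R - 1) * beta) / (h ^+ 2 * g)) by ring.
  lra.
(* This makes the final bound decreasing in [N], so that [w M <= N] can be used. *)
have Fail1 : Fail <= 1.
  rewrite -(ler_pM2l w0) mulr1; apply: le_trans hFail _; rewrite /w; lra.
have hsum : \sum_m err m <= L%:R * (N%:R * Fail + (M%:R - N%:R)).
  rewrite (bigID (fun m : 'I_M => (m < N)%N)) /= mulrDr; apply: lerD.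
    apply: le_trans (ler_sum _ _) _; first by move=> m; exact: errN.
    by rewrite -mulr_sumr ler_pM2l //; move: Ccost; rewrite /Fail; lra.
  apply: (@le_trans _ _ (\sum_(m < M | ~~ (m < N)%N) L%:R)); first by apply: ler_sum.
  rewrite -[X in \sum_(m | _) X]mulr1 -mulr_sumr ler_pM2l // lerBrDr.
  have -> : N%:R = \sum_(m < M | (m < N)%N) 1 :> R.
    by rewrite -(big_ord_widen M (fun=> (1 : R)) NM) sumr_const card_ord.
  have : \sum_(m < M) (1 : R) = M%:R by rewrite sumr_const card_ord.
  by rewrite (bigID (fun m : 'I_M => (m < N)%N)) /= addrC => ->.
rewrite ler_pdivrMl ?mulr_gt0 //; apply: le_trans hsum _.
rewrite [M%:R * _]mulrC -mulrA ler_pM2l //.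
have : (1 - Fail) * (w * M%:R) <= (1 - Fail) * N%:R by rewrite ler_wpM2l // subr_ge0.
have := ler_wpM2l (ltW MR) hFail.
have e : eps * M%:R = M%:R * eps by ring.
rewrite /w; have : 0 <= M%:R * eps by rewrite mulr_ge0 ?ltW.
lra.
Qed.

End Coding.

(** * From entropies to codes *)

Section Assembly.
Variable R : realType.
Local Notation C := (R[i]).
Local Notation toC := (@toC R).
Local Notation adj := (@adjmx R _ _).

Lemma idtens_ccq nX nY d k (f : 'M[C]_d -> 'M[C]_k) (p : 'I_nX -> 'I_nY -> R)
    (G : 'I_nX -> 'I_nY -> 'M[C]_d) : f 0 = 0 -> (forall a A, f (a *: A) = a *: f A) ->
  idtens (idtens f) (ccq p G) = ccq p (fun x y => f (G x y)).
Proof.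
move=> f0 fZ; have g0 : idtens f (0 : 'M[C]_(nY * d)) = 0.
  by apply: big1 => i _; apply: big1 => j _; rewrite blk0 f0 tensmx0.
rewrite /ccq idtens_cq //; apply: eq_cq => x /=.
by rewrite idtens_cq //; apply: eq_cq => y /=; rewrite fZ.
Qed.

Lemma tensmxZr m n k l (a : C) (A : 'M[C]_(m, n)) (B : 'M[C]_(k, l)) :
  tensmx A (a *: B) = a *: tensmx A B.
Proof. by apply/matrixP => i j; rewrite !mxE mulrCA. Qed.

Lemma tensmx_sumr m n k l (I : finType) (A : 'M[C]_(m, n)) (F : I -> 'M[C]_(k, l)) :
  tensmx A (\sum_i F i) = \sum_i tensmx A (F i).
Proof.
by apply/matrixP => i j; rewrite summxE !mxE summxE mulr_sumr; apply: eq_bigr => x _; rewrite !mxE.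
Qed.

Lemma rhoXYBE_ccq dA dB dE nX nY (V : 'M[C]_(dB * dE, dA)) (p : 'I_nX -> 'I_nY -> R)
    (rhoA : 'I_nX -> 'I_nY -> 'M[C]_dA) :
  rhoXYBE V p rhoA = ccq p (fun x y => chan V (rhoA x y)).
Proof.
apply: eq_bigr => x _; rewrite /cq tensmx_sumr; apply: eq_bigr => y _.
by rewrite !tensmxZr.
Qed.

Lemma public_rate_lt (x l : R) (I : \bar R) : (x%:E <= I - l%:E)%E ->
  forall z, z < x -> ((z + l)%:E < I)%E.
Proof.
case: I => [i||] //=; last by move=> _ z _; rewrite ltry.
by rewrite -EFinB lee_fin => h z zx; rewrite lte_fin; lra.
Qed.

(** [0 <= J] excludes [-oo], and [J = +oo] would make the right side [-oo] even for [I = +oo]; so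
    [J] is finite, while [I] may be infinite. *)
Lemma private_rate_lt (x l k : R) (I J : \bar R) : (0 <= J)%E ->
  (x%:E <= I - J - l%:E - k%:E)%E ->
  exists2 j, J = j%:E & forall z, z < x -> ((z + j + l + k)%:E < I)%E.
Proof.
case: J => [j||] // j0; last by case: I.
case: I => [i||] //= h; exists j => // z zx; last by rewrite ltry.
by move: h; rewrite -!EFinB lee_fin lte_fin; lra.
Qed.

Lemma povm_error n (M L : nat) (dec : 'I_M -> 'I_L -> 'M[C]_n) (rho : 'M[C]_n) m l :
  \sum_m \sum_l dec m l = 1%:M -> rtr rho = 1 ->
  \sum_(m' < M) \sum_(l' < L | (m', l') != (m, l)) reC (\tr (dec m' l' *m rho)) =
    1 - rtr (dec m l *m rho).
Proof.
move=> h1 h2.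
have -> : 1 = \sum_i \sum_j rtr (dec i j *m rho).
  rewrite -h2 -[in LHS](mul1mx rho) -h1 mulmx_suml rtr_sum.
  by apply: eq_bigr => i _; rewrite mulmx_suml rtr_sum.
rewrite pair_big_dep /= pair_big /= [X in _ = X - _](bigD1 (m, l)) //= addrAC subrr add0r.
by apply: eq_bigl => -[i j].
Qed.

(** Both states are block diagonal in the private message, so the trace norm splits into an average
    over it, as in [secrecy]. *)
Lemma secrecy_le (L d : nat) (tau : 'I_L -> 'M[C]_d) (sigma : 'M[C]_d) (rhoLE : 'M[C]_(L * d)) :
  (forall l, is_state (tau l)) ->
  rhoLE = \sum_(l < L) toC L%:R^-1 *: tensmx (delta_mx l l) (tau l) ->
  2^-1 * trnorm (rhoLE - tensmx (ptrace2 rhoLE) sigma) <=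
    L%:R^-1 * \sum_l 2^-1 * trnorm (tau l - sigma).
Proof.
move=> ht e.
have {e}-> : rhoLE = cq (fun l => toC L%:R^-1 *: tau l).
  by rewrite e; apply: eq_bigr => l _; rewrite tensmxZr.
rewrite (ptrace2_cq (p := fun=> L%:R^-1)); last first.
  by move=> l; rewrite mxtraceZ (ht l).2 mulr1.
rewrite tens_cstate_cq.
have -> : cq (fun l => toC L%:R^-1 *: tau l) - cq (fun=> toC L%:R^-1 *: sigma) =
    cq (fun l => toC L%:R^-1 *: (tau l - sigma)).
  by apply: mxtens_inj => i j; rewrite blkB !blk_cq -scalerBr -scalerBr.
rewrite -mulr_sumr mulrCA ler_pM2l ?invr_gt0 // mulr_sumr.
apply: le_trans (trnorm_cq_le _) _; apply: ler_sum => l _.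
by apply: trnormZ; rewrite invr_ge0.
Qed.

Lemma chan_avg dA dBE (V : 'M[C]_(dBE, dA)) (I : finType) (a : R) (F : I -> 'M[C]_dA) :
  chan V (toC a *: \sum_i F i) = toC a *: \sum_i chan V (F i).
Proof. by rewrite /chan -scalemxAr -scalemxAl mulmx_sumr mulmx_suml. Qed.

Lemma ptrace2_avg m n (I : finType) (a : R) (F : I -> 'M[C]_(m * n)) :
  ptrace2 (toC a *: \sum_i F i) = toC a *: \sum_i ptrace2 (F i).
Proof. by rewrite ptrace2Z (big_morph _ (@ptrace2D _ m n) (@ptrace20 _ m n)). Qed.

Lemma ptrace1_avg m n (I : finType) (a : R) (F : I -> 'M[C]_(m * n)) :
  ptrace1 (toC a *: \sum_i F i) = toC a *: \sum_i ptrace1 (F i).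
Proof. by rewrite ptrace1Z (big_morph _ (@ptrace1D _ m n) (@ptrace10 _ m n)). Qed.

Lemma state_avg n K (F : 'I_K -> 'M[C]_n) : (0 < K)%N -> (forall k, is_state (F k)) ->
  is_state (toC K%:R^-1 *: \sum_k F k).
Proof.
move=> K0 hF; split.
  apply: psdmxZ; first by rewrite invr_ge0.
  by apply: psdmx_sum => k _; exact: (hF k).1.
rewrite mxtraceZ raddf_sum (eq_bigr (fun=> toC 1)); last by move=> k _; exact: (hF k).2.
rewrite -toC_sum sumr_const card_ord -toCM mulVf //.
by rewrite pnatr_eq0 -lt0n.
Qed.

Lemma constant_code dA dB dE (V : 'M[C]_(dB * dE, dA)) (M L : nat) (rho : 'M[C]_dA) (e1 e2 : R) :
  is_isometry V -> (0 < M)%N -> (0 < L)%N -> is_state rho -> 1 <= e1 -> 0 <= e2 ->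
  exists (enc : 'I_M -> 'I_L -> 'M[C]_dA) (dec : 'I_M -> 'I_L -> 'M[C]_dB),
    is_pp_code V enc dec e1 e2.
Proof.
move=> hV M0 L0 hr h1 h2; pose m0 := Ordinal M0; pose l0 := Ordinal L0.
pose dec (m : 'I_M) (l : 'I_L) : 'M[C]_dB := if (m == m0) && (l == l0) then 1%:M else 0.
have hc := state_chan hV hr; have hB := state_ptrace2 hc; have hE := state_ptrace1 hc.
have decp m l : psdmx (dec m l).
  by rewrite /dec; case: ifP => _; [exact: psdmx1 | exact: psdmx0].
have decs : \sum_m \sum_l dec m l = 1%:M.
  rewrite (bigD1 m0) //= (bigD1 l0) //= /dec !eqxx /= big1 ?addr0; last first.
    by move=> l /negbTE ->.
  by rewrite big1 ?addr0 // => m /negbTE ->; apply: big1.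
exists (fun _ _ => rho), dec; split; [by [] | split; [exact: decp | split; [exact: decs | split]]].
  apply: le_trans h1; have ML : (0 : R) < M%:R * L%:R by rewrite mulr_gt0 ?ltr0n.
  apply: (@le_trans _ _ (\sum_(m < M) \sum_(l < L) (M%:R * L%:R)^-1)).
    apply: ler_sum => m _; apply: ler_sum => l _.
    rewrite -[X in _ <= X]mulr1; apply: ler_wpM2l; first by rewrite invr_ge0 ltW.
    rewrite (povm_error _ _ decs (rtr_state hB)) lerBlDr lerDl.
    exact: rtr_mul_ge0 (decp m l) hB.1.
  rewrite !sumr_const !card_ord -mulrnA -[X in X <= _]mulr_natr natrM [L%:R * _]mulrC.
  by rewrite mulVf // gt_eqF.
move=> m rhoLE; exists (ptrace1 (chan V rho)); split; first exact: hE.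
apply: le_trans (secrecy_le _ (fun=> hE) (erefl _)) _.
rewrite big1 ?mulr0 // => l _; by rewrite subrr trnorm0 mulr0.
Qed.

End Assembly.

(** * Tests and smoothed states extracted from the rate conditions *)

Section Resources.
Variable R : realType.
Local Notation C := (R[i]).
Local Notation toC := (@toC R).
Local Notation adj := (@adjmx R _ _).

Lemma public_tests nX nY d (p : 'I_nX -> 'I_nY -> R) (G : 'I_nX -> 'I_nY -> 'M[C]_d)
    (M : nat) (eta b0 : R) :
  (forall x y, 0 <= p x y) -> (forall x y, is_state (G x y)) -> (0 < M)%N ->
  0 <= eta -> 0 < b0 ->
  ((log2 M%:R)%:E <= IH eta (cq (fun x => \sum_y toC (p x y) *: G x y)%R)
     - (log2 b0^-1)%:E)%E ->
  forall r, 0 < r < M%:R -> exists T : 'I_nX -> 'M[C]_d,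
    [/\ forall x, psdmx (T x), forall x, psdmx (1%:M - T x),
     \sum_x rtr ((1%:M - T x) *m \sum_y toC (p x y) *: G x y) <= eta &
     r * (\sum_x marg p x * rtr (T x *m \sum_z \sum_y toC (p z y) *: G z y)) <= b0].
Proof.
move=> p0 hG M0 eta0 b00 h r /andP[r0 rM].
have rb : 0 < r / b0 by rewrite divr_gt0.
have /(IH_test (p := marg p) _ _ eta0 rb)[||T [h1 h2 h3 h4]] :
    ((log2 (r / b0))%:E < IH eta (cq (fun x => \sum_y toC (p x y) *: G x y)%R))%E.
- rewrite log2M ?invr_gt0 //; apply: (public_rate_lt h).
  by rewrite ltr_log2 // (lt_trans r0).
- by move=> x; apply: psdmx_sum => y _; exact: psdmxZ (p0 x y) (hG x y).1.
- move=> x; rewrite raddf_sum toC_sum; apply: eq_bigr => y _.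
  by rewrite /= mxtraceZ (hG x y).2 mulr1.
exists T; split; [exact: h1 | exact: h2 | exact: h3 |].
by move: h4; rewrite mulrAC ler_pdivrMr // mul1r.
Qed.

Lemma complement_mass_ge (e1 e2 s1 s2 s3 s4 : R) :
  s1 <= e1 -> s2 <= e2 -> s3 <= s1 + s2 -> s4 + s3 = 1 -> 1 - e1 - e2 <= s4.
Proof. lra. Qed.

(* [K] is the number of local randomization indices: [K] is at least half of
   [2^Imax / delta'^2], so that the dummy index hides the private message, and
   at most that, so that the pair (private message, dummy index) is decodable. *)
Lemma private_resources nX nY d dE (p : 'I_nX -> 'I_nY -> R)
    (B : 'I_nX -> 'I_nY -> 'M[C]_d) (E : 'I_nX -> 'I_nY -> 'M[C]_dE)
    (L : nat) (eta eta' delta' b0 : R) :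
  (forall x y, 0 <= p x y) -> \sum_x \sum_y p x y = 1 ->
  (forall x y, is_state (B x y)) -> (forall x y, is_state (E x y)) -> (0 < L)%N ->
  0 <= eta -> 0 < eta' < 1 -> 0 < delta' < 1 -> 0 < b0 ->
  ((log2 L%:R)%:E <= IHcond eta (ccq p B) - Imaxcond eta' (ccq p E)
     - (log2 b0^-1)%:E - (2 * log2 (1 / delta'))%:E)%E ->
  exists (K : nat) (good : pred 'I_nX) (S : 'I_nX -> 'I_nY -> 'M[C]_d)
    (omega : 'I_nX -> 'M[C]_dE),
  [/\ (0 < K)%N, forall x, good x -> 0 < marg p x /\ is_state (omega x),
      1 - eta ^+ 2 - eta' ^+ 2 <= \sum_(x | good x) marg p x,
      (forall x y, psdmx (S x y)) /\ (forall x y, psdmx (1%:M - S x y)) &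
      forall x, good x ->
      [/\ \sum_y cond p x y * rtr ((1%:M - S x y) *m B x y) <= eta,
          ((L * K)%:R - 1) *
     (\sum_y cond p x y * rtr (S x y *m \sum_z (toC (cond p x z) *: B x z))) <= b0 &
      \sum_(y : {ffun 'I_L * 'I_K -> 'I_nY})
     prodw (cond p x) y * secrecy (E x) (omega x) y <= eta' + delta']].
Proof.
move=> p0 p1 hB hE L0 eta0 /andP[et0 et1] /andP[d0 d1] b00 hrate.
have het : 0 <= eta' < 1 by rewrite ltW.
have [j ej hlt] := private_rate_lt (Imaxcond_ge0 p0 p1 hE het) hrate.
have j0 : 0 <= j by have := Imaxcond_ge0 p0 p1 hE het; rewrite ej lee_fin.
have LR : (0 : R) < L%:R by rewrite ltr0n.
pose v0 : R := pow2 j / delta' ^+ 2; pose K := Num.truncn v0.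
have d2 : 0 < delta' ^+ 2 by rewrite exprn_gt0.
(* Truncation thus leaves [K >= 1], and then [v0 < K + 1 <= 2 K]. *)
have v01 : 1 <= v0.
  rewrite ler_pdivlMr // mul1r; apply: (@le_trans _ _ 1).
    by rewrite expr_le1 ?ltW // ltW.
  by rewrite -pow2_0 ler_pow2.
have K0 : (0 < K)%N by rewrite truncn_gt0.
have v0p : 0 < v0 by apply: lt_le_trans v01.
have [Kv vK] : K%:R <= v0 /\ v0 < K%:R + 1.
  by have := truncn_itv (ltW v0p); rewrite -natr1 => /andP[].
have KR : (1 : R) <= K%:R by rewrite ler1n.
have KR0 : (0 : R) < K%:R by rewrite ltr0n.
have LK1 : (1 : R) <= (L * K)%:R by rewrite ler1n muln_gt0 L0.
(* Half a unit below [L K]: strictly smaller, as the test requires, yet at least the number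
   [L K - 1] of competing pairs. *)
pose s : R := (L * K)%:R - 1 / 2.
have s0 : 0 < s by rewrite /s; lra.
have sle : (L * K)%:R - 1 <= s by rewrite /s; lra.
(* The exponent [j + 1] provides the strict inequality for [Imaxcond_lt]; its factor 2 and that of
   [v0 <= 2 K] are absorbed by [(2 delta')^2]. *)
have vK2 : pow2 (j + 1) / K%:R <= (2 * delta') ^+ 2.
  rewrite pow2D pow2_1 ler_pdivrMr //.
  have -> : pow2 j = v0 * delta' ^+ 2 by rewrite /v0 divfK // gt_eqF.
  have : delta' ^+ 2 * v0 <= delta' ^+ 2 * (2 * K%:R).
    by rewrite ler_pM2l //; lra.
  by rewrite exprMn; lra.
have sb : 0 < s / b0 by rewrite divr_gt0.
have hs : ((log2 (s / b0))%:E < IHcond eta (ccq p B))%E.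
  have -> : log2 (s / b0) = (log2 s - j - 2 * log2 (1 / delta')) + j + log2 b0^-1
      + 2 * log2 (1 / delta').
    by rewrite log2M ?invr_gt0 //; ring.
  apply: hlt; apply: (@lt_le_trans _ _ (log2 (L%:R * K%:R) - j - 2 * log2 (1 / delta'))).
    by rewrite !ltrD2r ltr_log2 ?mulr_gt0 // -natrM /s; lra.
  rewrite log2M //; have : log2 K%:R <= log2 v0 by rewrite ler_log2.
  (* The two terms subtracted from the private rate are exactly [log2 v0], which bounds [log2 K]. *)
  have -> : log2 v0 = j + 2 * log2 (1 / delta').
    rewrite /v0 log2M ?pow2_gt0 ?invr_gt0 // log2_pow2 div1r expr2 invfM log2M ?invr_gt0 //.
    by ring.
  lra.
have [p' [dp' hp' HS]] := IHcond_test p0 hB eta0 sb hs.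
have hj : (Imaxcond eta' (ccq p E) < (j + 1)%:E)%E by rewrite ej lte_fin ltrDl.
have [p'' [dp'' hp'' HO]] := Imaxcond_lt p0 hE hj.
pose good : pred 'I_nX := fun x => [&& 0 < p' x, 0 < p'' x & 0 < marg p x].
have /choice [SO HSO] : forall x, exists SO : ('I_nY -> 'M[C]_d) * 'M[C]_dE,
  [/\ forall y, psdmx (SO.1 y), forall y, psdmx (1%:M - SO.1 y) &
   good x -> [/\ is_state SO.2, \sum_y cond p x y * rtr ((1%:M - SO.1 y) *m B x y) <= eta,
     ((L * K)%:R - 1) *
     (\sum_y cond p x y * rtr (SO.1 y *m \sum_z (toC (cond p x z) *: B x z))) <= b0 &
      \sum_(y : {ffun 'I_L * 'I_K -> 'I_nY})
     prodw (cond p x) y * secrecy (E x) SO.2 y <= eta' + delta']].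
  move=> x; have [gx|gx] := boolP (good x); last first.
    exists (fun=> 0, 0); split=> [y|y|//] /=; first exact: psdmx0.
    by rewrite subr0; exact: psdmx1.
  have /and3P[px px' mx] := gx.
  have [S [S0 S1 S2 S3]] := HS x px mx.
  have [rt [srt hrt hv]] := HO x px' mx.
  have [om [th [som hth sth hthv hdist]]] := smoothed_blocks p0 hE et0 mx srt hrt hv.
  exists (S, om); split; [exact: S0 | exact: S1 | move=> _; split].
  - exact: som.
  - exact: S2.
  - move: S3; rewrite mulrAC ler_pdivrMr // mul1r /=; apply: le_trans.
    apply: ler_wpM2r sle.
    apply: sumr_ge0 => y _; apply: mulr_ge0; first exact: cond_ge0.
    apply: rtr_mul_ge0; first exact: S0.
    by apply: psdmx_sum => z _; apply: psdmxZ; [exact: cond_ge0 | exact: (hB x z).1].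
  - apply: (secrecy_average L0 K0 (cond_ge0 p0 x) (cond_sum mx) som hth sth hthv hdist _ d0 vK2).
    by rewrite ltW // pow2_gt0.
exists K, good, (fun x => (SO x).1), (fun x => (SO x).2); split; first exact: K0.
- move=> x gx; have [_ _ /(_ gx)[h _ _ _]] := HSO x.
  by split; [case/and3P: gx | exact: h].
- have h1 := pdist_cstate_support dp' (marg_distr p0 p1) hp'.
  have h2 := pdist_cstate_support dp'' (marg_distr p0 p1) hp''.
  have h3 : \sum_(x | ~~ good x) marg p x <=
     \sum_(x | ~~ (0 < p' x)) marg p x + \sum_(x | ~~ (0 < p'' x)) marg p x.
    rewrite [X in X <= _]big_mkcond [X in _ <= X + _]big_mkcond [X in _ <= _ + X]big_mkcond.
    rewrite -big_split /=; apply: ler_sum => x _; rewrite /good.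
    have mx := marg_ge0 p0 x.
    case: (0 < p' x) => /=; last by rewrite lerDl; case: ifP.
    case: (0 < p'' x) => /=; last by rewrite add0r.
    by rewrite addr0; case: (ltrgt0P (marg p x)) mx => // ->.
  have := (marg_distr p0 p1).2; rewrite (bigID good) /=; exact: complement_mass_ge h1 h2 h3.
- by split=> x y; have [h1 h2 _] := HSO x; [exact: h1 | exact: h2].
- by move=> x gx; have [_ _ /(_ gx)[_ h1 h2 h3]] := HSO x; split; [exact: h1 | exact: h2 | exact: h3].
Qed.

End Resources.

Theorem theorem2 (R : realType) (dA dB dE : nat)
  (V : 'M[R[i]]_(dB * dE, dA)) (hV : is_isometry V)
  (eps eps' delta delta' : R)
  (heps : 0 < eps < 1) (heps' : 0 < eps' < 1)
  (hdelta : 0 < delta < eps) (hdelta' : 0 < delta' < eps')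
  (nX nY : nat) (pXY : 'I_nX -> 'I_nY -> R)
  (hp0 : forall x y, 0 <= pXY x y)
  (hp1 : \sum_(x < nX) \sum_(y < nY) pXY x y = 1)
  (rhoA : 'I_nX -> 'I_nY -> 'M[R[i]]_dA)
  (hrhoA : forall x y, is_state (rhoA x y))
  (nM nL : nat) (hnM : (0 < nM)%N) (hnL : (0 < nL)%N) :
  let rho := rhoXYBE V pXY rhoA in
  let rhoXYB := idtens (idtens (@ptrace2 R dB dE)) rho in
  let rhoXYE := idtens (idtens (@ptrace1 R dB dE)) rho in
  let rhoXB := idtens (@ptrace1 R nY dB) rhoXYB in
  ((log2 nM%:R)%:E <=
     IH (eps - delta) rhoXB - (log2 (4 * eps / delta ^+ 2))%:E)%E ->
  ((log2 nL%:R)%:E <=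
     IHcond (eps - delta) rhoXYB
     - Imaxcond (Num.sqrt eps' - delta') rhoXYE
     - (log2 (4 * eps / delta ^+ 2))%:E
     - (2 * log2 (1 / delta'))%:E)%E ->
  exists (enc : 'I_nM -> 'I_nL -> 'M[R[i]]_dA)
         (dec : 'I_nM -> 'I_nL -> 'M[R[i]]_dB),
    is_pp_code V enc dec
      (3 * eps + 2 * Num.sqrt eps + Num.sqrt eps')
      (2 * (eps + Num.sqrt eps) + Num.sqrt eps').
Proof.
move=> rho rhoXYB rhoXYE rhoXB hr hRt.
have [e0 e1] := andP heps; have [e0' e1'] := andP heps'.
have [d0 de] := andP hdelta; have [d0' de'] := andP hdelta'.
pose u := Num.sqrt eps'; pose a := Num.sqrt eps.
have a0 : 0 < a by rewrite sqrtr_gt0.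
have ae : a ^+ 2 = eps by rewrite sqr_sqrtr // ltW.
have u0 : 0 < u by rewrite sqrtr_gt0.
have ue : u ^+ 2 = eps' by rewrite sqr_sqrtr // ltW.
have u1 : u < 1 by rewrite -sqrtr1 ltr_sqrt.
have eu : eps' < u by rewrite -ue expr2 -[X in _ < X]mulr1 ltr_pM2l.
rewrite -/u -/a.
have [x0 [y0 _]] : exists (x : 'I_nX) (y : 'I_nY), True.
  apply: contrapT => h; move: hp1; rewrite big1 => [/esym/eqP|x _]; first by rewrite oner_eq0.
  by rewrite big1 // => y _; case: h; exists x, y.
have [S1|S1] := leP 1 (u + 2 * a + 2 * eps).
  apply: (constant_code hV hnM hnL (hrhoA x0 y0)); last by rewrite !addr_ge0 ?mulr_ge0 ?addr_ge0 ?ltW.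
  by apply: (le_trans S1); rewrite -subr_ge0 (_ : _ - _ = eps) ?ltW //; ring.
pose rB x y := ptrace2 (chan V (rhoA x y)); pose rE x y := ptrace1 (chan V (rhoA x y)).
have sB x y : is_state (rB x y) by exact/state_ptrace2/state_chan.
have sE x y : is_state (rE x y) by exact/state_ptrace1/state_chan.
have eXYB : rhoXYB = ccq pXY rB.
  rewrite /rhoXYB /rho rhoXYBE_ccq idtens_ccq //; first exact: ptrace20.
  by move=> *; exact: ptrace2Z.
have eXYE : rhoXYE = ccq pXY rE.
  rewrite /rhoXYE /rho rhoXYBE_ccq idtens_ccq //; first exact: ptrace10.
  by move=> *; exact: ptrace1Z.
have eXB : rhoXB = cq (fun x => \sum_y toC (pXY x y) *: rB x y).
  rewrite /rhoXB eXYB /ccq idtens_cq; last exact: ptrace10.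
  by apply: eq_cq => x /=; rewrite ptrace1_cq.
pose b0 := delta ^+ 2 / (4 * eps).
have b00 : 0 < b0 by rewrite divr_gt0 ?exprn_gt0 ?mulr_gt0.
have eb : 4 * eps / delta ^+ 2 = b0^-1 by rewrite invf_div.
rewrite eXB eb in hr; rewrite eXYB eXYE eb in hRt.
have ed0 : 0 <= eps - delta by rewrite subr_ge0 ltW.
have ed1 : 0 < u - delta' < 1.
  by rewrite subr_gt0 (lt_trans de') //= ltrBlDr (lt_trans u1) // ltrDl.
have dd : 0 < delta' < 1 by rewrite d0' (lt_trans de').
have hpub := public_tests hp0 sB hnM ed0 b00 hr.
have [K [good [S [omega [K0 hgood hmass [hS hS1] hpriv]]]]] :=
  private_resources hp0 hp1 sB sE hnL ed0 ed1 dd b00 hRt.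
(* The smoothing radius [u - delta'] and the covering error [delta'] add up to [u], the average
   entering the Markov bound. *)
rewrite subrK in hpriv.
have hmass2 : 1 - eps ^+ 2 - u ^+ 2 <= \sum_(x | good x) marg pXY x.
  apply: le_trans hmass; rewrite -!addrA lerD2l -!opprD lerN2 lerD //.
    by rewrite lerXn2r ?nnegrE ?(ltW e0) // lerBlDr lerDl ltW.
  by rewrite lerXn2r ?nnegrE ?(ltW u0) ?(ltW (andP ed1).1) // lerBlDr lerDl ltW.
(* Here [2 + c + 1 / c = 4 eps^2 / (delta (2 eps - delta))], so with [b0 = delta^2 / (4 eps)] the
   two error terms sum to exactly [eps]. *)
pose c := delta / (2 * eps - delta).
have c0 : 0 < c by rewrite divr_gt0 // subr_gt0 (lt_trans de) // mulr_natl mulr2n ltrDl.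
have hcb : (1 + c) * (eps - delta) + (2 + c + c^-1) * b0 = eps.
  rewrite /c /b0; field; rewrite !gt_eqF //=.
  by rewrite subr_gt0 (lt_trans de) // mulr_natl mulr2n ltrDl.
have u01 : 0 < u < 1 by rewrite u0.
have [xm [ym [dec [hdec hdecs hsec herr]]]] := random_code (E := rE) (omega := omega)
  hnM hnL K0 hp0 hp1 sB (fun x gx => (hgood x gx).1) hmass2 hS hS1
  (fun x gx => let: And3 h _ _ := hpriv x gx in h)
  (fun x gx => let: And3 _ h _ := hpriv x gx in h)
  (fun x gx => let: And3 _ _ h := hpriv x gx in h)
  hpub c0 a0 ae u01 S1 ed0 (ltW b00) hcb.
pose enc m l := toC K%:R^-1 *: \sum_k rhoA (xm m) (ym m (l, k)).
have henc m l : is_state (enc m l) by apply: state_avg.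
have eB m l : ptrace2 (chan V (enc m l)) = toC K%:R^-1 *: \sum_k rB (xm m) (ym m (l, k)).
  by rewrite /enc chan_avg ptrace2_avg.
have eE m l : ptrace1 (chan V (enc m l)) = toC K%:R^-1 *: \sum_k rE (xm m) (ym m (l, k)).
  by rewrite /enc chan_avg ptrace1_avg.
have st m l := state_chan hV (henc m l).
exists enc, dec; split; [exact: henc | split; [exact: hdec | split; [exact: hdecs | split]]].
  have -> : 3 * eps + 2 * a + u = u + 2 * a + 3 * eps by ring.
  apply: le_trans herr; apply: ler_sum => m _; apply: ler_sum => l _.
  by rewrite (povm_error _ _ hdecs (rtr_state (state_ptrace2 (st m l)))) eB.
move=> m rhoLE; have [gm sm] := hsec m; exists (omega (xm m)); split.
  exact: (hgood _ gm).2.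
have -> : 2 * (eps + a) + u = u + 2 * a + 2 * eps by ring.
apply: le_trans sm.
apply: le_trans (secrecy_le _ (fun l => state_ptrace1 (st m l)) (erefl _)) _.
rewrite /secrecy le_eqVlt; apply/orP; left; apply/eqP; congr (_ * _).
by apply: eq_bigr => l _; rewrite eE.
Qed.
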